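(* Assume $M\notin\{0,-2,-4,\dots\}$ and let $l\ge1$ be an integer. Then the superfunction \[ \nu_{2l}^{m|2n}(\mathbf{x})=\pi^n2^{2n}\frac{(n+l-1)!}{(l-1)!}\,\nu_{2l+2n}^{m}(R^2) \] is a fundamental solution of $\nabla^{2l}$, i.e. $\nabla^{2l}\nu_{2l}^{m|2n}=(-1)^l\delta(\mathbf{x})$ in the distributional sense. Equivalently, \[ \nu_{2l}^{m|2n}(\mathbf{x})= \begin{cases} R^{2l-M}/\gamma_{l-1,M}& M\ \text{odd},\\ R^{2l-M}/\gamma'_{l-1,M}& M\ \text{even and}\ l<\frac{M}{2},\\ -R^{2l-M}\log(R)/\gamma'_{l-1,M}&M\ \text{even and}\ l\ge \frac{M}{2}. \end{cases} \]
   Context: Fix integers $m\ge1$, $n\ge0$ and put $M=m-2n$. Let $\Lambda_{2n}$ be the complex Grassmann algebra generated by anticommuting variables ${x\grave{}}_1,\dots,{x\grave{}}_{2n}$; superfunctions are $f=\sum_A{x\grave{}}_Af_A$ with $\mathbb{C}$-valued coefficients on (subsets of) $\mathbb{R}^m$. Bosonic coordinates $\underline x=(x_1,\dots,x_m)$, $r^2=\sum x_i^2$. Fermionic derivatives $\partial_{{x\grave{}}_j}$ commute with the $x_i$ and satisfy $\partial_{{x\grave{}}_j}({x\grave{}}_k g)=\delta_{jk}g-{x\grave{}}_k\partial_{{x\grave{}}_j}g$. Put $\underline{x}\grave{}^2=\sum_{j=1}^n{x\grave{}}_{2j-1}{x\grave{}}_{2j}$, $R^2=r^2-\underline{x}\grave{}^2$,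 and for a smooth $h$ on $(0,\infty)$, $h(R^2)=\sum_{j=0}^n(-1)^j\frac{\underline{x}\grave{}^{2j}}{j!}h^{(j)}(r^2)$; in particular $R^{\beta}$ means $h(R^2)$ with $h(s)=s^{\beta/2}$, and $R^{\beta}\log R$ means $h(R^2)$ with $h(s)=\tfrac12 s^{\beta/2}\log s$. The super Laplace operator is $\nabla^2=\sum_{i=1}^m\partial_{x_i}^2-4\sum_{j=1}^n\partial_{{x\grave{}}_{2j-1}}\partial_{{x\grave{}}_{2j}}$ (acting on coefficients distributionally), and $\delta(\mathbf{x})=\delta(\underline{x})\frac{\pi^n\underline{x}\grave{}^{2n}}{n!}$. For integers $d\ge1$, $j\ge1$, $\nu_{2j}^d$ denotes the radial bosonic fundamental solution of $\nabla_b^{2j}$ on $\mathbb{R}^d$ (i.e. $\nabla_b^{2j}\nu^d_{2j}=(-1)^j\delta$, $\nabla_b^2$ the Laplacian of $\mathbb{R}^d$), written as a function of $r^2$: $\nu^d_{2j}=r^{2j-d}/\gamma_{j-1,d}$ if $d$ is odd, $\nu^d_{2j}=r^{2j-d}/\gamma'_{j-1,d}$ if $d$ is even and $j<d/2$, $\nu^d_{2j}=-r^{2j-d}\log(r)/\gamma'_{j-1,d}$ if $d$ is even and $j\ge d/2$, where $\gamma_{p,d}=2^{2p+1}p!\,\frac{2\pi^{d/2}}{\Gamma(d/2-p-1)}$ (this formula is also used for odd, possibly negative, $d=M$) and $\gamma'_{p,d}$ are the nonzero normalising constants making these bosonic fundamental solutions correct. *)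

(* Defs.v *)
From HB Require Import structures.
From mathcomp Require Import all_boot all_order all_algebra.
From mathcomp Require Import all_classical all_reals all_analysis.
Set Implicit Arguments.
Unset Strict Implicit.
Unset Printing Implicit Defensive.
Import Order.TTheory GRing.Theory Num.Theory.
Import numFieldNormedType.Exports.

Local Open Scope ring_scope.

Section SuperFundSol.
Variable R : realType.

(* Gamma function: Euler integral for z > 0, extended to the negative  *)
(* reals by the functional equation Gamma z = Gamma (z+k) / (z(z+1)..(z+k-1)). *)
Definition Gamma_pos (z : R) : R :=
  Rintegral lebesgue_measure `]0, +oo[%classic
    (fun t : R => t `^ (z - 1) * expR (- t)).

Definition Gamma (z : R) : R :=
  if 0 < z then Gamma_pos z
  else let k := `|Num.floor (- z)|%N.+1 in
       Gamma_pos (z + k%:R) / \prod_(i < k) (z + i%:R).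

Definition gamma_c (p : nat) (d : R) : R :=
  2 ^+ (p.*2.+1) * (p`!)%:R * (2 * pi `^ (d / 2)) / Gamma (d / 2 - p%:R - 1).

(* Lebesgue integral over R^d, written as an iterated integral of
   one-dimensional Lebesgue integrals (equal to the d-dimensional Lebesgue
   integral for integrable functions, by Fubini). *)
Fixpoint iint (d : nat) : ('rV[R]_d -> R) -> R :=
  match d return ('rV[R]_d -> R) -> R with
  | 0 => fun f => f 0
  | d'.+1 => fun f =>
      Rintegral lebesgue_measure setT
        (fun t : R => iint (fun x : 'rV[R]_d' => f (row_mx (const_mx t : 'rV[R]_1) x)))
  end.

Definition ebasis (d : nat) (i : 'I_d) : 'rV[R]_d := delta_mx 0 i.

Fixpoint iD (d : nat) (s : seq 'I_d) (f : 'rV[R]_d -> R) : 'rV[R]_d -> R :=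
  if s is i :: s' then 'D_(ebasis i) (iD s' f) else f.

Definition test_fun (d : nat) (phi : 'rV[R]_d -> R) : Prop :=
  (forall (s : seq 'I_d) (x : 'rV[R]_d), differentiable (iD s phi) x) /\
  compact (closure [set x | phi x != 0]%classic).

Definition lap (d : nat) (phi : 'rV[R]_d -> R) : 'rV[R]_d -> R :=
  fun x => \sum_(i < d) 'D_(ebasis i) ('D_(ebasis i) phi) x.

Definition r2 (d : nat) (x : 'rV[R]_d) : R := \sum_(i < d) x 0 i ^+ 2.

Definition bos_fundsol (d j : nat) (h : R -> R) : Prop :=
  forall phi : 'rV[R]_d -> R, test_fun phi ->
    iint (fun x => h (r2 x) * iter j (@lap d) phi x) = (-1) ^+ j * phi 0.

(* shapes s^{(2j-d)/2}/c  and  -(1/2) s^{(2j-d)/2} log s / c,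
   i.e. r^{2j-d}/c and -r^{2j-d} log r / c written as functions of s = r^2 *)
Definition pow_shape (j : nat) (d : R) (c : R) : R -> R :=
  fun s => s `^ (((j.*2)%:R - d) / 2) / c.
Definition log_shape (j : nat) (d : R) (c : R) : R -> R :=
  fun s => - (s `^ (((j.*2)%:R - d) / 2) * ln s / 2) / c.

Definition even_shape (d j : nat) (c : R) : R -> R :=
  if (j.*2 < d)%N then pow_shape j d%:R c else log_shape j d%:R c.

Definition gammap (p d : nat) : R :=
  xget 1 [set c : R | c != 0 /\ bos_fundsol d p.+1 (even_shape d p.+1 c)].

(* nu^d_{2j} as a function of r^2 *)
Definition nu_b (d j : nat) : R -> R :=
  if odd d then pow_shape j d%:R (gamma_c j.-1 d%:R)
  else even_shape d j (gammap j.-1 d).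

(* Grassmann algebra Lambda_N: an element is the family of its
   coefficients (x`_A, A a subset of {0..N-1}, x`_A the increasingly
   ordered product of the generators indexed by A).                  *)

Definition gsign (N : nat) (B C : {set 'I_N}) : R :=
  (-1) ^+ #|[set p : 'I_N * 'I_N | [&& p.1 \in B, p.2 \in C & (p.2 < p.1)%N]]|.

(* x`_B * x`_C = gsign B C x`_{B u C} for B, C disjoint, 0 otherwise *)
Definition gmul (N : nat) (g h : {set 'I_N} -> R) : {set 'I_N} -> R :=
  fun A => \sum_(B : {set 'I_N} | B \subset A) gsign B (A :\: B) * g B * h (A :\: B).

Definition gone (N : nat) : {set 'I_N} -> R := fun A => (A == finset.set0)%:R.
Definition ggen (N : nat) (i : 'I_N) : {set 'I_N} -> R := fun A => (A == finset.set1 i)%:R.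
Definition gpow (N : nat) (g : {set 'I_N} -> R) (k : nat) : {set 'I_N} -> R :=
  iter k (gmul g) (@gone N).

Lemma odd_idx_proof (n : nat) (j : 'I_n) : ((val j).*2 < n.*2)%N.
Proof. by rewrite ltn_double (ltn_ord j). Qed.
Lemma even_idx_proof (n : nat) (j : 'I_n) : ((val j).*2.+1 < n.*2)%N.
Proof. by rewrite -doubleS leq_double (ltn_ord j). Qed.

(* 0-based indices of x`_{2j-1} and x`_{2j} (j = 1..n) *)
Definition fo (n : nat) (j : 'I_n) : 'I_(n.*2) := Ordinal (odd_idx_proof j).
Definition fe (n : nat) (j : 'I_n) : 'I_(n.*2) := Ordinal (even_idx_proof j).

Definition xsq (n : nat) : {set 'I_(n.*2)} -> R :=
  fun A => \sum_(j < n) gmul (ggen (fo j)) (ggen (fe j)) A.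

Definition superfun (m n : nat) := {set 'I_(n.*2)} -> 'rV[R]_m -> R.

Definition superR2 (m n : nat) (h : R -> R) : superfun m n :=
  fun A x => \sum_(j < n.+1)
     (-1) ^+ j / (j`!)%:R * gpow (@xsq n) j A * iter j (fun g : R -> R => derive1 g) h (r2 x).

(* superdistributions: Lambda_{2n}-valued distributions on R^m,
   given by their action on (real) test functions coefficientwise *)
Definition superdist (m n : nat) := {set 'I_(n.*2)} -> ('rV[R]_m -> R) -> R.

Definition sf_dist (m n : nat) (f : superfun m n) : superdist m n :=
  fun A phi => iint (fun x => f A x * phi x).

(* fermionic derivative d/dx`_j (left derivative) *)
Definition fder (m n : nat) (j : 'I_(n.*2)) (T : superdist m n) : superdist m n :=
  fun A phi => if j \in A then 0
               else (-1) ^+ #|[set a in A | (a < j)%N]| * T (j |: A) phi.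

(* super Laplacian: sum_i d_{x_i}^2 - 4 sum_j d_{x`_{2j-1}} d_{x`_{2j}},
   bosonic part acting distributionally *)
Definition slap (m n : nat) (T : superdist m n) : superdist m n :=
  fun A phi => T A (@lap m phi)
               - 4 * \sum_(j < n) fder (fo j) (fder (fe j) T) A phi.

Definition sdelta (m n : nat) : superdist m n :=
  fun A phi => phi 0 * (pi ^+ n * gpow (@xsq n) n A / (n`!)%:R).

Definition nu_super (m n l : nat) : superfun m n :=
  @superR2 m n (fun s => pi ^+ n * 2 ^+ (n.*2) * ((n + l - 1)`!)%:R / ((l - 1)`!)%:R
                        * nu_b m (l + n) s).

(* the closed form in terms of M = m - 2n (as a function h with R^... = h(R^2)) *)
Definition nu_case (M : int) (l : nat) : R -> R :=
  if odd `|M|%N then pow_shape l M%:~R (gamma_c l.-1 M%:~R)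
  else match M with
       | Posz k => even_shape k l (gammap l.-1 k)
       | Negz _ => fun _ => 0 (* excluded by hypothesis *)
       end.

End SuperFundSol.

(* Main.v *)
(* On radial superfunctions h(R^2) the super Laplacian acts as the radial Laplacian of
   dimension M = m - 2n, turning h into 4 s h'' + 2 M h'. From h(s) = s^(l - M/2), possibly
   with a factor log s, l - 1 steps lead to the critical exponent 1 - M/2. There
   4 s h'' + 2 M h' = 0 for s > 0, so the bosonic and fermionic contributions to the last
   Laplacian cancel in every coefficient except that of the full product of the generators:
   this one is a multiple of r^(2 - m) (of log r if m = 2), whose Laplacian is a multiple of
   delta. The product of the factors collected on the way is the normalisation. The case n = 0
   of the same computation determines the bosonic constants gamma and gamma', and comparing
   the constants for m and M gives both formulas. *)

(* The obstacle is [iint], an iterated one-dimensional integral: linearity, translation invariance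
   and dominated convergence have to be proved by induction on the dimension, with bounds that stay
   explicit on every slice. Bounds C (A + r2 x)^(-b) have this property, since fixing a coordinate t
   only replaces A by A + t^2. The kernels are singular at the origin. Hence r2 x is first replaced
   by r2 x + 1/(n+1), Green's identity is applied to the regularised kernel, and both sides pass to
   the limit. The exponent decides what the limit is: while the Laplacian of the kernel stays
   locally integrable, no delta arises; at 1 - m/2 one does. The constants [gammap] come from a
   choice operator applied to the property that they should have. They become known only through
   existence of a solution and its uniqueness, and the latter takes a test function that does not
   vanish at 0. *)
Require Import Defs.
From HB Require Import structures.
From mathcomp Require Import all_boot all_order all_algebra.
From mathcomp Require Import all_classical all_reals all_analysis.
From mathcomp Require Import measurable_realfun.
From mathcomp Require Import ring lra.
Set Implicit Arguments.
Unset Strict Implicit.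
Unset Printing Implicit Defensive.
Import Order.TTheory GRing.Theory Num.Theory.
Import numFieldNormedType.Exports.
Local Open Scope classical_set_scope.
Local Open Scope ring_scope.

(** * Integration on the real line: fundamental theorem and translation *)

Section OneVariable.
Variable R : realType.
Local Notation mu := (@lebesgue_measure R).

Lemma cvgy_natS (G : R -> R) (k : R) :
  G x @[x --> +oo] --> k -> G n.+1%:R @[n --> \oo] --> k.
Proof.
move=> /cvg_pinftyP /(_ (fun n => n.+1%:R)) ; apply.
by have := @cvgr_idn R; rewrite -cvg_shiftS.
Qed.

Lemma integral_segment_FTC (f F : R -> R) (a b : R) : a < b -> continuous f ->
  (forall x, is_derive (x : R) (1 : R) F (f x)) ->
  (\int[mu]_(x in `[a, b]) (f x)%:E = (F b - F a)%:E)%E.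
Proof.
move=> ab cf dF.
have dF1 x : derivable F x 1 by have [] := dF x.
have cF : continuous F.
  by move=> x; apply/differentiable_continuous/derivable1_diffP.
rewrite (@continuous_FTC2 _ f F)//.
- by apply: continuous_subspaceT.
- split => //.
  + by apply: cvg_at_right_filter; exact: cF.
  + by apply: cvg_at_left_filter; exact: cF.
- by move=> x _; rewrite derive1E; have [_ ->] := dF x.
Qed.

Let segs (n : nat) : set R := `[(- n.+1%:R)%R, n.+1%:R]%classic.

Let segs_mono : {homo segs : n m / (n <= m)%N >-> (n <= m)%O}.
Proof.
move=> n m nm; apply/subsetPset => x; rewrite /segs/= !in_itv/= => /andP[h1 h2].
have : n.+1%:R <= m.+1%:R :> R by rewrite ler_nat.
by move=> h; apply/andP; split; lra.
Qed.

Let segs_cover : \bigcup_i segs i = setT.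
Proof.
apply/seteqP; split => // x _.
have [n hn] : exists n : nat, `|x| <= n.+1%:R.
  exists (Num.truncn `|x|); apply: ltW; exact: truncnS_gt.
by exists n => //; rewrite /segs /= in_itv/=; rewrite ler_norml in hn.
Qed.

Lemma Rintegral_cover_cvg (f : R -> R) : mu.-integrable setT (EFin \o f) ->
  \int[mu]_(x in segs n) f x @[n --> \oo] --> \int[mu]_x f x.
Proof.
move=> intf.
have mf : measurable_fun setT f by apply/measurable_EFinP; case/integrableP : intf.
apply: fine_cvg; rewrite fineK; last exact: integrable_fin_num.
under eq_fun do rewrite integral_mkcond.
have [] // := @dominated_convergence _ _ R mu setT measurableT
  (fun n => (EFin \o f) \_ (segs n)) (EFin \o f) (abse \o (EFin \o f)).
- move=> n; apply/(measurable_restrictT _ _).1; first exact: measurable_itv.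
  exact/measurable_EFinP/measurable_funTS.
- exact/measurable_EFinP.
- apply: aeW => x _.
  have [n _ nx] : (\bigcup_i segs i) x by rewrite segs_cover.
  apply/cvg_ballP => e e0; exists n => //= k nk.
  rewrite patchE mem_set; first exact: ballxx.
  by have /subsetPset := segs_mono nk; apply.
- exact: integrable_abse.
- apply: aeW => x n _; rewrite patchE; case: ifP => _ //.
  by rewrite abse0 abse_ge0.
Qed.

Lemma RintegralT_FTC (f F : R -> R) (l l' : R) : continuous f ->
  mu.-integrable setT (EFin \o f) -> (forall x, is_derive (x : R) (1 : R) F (f x)) ->
  F x @[x --> +oo] --> l -> F (- x) @[x --> +oo] --> l' ->
  \int[mu]_x f x = l - l'.
Proof.
move=> cf intf dF Fl Fl'.
have /cvg_unique := Rintegral_cover_cvg intf; apply => //.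
have E n : \int[mu]_(x in segs n) f x = F n.+1%:R - F (- n.+1%:R).
  by rewrite /Rintegral (integral_segment_FTC _ cf dF) ?gtrN.
have {}E : (fun n => \int[mu]_(x in segs n) f x) =
   (fun n => F n.+1%:R - F (- n.+1%:R)) by apply/funext.
rewrite /= E.
by apply: cvgB; [exact: (cvgy_natS (G := F))|exact: (cvgy_natS (G := fun x => F (- x)))].
Qed.

Lemma integral_translation (f : R -> R) (v : R) : continuous f ->
  (\int[mu]_x (f (x + v))%:E = \int[mu]_x (f x)%:E)%E.
Proof.
move=> cf.
(* The substitution rule concerns nonnegative integrands, so the positive and negative parts of f
   are translated separately. *)
have H (g : R -> R) : continuous g -> (forall x, 0 <= g x) ->
   (\int[mu]_x (g x)%:E = \int[mu]_x (g (x + v)%R)%:E)%E.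
  move=> cg g0.
  have dv x : is_derive x (1:R) (fun x => x + v) 1.
    by apply: is_derive_eq; rewrite addr0.
  have d1 : derive1 (fun x : R => x + v) = cst 1.
    by apply/funext => x; rewrite derive1E; have [_ ->] := dv x.
  rewrite (@increasing_ge0_integration_by_substitutionT _ (fun x => x + v) g)//.
  - by apply: eq_integral => x _; rewrite d1 /= /GRing.mul /= mulr1.
  - by move=> x y; rewrite ltrD2r.
  - by rewrite d1; exact: cst_continuous.
  - by rewrite d1; exact: is_cvg_cst.
  - by rewrite d1; exact: is_cvg_cst.
  - exact: cvg_addrr_Ny.
  - exact: cvg_addrr.
rewrite [LHS]integralE [RHS]integralE; congr (_ - _)%E.
- rewrite [RHS](_ : _ = \int[mu]_x (Num.max (f x) 0)%:E)%E; last first.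
    by apply: eq_integral => x _; rewrite funeposE EFin_max.
  rewrite H; last 2 first.
  + by move=> x; apply: continuous_max; [exact: cf|exact: cst_continuous].
  + by move=> x; rewrite le_max lexx orbT.
  by apply: eq_integral => x _; rewrite funeposE EFin_max.
- rewrite [RHS](_ : _ = \int[mu]_x (Num.max (- f x) 0)%:E)%E; last first.
    by apply: eq_integral => x _; rewrite funenegE EFin_max.
  rewrite H; last 2 first.
  + move=> x; apply: (@continuous_max _ _ (fun x => - f x) (cst 0)).
      by apply: cvgN; exact: cf.
    exact: cst_continuous.
  + by move=> x; rewrite le_max lexx orbT.
  by apply: eq_integral => x _; rewrite funenegE EFin_max.
Qed.

End OneVariable.

(** * The integrals of (A + u^2)^(-b) over the line *)

Section JapaneseBracket.
Variable R : realType.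
Local Notation mu := (@lebesgue_measure R).

Lemma is_derive_continuous (F f : R -> R) :
  (forall x, is_derive (x : R) (1 : R) F (f x)) -> continuous F.
Proof.
move=> dF x; apply/differentiable_continuous/derivable1_diffP.
by have [] := dF x.
Qed.

Lemma is_derive_mulR (f g : R -> R) (x df dg : R) :
  is_derive (x : R) (1 : R) f df -> is_derive (x : R) (1 : R) g dg ->
  is_derive (x : R) (1 : R) (fun u => f u * g u) (df * g x + f x * dg).
Proof.
move=> hf hg; apply: is_derive_eq (is_deriveM hf hg) _.
by rewrite /GRing.scale /=; ring.
Qed.

Lemma is_derive_addR (f g : R -> R) (x df dg : R) :
  is_derive (x : R) (1 : R) f df -> is_derive (x : R) (1 : R) g dg ->
  is_derive (x : R) (1 : R) (fun u => f u + g u) (df + dg).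
Proof. by move=> hf hg; exact: is_deriveD hf hg. Qed.

Lemma is_derive_cstR (c x : R) : is_derive (x : R) (1 : R) (fun=> c) 0.
Proof. exact: is_derive_cst. Qed.

Lemma is_derive_idR (x : R) : is_derive (x : R) (1 : R) (fun u => u) 1.
Proof. exact: is_derive_id. Qed.

Lemma is_derive_cmulR (f : R -> R) (c x df : R) :
  is_derive (x : R) (1 : R) f df ->
  is_derive (x : R) (1 : R) (fun u => c * f u) (c * df).
Proof.
by move=> hf; have := is_derive_mulR (is_derive_cstR c x) hf; rewrite mul0r add0r.
Qed.

Lemma RintegralT_FTC_odd (f F : R -> R) (l : R) : continuous f ->
  mu.-integrable setT (EFin \o f) -> (forall x, is_derive (x : R) (1 : R) F (f x)) ->
  (forall x, F (- x) = - F x) ->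
  F x @[x --> +oo] --> l -> \int[mu]_x f x = l *+ 2.
Proof.
move=> cf intf dF oF Fl; rewrite (@RintegralT_FTC _ f F l (- l))// ?opprK//.
under eq_fun do rewrite oF.
exact: cvgN.
Qed.

Lemma cvgy_rate (F : R -> R) (l : R) :
  (forall u, 1 <= u -> `|l - F u| <= u^-1) -> F x @[x --> +oo] --> l.
Proof.
move=> H; apply/cvgrPdist_lt => e e0; near=> u.
have u1 : 1 <= u by near: u; apply: nbhs_pinfty_ge; rewrite num_real.
have ue : e^-1 < u by near: u; apply: nbhs_pinfty_gt; rewrite num_real.
have u0 : 0 < u by exact: lt_le_trans u1.
by apply: le_lt_trans (H u u1) _; rewrite invf_plt ?posrE.
Unshelve. all: by end_near. Qed.

Lemma lerN_powR (x y b : R) : 0 < x -> x <= y -> 0 <= b ->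
  y `^ (- b) <= x `^ (- b).
Proof.
move=> x0 xy b0; rewrite !powRN lef_pV2 ?posrE ?powR_gt0//; last exact: lt_le_trans xy.
by apply: ge0_ler_powR => //; rewrite nnegrE ltW// (lt_le_trans x0 xy).
Qed.

Lemma sqrD_gt0 (A u : R) : 0 < A -> 0 < A + u ^+ 2.
Proof. by move=> A0; rewrite ltr_pwDl// sqr_ge0. Qed.

Lemma is_derive_powR_comp (g : R -> R) (x a dg : R) : 0 < g x ->
  is_derive (x : R) (1 : R) g dg ->
  is_derive (x : R) (1 : R) (fun u => g u `^ a) (a * g x `^ (a - 1) * dg).
Proof.
move=> g0 dgx.
exact: (@is_derive1_comp _ (fun u => u `^ a) g x _ _ (is_derive1_powR a g0) dgx).
Qed.

Lemma is_derive_jpow (A b x : R) : 0 < A ->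
  is_derive (x : R) (1 : R) (fun u => (A + u ^+ 2) `^ b)
     (b * (A + x ^+ 2) `^ (b - 1) * (2 * x)).
Proof.
move=> A0; apply: is_derive_powR_comp; first exact: sqrD_gt0.
apply: is_derive_eq; rewrite add0r /GRing.scale /=; ring.
Qed.

Lemma continuous_jpow (A b : R) : 0 < A ->
  continuous (fun u : R => (A + u ^+ 2) `^ b).
Proof. by move=> A0; apply: is_derive_continuous => x; exact: is_derive_jpow. Qed.

(** This majorant has the elementary antiderivative -2 (1 + u)^(-1/2) for u >= 0. Its exponent 3/2
    is twice 3/4, the smallest power of 1 + u^2 that has to be integrated below. *)
Lemma integrable_half_kernel :
  mu.-integrable setT (EFin \o (fun u : R => (1 + `|u|) `^ (- (3/2)))).
Proof.
set f := fun u : R => _.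
have cf : continuous f.
  move=> x; apply: (@continuous_comp _ _ _ (fun u : R => 1 + `|u|) (fun u => u `^ (- (3/2)))).
    by apply: cvgD; [exact: cvg_cst|exact: norm_continuous].
  apply/differentiable_continuous/derivable1_diffP.
  by have [] := @is_derive1_powR _ (- (3/2)) (1 + `|x|) (ltr_pwDl ltr01 (normr_ge0 x)).
have f0 x : 0 <= f x by exact: powR_ge0.
apply/integrableP; split.
  by apply/measurable_EFinP; exact: continuous_measurable_fun.
rewrite (_ : (fun x => _) = (EFin \o f)); last first.
  by apply/funext => x /=; rewrite ger0_norm.
rewrite ge0_symfun_integralT//; last by move=> x; rewrite /f /= normrN.
rewrite (_ : [set x | _] = `[0, +oo[%classic); last first.
  by apply/seteqP; split => x/=; rewrite in_itv/= andbT.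
pose F (u : R) := - 2 * (1 + u) `^ (- 2^-1).
have dF x : 0 <= x -> is_derive (x : R) (1 : R) F (f x).
  move=> x0; have x1 : 0 < 1 + x by rewrite ltr_pwDl.
  have d1 : is_derive (x : R) (1 : R) (fun u => 1 + u) 1.
    by apply: is_derive_eq (is_derive_addR (is_derive_cstR 1 x) (is_derive_idR x)) _; rewrite add0r.
  have d2 := @is_derive_powR_comp (fun u => 1 + u) x (- 2^-1) _ x1 d1.
  apply: is_derive_eq (is_derive_cmulR (- 2) d2) _.
  rewrite /f ger0_norm// /GRing.scale /= (_ : - 2^-1 - 1 = - (3/2)); last by lra.
  by rewrite mulr1 mulrA (_ : -2 * - 2^-1 = 1) ?mul1r//; field.
rewrite (@ge0_continuous_FTC2y _ f F 0 0)//.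
- by rewrite -EFinB -EFinM ltry.
- exact: continuous_subspaceT.
- rewrite (_ : 0 = -2 * 0); last by rewrite mulr0.
  apply: cvgMl_tmp.
  apply/cvgrPdist_lt => e e0; near=> u.
  have u1 : 1 <= u by near: u; apply: nbhs_pinfty_ge; rewrite num_real.
  have ue : e^-1 ^+ 2 < u by near: u; apply: nbhs_pinfty_gt; rewrite num_real.
  rewrite sub0r normrN ger0_norm ?powR_ge0// powRN.
  rewrite invf_plt ?posrE ?powR_gt0 ?ltr_pwDl ?(le_trans ler01)//.
  have u0 : 0 <= 1 + u by lra.
  rewrite powR12_sqrt// -(@ger0_norm _ e^-1) ?invr_ge0 ?ltW// -sqrtr_sqr.
  by rewrite ltr_sqrt; lra.
- by move=> x x0; have [] := dF x (ltW x0).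
- apply: cvg_at_right_filter.
  by apply/differentiable_continuous/derivable1_diffP; have [] := dF 0 (lexx _).
- move=> x; rewrite in_itv/= andbT => x0; rewrite derive1E.
  by have [_ ->] := dF x (ltW x0).
Unshelve. all: by end_near. Qed.

(** This is (1 + |u|)^2 <= 2 (1 + u^2) raised to the power 3/4. *)
Lemma jpow_le_half_kernel (u : R) :
  (1 + u ^+ 2) `^ (- (3/4)) <= 2 `^ (3/4) * (1 + `|u|) `^ (- (3/2)).
Proof.
have p : 0 < 1 + `|u| by rewrite ltr_pwDl.
have q := sqrD_gt0 u (@ltr01 R).
rewrite !powRN ler_pdivlMr ?powR_gt0// mulrC ler_pdivrMr ?powR_gt0//.
rewrite (_ : 3/2 = 2%:R * (3/4)); last by field.
rewrite powRrM powR_mulrn ?(ltW p)// -powRM ?(ltW q)//.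
have h34 : 0 <= 3/4 :> R by lra.
apply: (ge0_ler_powR h34); rewrite ?nnegrE ?sqr_ge0 ?mulr_ge0 ?(ltW q)//.
have : 0 <= (1 - `|u|) ^+ 2 by exact: sqr_ge0.
rewrite -(real_normK (num_real u)); nra.
Qed.

Lemma integrable_jpow1 (b : R) : 3/4 <= b ->
  mu.-integrable setT (EFin \o (fun u : R => (1 + u ^+ 2) `^ (- b))).
Proof.
move=> b34.
have := integrableZl (mu := mu) measurableT (2 `^ (3/4)) integrable_half_kernel.
apply: le_integrable => //.
  apply/measurable_EFinP; apply: continuous_measurable_fun.
  exact: continuous_jpow.
move=> x _ /=; rewrite lee_fin ger0_norm ?powR_ge0//.
rewrite ger0_norm ?mulr_ge0 ?powR_ge0//.
apply: le_trans (jpow_le_half_kernel x).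
by apply: ler_powR; [rewrite lerDl sqr_ge0|lra].
Qed.

(* Slicing (A + r2 x)^-b one coordinate at a time turns every radial integral needed
   below into a product of values of jint; this replaces polar coordinates. *)
Definition jint (b : R) : R := \int[mu]_u (1 + u ^+ 2) `^ (- b).

Lemma jint_ge0 (b : R) : 0 <= jint b.
Proof. by apply: Rintegral_ge0 => x _; exact: powR_ge0. Qed.

(** Substitute sqrt A * u for u; the Jacobian sqrt A is the 1/2 in the exponent. *)
Lemma integral_jpow (A b : R) : 0 < A -> 3/4 <= b ->
  (\int[mu]_u ((A + u ^+ 2) `^ (- b))%:E = (A `^ (2^-1 - b) * jint b)%:E)%E.
Proof.
move=> A0 b34.
have s0 : 0 < Num.sqrt A by rewrite sqrtr_gt0.
pose F (u : R) := Num.sqrt A * u.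
have dv x : is_derive (x : R) (1 : R) F (Num.sqrt A).
  by apply: is_derive_eq; rewrite /GRing.scale /= mulr1.
have d1 : derive1 F = cst (Num.sqrt A).
  by apply/funext => x; rewrite derive1E; have [_ ->] := dv x.
have E : A `^ (- b) * Num.sqrt A = A `^ (2^-1 - b).
  rewrite -powR12_sqrt ?(ltW A0)// -powRD; last by rewrite (gt_eqF A0) implybT.
  by congr (_ `^ _); ring.
rewrite (@increasing_ge0_integration_by_substitutionT _ F (fun u => (A + u ^+ 2) `^ (- b)))//.
- rewrite /jint /Rintegral EFinM fineK; last first.
    apply: integrable_fin_num => //; exact: integrable_jpow1.
  rewrite -ge0_integralZl_EFin ?powR_ge0//; last 2 first.
  + by move=> x _; rewrite lee_fin powR_ge0.
  + apply/measurable_EFinP; apply: continuous_measurable_fun.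
    exact: continuous_jpow.
  apply: eq_integral => x _; rewrite d1 /F /= /GRing.mul /= -EFinM; congr EFin.
  have -> : A + (Num.sqrt A * x) ^+ 2 = A * (1 + x ^+ 2).
    by rewrite exprMn sqr_sqrtr ?(ltW A0)// mulrDr mulr1.
  rewrite powRM ?(ltW A0) ?(ltW (sqrD_gt0 _ _))// -[LHS]mulrAC.
  by rewrite [X in X * _]E.
- by move=> x y xy; rewrite /F ltr_pM2l.
- by rewrite d1; exact: cst_continuous.
- by rewrite d1; exact: is_cvg_cst.
- by rewrite d1; exact: is_cvg_cst.
- by apply: gt0_cvgMrNy => //; exact: cvg_id.
- by apply: gt0_cvgMry => //; exact: cvg_id.
- by move=> x; exact: continuous_jpow.
- by move=> x; exact: powR_ge0.
Qed.

Lemma integrable_jpow (A b : R) : 0 < A -> 3/4 <= b ->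
  mu.-integrable setT (EFin \o (fun u : R => (A + u ^+ 2) `^ (- b))).
Proof.
move=> A0 b34; apply/integrableP; split.
  apply/measurable_EFinP; apply: continuous_measurable_fun.
  exact: continuous_jpow.
rewrite (_ : (fun x => _) = (fun u => ((A + u ^+ 2) `^ (- b))%:E)).
  by rewrite integral_jpow// ltry.
by apply/funext => x /=; rewrite ger0_norm// powR_ge0.
Qed.

Lemma Rintegral_jpow (A b : R) : 0 < A -> 3/4 <= b ->
  \int[mu]_u (A + u ^+ 2) `^ (- b) = A `^ (2^-1 - b) * jint b.
Proof. by move=> A0 b34; rewrite {1}/Rintegral integral_jpow. Qed.

Lemma powRB1 (x b : R) : 0 < x -> x `^ (b - 1) = x `^ b / x.
Proof.
move=> x0; rewrite powRD; last by rewrite (gt_eqF x0) implybT.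
by rewrite powR_inv1// ltW.
Qed.

Lemma cvgy_jpow (b : R) : 1 <= b ->
  (fun u : R => u * (1 + u ^+ 2) `^ (- b)) x @[x --> +oo] --> (0 : R).
Proof.
move=> b1; apply: cvgy_rate => u u1.
have u0 : 0 < u by apply: lt_le_trans u1.
rewrite sub0r normrN ger0_norm ?mulr_ge0 ?powR_ge0 ?(ltW u0)//.
apply: (@le_trans _ _ (u * (1 + u ^+ 2) `^ (- 1))).
  by rewrite ler_pM2l//; apply: ler_powR; [rewrite lerDl sqr_ge0|rewrite lerN2].
rewrite powR_inv1; last by rewrite ltW// sqrD_gt0.
rewrite -(@ler_pM2r _ u)// mulVf ?gt_eqF// mulrAC -expr2 ler_pdivrMr ?sqrD_gt0//.
by rewrite mul1r lerDr.
Qed.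

(** The derivative of u (1 + u^2)^(-b) combines the two integrands and has integral 0. With the
    values at 3/2 and 2 this determines [jint] at all half-integral exponents from 3/2 on. *)
Lemma jint_rec (b : R) : 1 <= b -> jint (b + 1) = jint b * (b - 2^-1) / b.
Proof.
move=> b1; have b0 : b != 0 by rewrite gt_eqF// (lt_le_trans ltr01).
pose f (u : R) := (1 - 2 * b) * (1 + u ^+ 2) `^ (- b)
                   + 2 * b * (1 + u ^+ 2) `^ (- (b + 1)).
have I1 : mu.-integrable setT (EFin \o (fun u : R => (1 + u ^+ 2) `^ (- b))).
  by apply: integrable_jpow1; lra.
have I2 : mu.-integrable setT (EFin \o (fun u : R => (1 + u ^+ 2) `^ (- (b + 1)))).
  by apply: integrable_jpow1; lra.
have I1' := integrableZl (mu := mu) measurableT (1 - 2 * b) I1.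
have I2' := integrableZl (mu := mu) measurableT (2 * b) I2.
have : \int[mu]_u f u = 0 *+ 2.
  apply: (@RintegralT_FTC_odd f (fun u : R => u * (1 + u ^+ 2) `^ (- b))).
  - move=> x; apply: cvgD; (apply: cvgM; first exact: cvg_cst);
      by apply: continuous_jpow.
  - exact: (integrableD measurableT I1' I2').
  - move=> x; have d1 := @is_derive_jpow 1 (- b) x ltr01.
    apply: is_derive_eq (is_derive_mulR (is_derive_idR x) d1) _.
    rewrite mul1r /f.
    have q := sqrD_gt0 x (@ltr01 R).
    rewrite (_ : - (b + 1) = - b - 1); last by ring.
    by rewrite powRB1//; field; rewrite gt_eqF.
  - by move=> x; rewrite sqrrN mulNr.
  - exact: cvgy_jpow.
rewrite /f RintegralD// RintegralZl// RintegralZl// -/(jint b) -/(jint (b+1)).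
rewrite mul0rn => /eqP; rewrite addr_eq0 => /eqP h.
have : 2 * b * jint (b + 1) = (2 * b - 1) * jint b.
  by apply: oppr_inj; rewrite -h; ring.
by move=> h2; apply: (mulfI b0); rewrite [RHS]mulrC divfK//; lra.
Qed.

Lemma jint32 : jint (3/2) = 2.
Proof.
pose F (u : R) := u * (1 + u ^+ 2) `^ (- 2^-1).
have Fy : F x @[x --> +oo] --> (1 : R).
  apply: cvgy_rate => u u1; have u0 : 0 < u by apply: lt_le_trans u1.
  have q := sqrD_gt0 u (@ltr01 R).
  have F2 : F u ^+ 2 = u ^+ 2 / (1 + u ^+ 2).
    rewrite /F exprMn -[(_ `^ _) ^+ 2]powR_mulrn ?powR_ge0// -powRrM.
    by rewrite (_ : - 2^-1 * 2 = -1) ?powR_inv1 ?(ltW q)//; field.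
  have F0 : 0 <= F u by rewrite mulr_ge0 ?powR_ge0 ?ltW.
  have H : F u ^+ 2 = 1 - (1 + u ^+ 2)^-1 by rewrite F2; field; rewrite gt_eqF.
  have i0 : 0 < (1 + u ^+ 2)^-1 by rewrite invr_gt0.
  have iu : (1 + u ^+ 2)^-1 <= u^-1.
    by rewrite lef_pV2 ?posrE//; nra.
  have F1 : F u <= 1 by nra.
  by rewrite ger0_norm; nra.
apply: (@RintegralT_FTC_odd (fun u : R => (1 + u ^+ 2) `^ (- (3/2))) F 1) => //.
- by move=> x; exact: continuous_jpow.
- by apply: integrable_jpow1; lra.
- move=> x; have d1 := @is_derive_jpow 1 (- 2^-1) x ltr01.
  apply: is_derive_eq (is_derive_mulR (is_derive_idR x) d1) _.
  rewrite mul1r.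
  have q := sqrD_gt0 x (@ltr01 R).
  rewrite (_ : - 2^-1 = - (3/2) + 1); last by field.
  rewrite addrK powRD; last by rewrite (gt_eqF q) implybT.
  by rewrite powRr1 ?(ltW q)//; field.
- by move=> x; rewrite /F sqrrN mulNr.
Qed.

Lemma jint2 : jint 2 = pi / 2.
Proof.
pose F (u : R) := 2^-1 * (u * (1 + u ^+ 2) `^ (- 1) + atan u).
have Fy : F x @[x --> +oo] --> (pi / 4 : R).
  rewrite (_ : pi / 4 = 2^-1 * (0 + pi / 2)); last by field.
  apply: cvgM; first exact: cvg_cst.
  by apply: cvgD; [exact: cvgy_jpow|exact: cvgy_atan].
apply: (etrans (@RintegralT_FTC_odd (fun u : R => (1 + u ^+ 2) `^ (- 2)) F (pi/4) _ _ _ _ _));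
  last by field.
- by move=> x; exact: continuous_jpow.
- by apply: integrable_jpow1; lra.
- move=> x; have d1 := @is_derive_jpow 1 (- 1) x ltr01.
  have d2 := is_derive_mulR (is_derive_idR x) d1.
  have d3 := is_derive_addR d2 (is_derive1_atan x).
  apply: is_derive_eq (is_derive_cmulR 2^-1 d3) _.
  rewrite mul1r.
  have q := sqrD_gt0 x (@ltr01 R).
  rewrite (_ : (-1) - 1 = - 2%:R :> R); last by ring.
  rewrite powR_inv1 ?(ltW q)// powRN powR_mulrn ?(ltW q)//.
  by field; rewrite gt_eqF.
- by move=> x; rewrite /F sqrrN mulNr atanN -opprD mulrN.
- exact: Fy.
Qed.

End JapaneseBracket.

(** * Dominated convergence, linearity and translation for the iterated integral *)

Section IteratedIntegral.
Variable R : realType.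
Local Notation mu := (@lebesgue_measure R).

Lemma cvg_sum_ord (T : Type) (F : set_system T) {FF : Filter F}
    (V : normedModType R) n (f : 'I_n -> T -> V) (a : 'I_n -> V) :
  (forall i, f i x @[x --> F] --> a i) ->
  \sum_(i < n) f i x @[x --> F] --> \sum_(i < n) a i.
Proof.
move=> fa; elim: n f a fa => [|n IH] f a fa.
  by rewrite big_ord0; under eq_fun do rewrite big_ord0; exact: cvg_cst.
rewrite big_ord_recl; under eq_fun do rewrite big_ord_recl.
by apply: cvgD; [exact: fa|apply: (IH (fun i => f (lift ord0 i))) => i; exact: fa].
Qed.

Lemma continuous_sum_ord (T : topologicalType) (V : normedModType R) n
    (f : 'I_n -> T -> V) :
  (forall i, continuous (f i)) -> continuous (fun x => \sum_(i < n) f i x).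
Proof. by move=> fc x; apply: cvg_sum_ord => i; exact: fc. Qed.

Lemma continuous_addfun (T : topologicalType) (V : normedModType R) (f g : T -> V) :
  continuous f -> continuous g -> continuous (fun x => f x + g x).
Proof. by move=> fc gc x; apply: cvgD; [exact: fc|exact: gc]. Qed.

Lemma continuous_mulfun (T : topologicalType) (f g : T -> R) :
  continuous f -> continuous g -> continuous (fun x => f x * g x).
Proof. by move=> fc gc x; apply: cvgM; [exact: fc|exact: gc]. Qed.

Lemma continuous_scalel (T : topologicalType) (V : normedModType R) (f : T -> R) (v : V) :
  continuous f -> continuous (fun x => f x *: v).
Proof. by move=> fc x; apply: cvgZr_tmp; exact: fc. Qed.

(** Convergence and domination are asked for t != 0 only, because the slice t = 0 of a singular
    kernel passes through the singularity. *)
Lemma Rintegral_dominated_cvg (g_ : nat -> R -> R) (g : R -> R) (k : R -> \bar R) :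
  (forall n, measurable_fun setT (g_ n)) ->
  (forall t, t != 0 -> g_ n t @[n --> \oo] --> g t) ->
  mu.-integrable setT k ->
  (forall n t, t != 0 -> (`|g_ n t|%:E <= k t)%E) ->
  [/\ mu.-integrable setT (EFin \o g) &
      \int[mu]_t g_ n t @[n --> \oo] --> \int[mu]_t g t].
Proof.
move=> mg gg ik gk.
have mg' : measurable_fun setT g.
  rewrite -(setUv [set 0]); apply/measurable_funU => //.
    exact: measurableC.
  split; first exact: measurable_fun_set1.
  apply: (@measurable_fun_cvg _ _ _ _ g_).
    by move=> m; exact: measurable_funTS.
  by move=> x /eqP x0; exact: gg.
have ae0 (P : R -> Prop) : (forall t, t != 0 -> P t) -> {ae mu, forall t, P t}.
  move=> H; exists [set 0]; split => //; first exact: lebesgue_measure_set1.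
  by move=> t /=; apply: contra_notP => /eqP; exact: H.
have [] := @dominated_convergence _ _ R mu setT measurableT
  (fun n => EFin \o g_ n) (EFin \o g) k.
- by move=> n; apply/measurable_EFinP; exact: mg.
- by apply/measurable_EFinP; exact: mg'.
- apply: ae0 => t t0 _; apply: cvg_EFin; first exact: nearW.
  exact: gg.
- exact: ik.
- by apply: ae0 => t t0 n _ /=; exact: gk.
- move=> ig _ H; split => //.
  by apply: fine_cvg; rewrite fineK //; exact: integrable_fin_num.
Qed.

Definition rcons_pt d (t : R) (x : 'rV[R]_d) : 'rV[R]_d.+1 :=
  row_mx (const_mx t : 'rV[R]_1) x.

Lemma iintS d (f : 'rV[R]_d.+1 -> R) :
  iint f = \int[mu]_t iint (fun x => f (rcons_pt t x)).
Proof. by []. Qed.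

Lemma rcons_pt0 d t (x : 'rV[R]_d) : rcons_pt t x 0 0 = t.
Proof.
have -> : (0 : 'I_d.+1) = @lshift 1 d 0 by apply/val_inj.
by rewrite /rcons_pt (row_mxEl (const_mx t : 'rV[R]_1) x) mxE.
Qed.

Lemma rcons_ptS d t (x : 'rV[R]_d) (i : 'I_d) : rcons_pt t x 0 (lift 0 i) = x 0 i.
Proof.
have -> : lift 0 i = @rshift 1 d i by apply/val_inj.
by rewrite /rcons_pt (row_mxEr (const_mx t : 'rV[R]_1) x).
Qed.

Lemma rcons_ptD d t s (x y : 'rV[R]_d) :
  rcons_pt (t + s) (x + y) = rcons_pt t x + rcons_pt s y.
Proof.
apply/rowP => i; rewrite [RHS]mxE; case: (unliftP 0 i) => [j ->|->].
  by rewrite !rcons_ptS mxE.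
by rewrite !rcons_pt0.
Qed.

Lemma rcons_pt_split d (x : 'rV[R]_d.+1) :
  x = rcons_pt (x 0 0) (\row_i x 0 (lift 0 i)).
Proof.
apply/rowP => i; case: (unliftP 0 i) => [j ->|->].
  by rewrite rcons_ptS mxE.
by rewrite rcons_pt0.
Qed.

Lemma r2_rcons_pt d t (x : 'rV[R]_d) : r2 (rcons_pt t x) = t ^+ 2 + r2 x.
Proof.
rewrite /r2 big_ord_recl rcons_pt0; congr (_ + _).
by apply: eq_bigr => i _; rewrite rcons_ptS.
Qed.

Lemma r2_ge0 d (x : 'rV[R]_d) : 0 <= r2 x.
Proof. by apply: sumr_ge0 => i _; exact: sqr_ge0. Qed.

Lemma continuous_r2 d : continuous (@r2 R d).
Proof.
apply: (@continuous_sum_ord 'rV[R]_d R^o) => i.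
apply: (@continuous_mulfun 'rV[R]_d (fun x => x 0 i) (fun x => x 0 i));
  exact: coord_continuous.
Qed.

Lemma rcons_ptE d t (x : 'rV[R]_d) :
  rcons_pt t x = t *: delta_mx 0 0 + \sum_(j < d) x 0 j *: delta_mx 0 (lift 0 j).
Proof.
apply/rowP => i; rewrite [RHS]mxE summxE; case: (unliftP 0 i) => [j ->|->].
  rewrite rcons_ptS !mxE eqxx eq_sym (negbTE (neq_lift _ _)) /= mulr0 add0r.
  rewrite (bigD1 j)//= !mxE !eqxx mulr1 big1 ?addr0// => k kj.
  by rewrite !mxE (inj_eq lift_inj) eqxx eq_sym (negbTE kj) mulr0.
rewrite rcons_pt0 !mxE !eqxx mulr1 big1 ?addr0// => k _.
by rewrite !mxE eqxx /= mulr0.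
Qed.

Lemma continuous_rcons_ptr d t : continuous (fun x : 'rV[R]_d => rcons_pt t x).
Proof.
rewrite (_ : (fun x => _) = (fun x : 'rV[R]_d => t *: 'e_0 +
   \sum_(j < d) x 0 j *: 'e_(lift 0 j) : 'rV[R]_d.+1)); last first.
  by apply/funext => x; rewrite rcons_ptE.
apply: (@continuous_addfun 'rV[R]_d 'rV[R]_d.+1 (fun=> t *: 'e_0)).
  exact: cst_continuous.
apply: (@continuous_sum_ord 'rV[R]_d 'rV[R]_d.+1) => i.
apply: (@continuous_scalel 'rV[R]_d 'rV[R]_d.+1 (fun x => x 0 i)).
exact: coord_continuous.
Qed.

Lemma continuous_rcons_ptl d (x : 'rV[R]_d) : continuous (fun t : R => rcons_pt t x).
Proof.
move=> t; rewrite /continuous_at rcons_ptE.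
under eq_fun do rewrite rcons_ptE.
apply: cvgD; last exact: cvg_cst.
by apply: cvgZr_tmp; exact: cvg_id.
Qed.

Lemma rcons_pt_neq0 d t (x : 'rV[R]_d) : t != 0 -> rcons_pt t x != 0.
Proof.
by apply: contra_neq => /(congr1 (fun y : 'rV[R]_d.+1 => y 0 0)); rewrite rcons_pt0 mxE.
Qed.

(** The integral of (1 + r2 x)^(-b) over R^d, see [iint_jpow]: integrating out d' coordinates lowers
    the exponent by d'/2 before the last integration. *)
Fixpoint brint (d : nat) (b : R) : R :=
  if d is d'.+1 then brint d' b * jint (b - d'%:R / 2) else 1.

Lemma brint_ge0 d b : 0 <= brint d b.
Proof. by elim: d => //= d IH; rewrite mulr_ge0 ?jint_ge0. Qed.

Lemma slice_exponent d (b : R) : d.+1%:R / 2 + 4^-1 <= b ->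
  d%:R / 2 + 4^-1 <= b /\ 3 / 4 <= b - d%:R / 2.
Proof. rewrite -natr1; lra. Qed.

(** Convergence and the bound go through the induction together: the bound on the inner integrals is
    the dominating function of the outer one, and their convergence gives the pointwise limit there.
    A is general because a slice turns it into A + t^2. *)
Lemma iint_dominated d (b A C : R) (f_ : nat -> 'rV[R]_d -> R) (f : 'rV[R]_d -> R) :
  d%:R / 2 + 4^-1 <= b -> 0 < A ->
  (forall n, continuous (f_ n)) -> continuous f ->
  (forall n x, `|f_ n x| <= C * (A + r2 x) `^ (- b)) ->
  (forall x, `|f x| <= C * (A + r2 x) `^ (- b)) ->
  (forall x, f_ n x @[n --> \oo] --> f x) ->
  iint (f_ n) @[n --> \oo] --> iint f /\
  `|iint f| <= C * brint d b * A `^ (d%:R / 2 - b).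
Proof.
elim: d A f_ f => [|d IH] A f_ f db A0 cf_ cf bf_ bf ff.
  split; first exact: ff.
  have := bf 0; rewrite /r2 big_ord0 addr0 /= mulr1.
  by rewrite mul0r add0r.
have [db' b34] := slice_exponent db.
have C0 : 0 <= C.
  have := le_trans (normr_ge0 _) (bf 0).
  by rewrite pmulr_lge0// powR_gt0// ltr_wpDr// r2_ge0.
have cS (h : 'rV[R]_d.+1 -> R) t : continuous h ->
    continuous (fun x => h (rcons_pt t x)).
  move=> ch x; apply: (@continuous_comp _ _ _ (rcons_pt t)); last exact: ch.
  exact: continuous_rcons_ptr.
have bS (h : 'rV[R]_d.+1 -> R) t :
    (forall x, `|h x| <= C * (A + r2 x) `^ (- b)) ->
    forall x, `|h (rcons_pt t x)| <= C * ((A + t ^+ 2) + r2 x) `^ (- b).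
  by move=> bh x; have := bh (rcons_pt t x); rewrite r2_rcons_pt addrA.
have b0 : 0 <= b.
  by apply: le_trans db; rewrite addr_ge0 ?divr_ge0.
have bS' (h : 'rV[R]_d.+1 -> R) t :
    (forall x, `|h x| <= C * (A + r2 x) `^ (- b)) ->
    forall x, `|h (rcons_pt t x)| <= C * (A + r2 x) `^ (- b).
  move=> bh x; apply: le_trans (bS h t bh x) _; apply: ler_wpM2l => //.
  apply: lerN_powR => //; first by rewrite ltr_wpDr// r2_ge0.
  by rewrite lerD2r lerDl sqr_ge0.
have At t : 0 < A + t ^+ 2 by exact: sqrD_gt0.
pose g_ n t := iint (fun x => f_ n (rcons_pt t x)).
pose g t := iint (fun x => f (rcons_pt t x)).
have bg (h : 'rV[R]_d.+1 -> R) t : continuous h ->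
    (forall x, `|h x| <= C * (A + r2 x) `^ (- b)) ->
    `|iint (fun x => h (rcons_pt t x))| <=
       C * brint d b * (A + t ^+ 2) `^ (- (b - d%:R / 2)).
  move=> ch bh; rewrite opprB.
  have [] // := IH (A + t ^+ 2) (fun=> fun x => h (rcons_pt t x))
    (fun x => h (rcons_pt t x)) db' (At t).
  - by move=> _; exact: cS.
  - exact: cS.
  - by move=> _; exact: bS.
  - exact: bS.
  - by move=> x; exact: cvg_cst.
(* Continuity in t makes the outer integrand measurable. It is obtained sequentially, from the
   induction hypothesis applied to the slices at [u n]. *)
have cg (h : 'rV[R]_d.+1 -> R) : continuous h ->
    (forall x, `|h x| <= C * (A + r2 x) `^ (- b)) ->
    continuous (fun t => iint (fun x => h (rcons_pt t x)) : R).
  move=> ch bh t; apply/(@cvg_nbhsP _ R^o) => u ut.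
  have [] // := IH A (fun n => fun x => h (rcons_pt (u n) x))
    (fun x => h (rcons_pt t x)) db' A0.
  - by move=> n; exact: cS.
  - exact: cS.
  - by move=> n; exact: bS'.
  - exact: bS'.
  - move=> x; apply: (@cvg_comp _ _ _ u (fun s => h (rcons_pt s x)) _ _ _ ut).
    apply: (@continuous_comp _ _ _ (fun s => rcons_pt s x)); last exact: ch.
    exact: continuous_rcons_ptl.
have gk n t : t != 0 -> (`|g_ n t|%:E <=
    (C * brint d b)%:E * ((A + t ^+ 2) `^ (- (b - d%:R / 2)))%:E)%E.
  by move=> _; rewrite -EFinM lee_fin; exact: bg.
have ik : mu.-integrable setT (fun t : R => (C * brint d b)%:E *
    ((A + t ^+ 2) `^ (- (b - d%:R / 2)))%:E)%E.
  exact: (integrableZl measurableT _ (integrable_jpow A0 b34)).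
have [||ig gg] := @Rintegral_dominated_cvg g_ g _ _ _ ik gk.
- by move=> n; apply: continuous_measurable_fun; exact: cg.
- move=> t t0; have [] // := IH A (fun n => fun x => f_ n (rcons_pt t x))
    (fun x => f (rcons_pt t x)) db' A0.
  + by move=> n; exact: cS.
  + exact: cS.
  + by move=> n; exact: bS'.
  + exact: bS'.
split; first by rewrite iintS; exact: gg.
rewrite iintS; apply: le_trans (le_normr_Rintegral measurableT ig) _.
apply: (@le_trans _ _
  (\int[mu]_t (C * brint d b * (A + t ^+ 2) `^ (- (b - d%:R / 2))))).
  apply: le_Rintegral => //.
  - exact: integrable_norm.
  - by move=> t _; exact: bg.
rewrite RintegralZl ?Rintegral_jpow//; last exact: integrable_jpow.
rewrite (_ : 2^-1 - (b - d%:R / 2) = d.+1%:R / 2 - b); last first.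
  by rewrite -natr1; field.
by rewrite /= le_eqVlt; apply/orP; left; apply/eqP; ring.
Qed.

(* The hypothesis d / 2 + 4^-1 <= b recurring below: any fixed margin above the
   integrability threshold d / 2 is preserved by slicing off a coordinate. *)
Definition japanese_bounded d (b A C : R) (f : 'rV[R]_d -> R) :=
  forall x, `|f x| <= C * (A + r2 x) `^ (- b).

Definition decaying d (b : R) (f : 'rV[R]_d -> R) :=
  continuous f /\ exists C, japanese_bounded b 1 C f.

Lemma iint_bound d (b A C : R) (f : 'rV[R]_d -> R) : d%:R / 2 + 4^-1 <= b -> 0 < A ->
  continuous f -> japanese_bounded b A C f ->
  `|iint f| <= C * brint d b * A `^ (d%:R / 2 - b).
Proof.
move=> db A0 cf bf.
by have [] // := @iint_dominated d b A C (fun=> f) f db A0 (fun=> cf) cf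
  (fun=> bf) bf (fun x => cvg_cst _).
Qed.

Lemma continuous_slice d (h : 'rV[R]_d.+1 -> R) t : continuous h ->
  continuous (fun x => h (rcons_pt t x)).
Proof.
move=> ch x; apply: (@continuous_comp _ _ _ (rcons_pt t)); last exact: ch.
exact: continuous_rcons_ptr.
Qed.

Lemma jbounded_slice d (b A C : R) (h : 'rV[R]_d.+1 -> R) t :
  japanese_bounded b A C h ->
  japanese_bounded b (A + t ^+ 2) C (fun x => h (rcons_pt t x)).
Proof. by move=> bh x; have := bh (rcons_pt t x); rewrite r2_rcons_pt addrA. Qed.

Lemma jbounded_ge0 d (b A C : R) (f : 'rV[R]_d -> R) : 0 < A ->
  japanese_bounded b A C f -> 0 <= C.
Proof.
move=> A0 bf; have := le_trans (normr_ge0 _) (bf 0).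
by rewrite pmulr_lge0// powR_gt0// ltr_wpDr// r2_ge0.
Qed.

Lemma jboundedW d (b A B C : R) (f : 'rV[R]_d -> R) : 0 <= b -> 0 < A -> A <= B ->
  japanese_bounded b B C f -> japanese_bounded b A C f.
Proof.
move=> b0 A0 AB bf x; apply: le_trans (bf x) _; apply: ler_wpM2l.
  by apply: jbounded_ge0 bf; exact: lt_le_trans AB.
apply: lerN_powR => //; first by rewrite ltr_wpDr// r2_ge0.
by rewrite lerD2r.
Qed.

Lemma exponent_ge0 d (b : R) : d%:R / 2 + 4^-1 <= b -> 0 <= b.
Proof. by apply: le_trans; rewrite addr_ge0 ?divr_ge0. Qed.

Lemma decaying_slice d (b : R) (f : 'rV[R]_d.+1 -> R) t : 0 <= b ->
  decaying b f -> decaying b (fun x => f (rcons_pt t x)).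
Proof.
move=> b0 [cf [C bf]]; split; first exact: continuous_slice.
exists C; apply: jboundedW (jbounded_slice t bf) => //.
by rewrite lerDl sqr_ge0.
Qed.

Lemma continuous_iint_slice d (b A C : R) (h : 'rV[R]_d.+1 -> R) :
  d%:R / 2 + 4^-1 <= b -> 0 < A -> continuous h -> japanese_bounded b A C h ->
  continuous (fun t => iint (fun x => h (rcons_pt t x)) : R).
Proof.
move=> db A0 ch bh t; apply/(@cvg_nbhsP _ R^o) => u ut.
have bs s : japanese_bounded b A C (fun x => h (rcons_pt s x)).
  apply: jboundedW (jbounded_slice s bh) => //; first exact: exponent_ge0 db.
  by rewrite lerDl sqr_ge0.
have [] // := @iint_dominated d b A C (fun n => fun x => h (rcons_pt (u n) x))
  (fun x => h (rcons_pt t x)) db A0.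
- by move=> n; exact: continuous_slice.
- exact: continuous_slice.
- by move=> n; exact: bs.
- exact: bs.
- move=> x; apply: (@cvg_comp _ _ _ u (fun s => h (rcons_pt s x)) _ _ _ ut).
  apply: (@continuous_comp _ _ _ (fun s => rcons_pt s x)); last exact: ch.
  exact: continuous_rcons_ptl.
Qed.

Lemma iint_slice_bound d (b A C : R) (h : 'rV[R]_d.+1 -> R) t :
  d.+1%:R / 2 + 4^-1 <= b -> 0 < A -> continuous h -> japanese_bounded b A C h ->
  `|iint (fun x => h (rcons_pt t x))| <=
       C * brint d b * (A + t ^+ 2) `^ (- (b - d%:R / 2)).
Proof.
move=> /slice_exponent[db _] A0 ch bh; rewrite opprB; apply: iint_bound => //.
- exact: sqrD_gt0.
- exact: continuous_slice.
- exact: jbounded_slice.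
Qed.

Lemma integrable_iint_slice d (b : R) (h : 'rV[R]_d.+1 -> R) :
  d.+1%:R / 2 + 4^-1 <= b -> decaying b h ->
  mu.-integrable setT (EFin \o (fun t => iint (fun x => h (rcons_pt t x)))).
Proof.
move=> db [ch [C bh]]; have [db' b34] := slice_exponent db.
have C0 := jbounded_ge0 ltr01 bh.
have := integrableZl (mu := mu) measurableT (C * brint d b) (integrable_jpow ltr01 b34).
apply: le_integrable => //.
  apply/measurable_EFinP; apply: continuous_measurable_fun.
  exact: continuous_iint_slice db' ltr01 ch bh.
move=> t _ /=; rewrite lee_fin [leRHS]ger0_norm.
  exact: iint_slice_bound db ltr01 ch bh.
by rewrite mulr_ge0 ?powR_ge0 // mulr_ge0 ?brint_ge0.
Qed.

Lemma decayingD d (b : R) (f g : 'rV[R]_d -> R) : decaying b f -> decaying b g ->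
  decaying b (fun x => f x + g x).
Proof.
move=> [cf [C bf]] [cg [D bg]]; split; first exact: (@continuous_addfun 'rV[R]_d R^o).
exists (C + D) => x; rewrite mulrDl; apply: le_trans (ler_normD _ _) _.
by apply: lerD; [exact: bf|exact: bg].
Qed.

Lemma decayingZ d (b c : R) (f : 'rV[R]_d -> R) : decaying b f -> decaying b (fun x => c * f x).
Proof.
move=> [cf [C bf]]; split.
  by apply: (@continuous_mulfun 'rV[R]_d (fun=> c)) => //; exact: cst_continuous.
by exists (`|c| * C) => x; rewrite normrM -mulrA ler_wpM2l.
Qed.

Lemma iintD d (b : R) (f g : 'rV[R]_d -> R) : d%:R / 2 + 4^-1 <= b ->
  decaying b f -> decaying b g -> iint (fun x => f x + g x) = iint f + iint g.
Proof.
elim: d f g => [//|d IH] f g db gf gg; have [db' _] := slice_exponent db.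
have b0 := exponent_ge0 db.
rewrite !iintS -RintegralD//; last 2 first.
- exact: integrable_iint_slice db gf.
- exact: integrable_iint_slice db gg.
by apply: eq_Rintegral => t _; apply: IH => //; exact: decaying_slice.
Qed.

Lemma iintZ d (b c : R) (f : 'rV[R]_d -> R) : d%:R / 2 + 4^-1 <= b ->
  decaying b f -> iint (fun x => c * f x) = c * iint f.
Proof.
elim: d f => [//|d IH] f db gf; have [db' _] := slice_exponent db.
have b0 := exponent_ge0 db.
rewrite !iintS -RintegralZl//; last exact: integrable_iint_slice db gf.
by apply: eq_Rintegral => t _; apply: IH => //; exact: decaying_slice.
Qed.

Lemma eq_iint d (f g : 'rV[R]_d -> R) : f =1 g -> iint f = iint g.
Proof. by move=> /funext ->. Qed.

Lemma iint_jpow d (b A : R) : d%:R / 2 + 4^-1 <= b -> 0 < A ->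
  iint (fun x : 'rV[R]_d => (A + r2 x) `^ (- b)) = brint d b * A `^ (d%:R / 2 - b).
Proof.
elim: d A => [|d IH] A db A0.
  by rewrite /= /r2 big_ord0 addr0 mul0r add0r mul1r.
have [db' b34] := slice_exponent db.
rewrite iintS (_ : (fun t => _) = (fun t => brint d b * (A + t ^+ 2) `^ (- (b - d%:R / 2)))).
  rewrite RintegralZl ?Rintegral_jpow//; last exact: integrable_jpow.
  rewrite (_ : 2^-1 - (b - d%:R / 2) = d.+1%:R / 2 - b); last first.
    by rewrite -natr1; field.
  by rewrite /=; ring.
apply/funext => t; rewrite opprB -IH//; last exact: sqrD_gt0.
by apply: eq_iint => x; rewrite r2_rcons_pt addrA.
Qed.

Lemma iint_translation d (b : R) (f : 'rV[R]_d -> R) (v : 'rV[R]_d) :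
  d%:R / 2 + 4^-1 <= b -> decaying b f -> (forall w, decaying b (fun x => f (x + w))) ->
  iint (fun x => f (x + v)) = iint f.
Proof.
elim: d f v => [|d IH] f v db gf gv.
  by rewrite /= (_ : 0 + v = 0)//; apply/rowP => -[].
have [db' _] := slice_exponent db; have b0 := exponent_ge0 db.
rewrite [v]rcons_pt_split; set v0 := v 0 0; set v1 := \row_i _.
rewrite !iintS.
pose G t := iint (fun x => f (rcons_pt t x)).
rewrite (_ : (fun t => _) = (fun t => G (t + v0))).
  rewrite /Rintegral integral_translation//.
  by case: gf => cf [C bf]; exact: continuous_iint_slice db' ltr01 cf bf.
apply/funext => t; under eq_fun do rewrite -rcons_ptD.
rewrite /G -(IH (fun x => f (rcons_pt (t + v0) x)) v1)//.
  exact: decaying_slice.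
move=> w; have := decaying_slice t b0 (gv (rcons_pt v0 w)).
by under eq_fun do rewrite -rcons_ptD.
Qed.

End IteratedIntegral.

(** * Dominated convergence under a singularity at the origin *)

Section SingularKernel.
Variable R : realType.
Local Notation mu := (@lebesgue_measure R).

(** Twice the derivative of t (e + t^2)^(-1/4) majorises the integrand. The resulting bound is
    uniform in e, as monotone convergence for e -> 0 requires. *)
Lemma integral_quarter_le (e K : R) : 0 < e -> 0 < K ->
  (\int[mu]_(t in `[(- K)%R, K]) ((e + t ^+ 2) `^ (- 4^-1))%:E
     <= (4 * K * (K ^+ 2) `^ (- 4^-1))%:E)%E.
Proof.
move=> e0 K0.
pose F (t : R) := t * (e + t ^+ 2) `^ (- 4^-1).
pose f (t : R) := 1 * (e + t ^+ 2) `^ (- 4^-1)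
  + t * (- 4^-1 * (e + t ^+ 2) `^ (- 4^-1 - 1) * (2 * t)).
have dF t : is_derive (t : R) (1 : R) F (f t).
  exact: is_derive_mulR (is_derive_idR t) (is_derive_jpow _ t e0).
have cid : continuous (fun t : R => t) by move=> t; exact: cvg_id.
have cst c : continuous (fun _ : R => c : R) by exact: cst_continuous.
have cf : continuous f.
  apply: (@continuous_addfun R R R^o).
    by apply: (@continuous_mulfun R R) => //; exact: continuous_jpow.
  apply: (@continuous_mulfun R R) => //.
  apply: (@continuous_mulfun R R).
    by apply: (@continuous_mulfun R R) => //; exact: continuous_jpow.
  by apply: (@continuous_mulfun R R).
have gf t : (e + t ^+ 2) `^ (- 4^-1) <= 2 * f t.
  have q := sqrD_gt0 t e0.
  rewrite /f powRB1//; set p := (e + t ^+ 2) `^ (- 4^-1).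
  have p0 : 0 <= p by exact: powR_ge0.
  have -> : 2 * (1 * p + t * (- 4^-1 * (p / (e + t ^+ 2)) * (2 * t))) =
     p * (2 - t ^+ 2 / (e + t ^+ 2)) by field; rewrite gt_eqF.
  rewrite -[leLHS]mulr1; apply: ler_wpM2l => //.
  have : t ^+ 2 / (e + t ^+ 2) <= 1 by rewrite ler_pdivrMr// mul1r lerDr ltW.
  lra.
apply: (@le_trans _ _ (\int[mu]_(t in `[(- K)%R, K]) (2 * f t)%:E)%E).
  apply: ge0_le_integral => //.
  - by move=> t _; rewrite lee_fin powR_ge0.
  - apply/measurable_EFinP/measurable_funTS; apply: continuous_measurable_fun.
    exact: continuous_jpow.
  - apply/measurable_EFinP/measurable_funTS; apply: continuous_measurable_fun.
    by apply: (@continuous_mulfun R R).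
  - by move=> t _; rewrite lee_fin.
rewrite (@integral_segment_FTC _ _ (fun t => 2 * F t)).
- rewrite lee_fin /F sqrrN; set p := (e + K ^+ 2) `^ _.
  have -> : 2 * (K * p) - 2 * (- K * p) = 4 * K * p by ring.
  apply: ler_wpM2l; first by rewrite mulr_ge0// ltW.
  apply: lerN_powR => //; first by rewrite exprn_gt0.
  by rewrite lerDr ltW.
- by rewrite gtrN.
- by apply: (@continuous_mulfun R R).
Qed.

(** k is the increasing limit of (1/(n+1) + t^2)^(-1/4), cut off outside [-K, K]. It takes extended
    real values since this limit is infinite at t = 0. *)
Lemma singular_kernel (K : R) : exists k : R -> \bar R,
  [/\ mu.-integrable setT k, forall t, (0 <= k t)%E &
   forall t, t != 0 -> `|t| <= K -> (((t ^+ 2) `^ (- 4^-1))%:E <= k t)%E].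
Proof.
wlog K0 : K / 0 < K.
  move=> H; have [k [k1 k2 k3]] := H (`|K| + 1) (ltr_pwDr ltr01 (normr_ge0 K)).
  exists k; split => // t t0 tK; apply: k3 => //.
  by rewrite (le_trans tK)// (le_trans (ler_norm K))// lerDl.
pose g n (t : R) : \bar R := ((n.+1%:R^-1 + t ^+ 2) `^ (- 4^-1))%:E.
have n0 n : 0 < n.+1%:R^-1 :> R by rewrite invr_gt0.
have mD : measurable (`[- K, K]%classic : set R) by exact: measurable_itv.
have mg n : measurable_fun `[- K, K]%classic (g n).
  apply/measurable_EFinP/measurable_funTS; apply: continuous_measurable_fun.
  exact: continuous_jpow.
have gm t : {homo (fun n => g n t) : n m / (n <= m)%N >-> (n <= m)%E}.
  move=> n m nm; rewrite lee_fin; apply: lerN_powR => //.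
    exact: sqrD_gt0.
  by rewrite lerD2r lef_pV2 ?posrE// ler_nat.
have gc t : cvgn (g ^~ t) by exact: ereal_nondecreasing_is_cvgn (gm t).
have g0 n t : (0 <= g n t)%E by rewrite lee_fin powR_ge0.
pose k t := limn (fun n => g n t).
have k0 t : (0 <= k t)%E by apply: lime_ge => //; exact: nearW.
have ik : mu.-integrable `[- K, K]%classic k.
  apply/integrableP; split.
    apply: (emeasurable_fun_cvg g) => // t _; exact: gc.
  under eq_integral do rewrite gee0_abs//.
  have H := @cvg_monotone_convergence _ _ R mu `[- K, K]%classic mD g mg
    (fun n t _ => g0 n t) (fun t _ => gm t).
  rewrite -(cvg_lim _ H)//.
  apply: (@le_lt_trans _ _ (4 * K * (K ^+ 2) `^ (- 4^-1))%:E); last exact: ltry.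
  apply: lime_le; first by apply/cvg_ex; eexists; exact: H.
  by apply: nearW => n; exact: integral_quarter_le.
exists (k \_ `[- K, K]); split.
- by have [h _] := @integrable_mkcond _ _ R mu _ k mD; exact: h.
- by move=> t; rewrite patchE; case: ifP.
move=> t t0 tK; rewrite patchE mem_set; last first.
  by rewrite /= in_itv/= -ler_norml.
rewrite /k (_ : limn _ = ((t ^+ 2) `^ (- 4^-1))%:E)//.
apply/cvg_lim => //; apply: cvg_EFin; first exact: nearW.
have t2 : 0 < t ^+ 2 by rewrite exprn_even_gt0.
apply: (@cvg_comp _ _ _ (fun n : nat => n.+1%:R^-1 + t ^+ 2 : R)
  (fun s => s `^ (- 4^-1)) _ (nbhs (t ^+ 2))).
  suff : (n.+1%:R^-1 + t ^+ 2 : R) @[n --> \oo] --> 0 + t ^+ 2 by rewrite add0r.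
  by apply: cvgD; [exact: cvg_harmonic|exact: cvg_cst].
suff : {for t ^+ 2, continuous (fun s : R => s `^ (- 4^-1))} by [].
apply/differentiable_continuous/derivable1_diffP.
by have [] := is_derive1_powR (- 4^-1) t2.
Qed.

Lemma iint0 d : iint (fun _ : 'rV[R]_d => 0) = 0.
Proof.
elim: d => [//|d IH]; rewrite iintS.
by under eq_Rintegral do rewrite IH; rewrite Rintegral_cst// mul0r.
Qed.

(* iint is an iterated integral, so domination is needed slice by slice only: over the
   last d coordinates the singular bound integrates to a multiple of |t|^(-1/2), which is
   locally integrable in the first coordinate t. The slice t = 0 is negligible. *)
Lemma iint_singular_cvg d (b' K C : R) (F_ : nat -> 'rV[R]_d.+1 -> R)
    (F : 'rV[R]_d.+1 -> R) :
  d.+1%:R / 2 + 4^-1 <= b' -> (forall n, decaying b' (F_ n)) -> 0 <= C ->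
  (forall t, t != 0 -> continuous (fun x => F (rcons_pt t x))) ->
  (forall n x, x != 0 -> `|F_ n x| <= C * r2 x `^ (- (d%:R / 2 + 4^-1))) ->
  (forall n (x : 'rV[R]_d.+1), K < `|x 0 0| -> F_ n x = 0) ->
  (forall x : 'rV[R]_d.+1, x 0 0 != 0 -> F_ n x @[n --> \oo] --> F x) ->
  iint (F_ n) @[n --> \oo] --> iint F.
Proof.
move=> db gF C0 cF bF sF FF; have [db' _] := slice_exponent db.
have [k [ik k0 kt]] := singular_kernel K.
set b : R := d%:R / 2 + 4^-1.
have bFt n t x : t != 0 -> `|F_ n (rcons_pt t x)| <= C * (t ^+ 2 + r2 x) `^ (- b).
  by move=> t0; rewrite -r2_rcons_pt; apply: bF; exact: rcons_pt_neq0.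
have bFl t x : t != 0 -> `|F (rcons_pt t x)| <= C * (t ^+ 2 + r2 x) `^ (- b).
  move=> t0; have h : F_ n (rcons_pt t x) @[n --> \oo] --> F (rcons_pt t x).
    by apply: FF; rewrite rcons_pt0.
  have h' : `|F_ n (rcons_pt t x)| @[n --> \oo] --> `|F (rcons_pt t x)|.
    exact: cvg_norm.
  rewrite -(cvg_lim _ h')//.
  apply: limr_le; first by apply/cvg_ex; eexists; exact: h'.
  by apply: nearW => n; exact: bFt.
have t20 (t : R) : t != 0 -> 0 < t ^+ 2 by move=> t0; rewrite exprn_even_gt0.
have cFn n t : continuous (fun x => F_ n (rcons_pt t x)).
  by apply: continuous_slice; case: (gF n).
have [] // := @Rintegral_dominated_cvg R
  (fun n t => iint (fun x => F_ n (rcons_pt t x)))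
  (fun t => iint (fun x => F (rcons_pt t x)))
  (fun t => (C * brint d b)%:E * k t)%E.
- move=> n; apply: continuous_measurable_fun; have [cf [D bf]] := gF n.
  exact: continuous_iint_slice db' ltr01 cf bf.
- move=> t t0.
  have [] // := @iint_dominated R d b (t ^+ 2) C
    (fun n x => F_ n (rcons_pt t x)) (fun x => F (rcons_pt t x)) (lexx _) (t20 t t0).
  + exact: cF.
  + by move=> n x; exact: bFt.
  + by move=> x; exact: bFl.
  + by move=> x; apply: FF; rewrite rcons_pt0.
- exact: integrableZl.
- move=> n t t0; have [tK|Kt] := leP `|t| K; last first.
    rewrite (_ : (fun x => _) = (fun=> 0)); last first.
      by apply/funext => x; apply: sF; rewrite rcons_pt0.
    by rewrite iint0 normr0 mule_ge0// lee_fin mulr_ge0 ?brint_ge0.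
  have h : `|iint (fun x => F_ n (rcons_pt t x))| <=
      C * brint d b * (t ^+ 2) `^ (- 4^-1).
    rewrite (_ : - 4^-1 = d%:R / 2 - b); last by rewrite /b; ring.
    by apply: iint_bound => // [|x]; [exact: t20|exact: bFt].
  apply: (@le_trans _ _ ((C * brint d b) * (t ^+ 2) `^ (- 4^-1))%:E).
    by rewrite lee_fin.
  rewrite EFinM; apply: lee_wpmul2l; first by rewrite lee_fin mulr_ge0 ?brint_ge0.
  exact: kt.
Qed.

End SingularKernel.

(** * Functions of bounded support; a derivative integrates to zero *)

Section CompactSupport.
Variables (R : realType) (d : nat).
Implicit Types (f g phi : 'rV[R]_d -> R) (x v w : 'rV[R]_d).

(** A quantitative form of compact support: it passes to products, sums, translates and derivatives
    with an explicit radius, without any closure. *)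
Definition csupp (K : R) f := forall x, K < r2 x -> f x = 0.

Lemma sqr_le_r2 x i : x 0 i ^+ 2 <= r2 x.
Proof.
rewrite /r2 (bigD1 i)//= lerDl; apply: sumr_ge0 => j _; exact: sqr_ge0.
Qed.

Lemma norm_coord_le x i : `|x 0 i| <= `|x|.
Proof. by rewrite [leRHS]mx_normrE; apply: (le_bigmax _ (fun ij => `|x ij.1 ij.2|) (0, i)). Qed.

Lemma r2_le_norm x : r2 x <= d%:R * `|x| ^+ 2.
Proof.
rewrite /r2 -[X in X%:R]card_ord -sumr_const mulr_suml; apply: ler_sum => i _.
rewrite mul1r -real_normK ?num_real// ler_sqr ?nnegrE//; exact: norm_coord_le.
Qed.

Lemma compact_r2_le (K : R) : compact [set x : 'rV[R]_d | r2 x <= K].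
Proof.
apply: bounded_closed_compact.
  exists (K + 1); split; first exact: num_real.
  move=> M KM x /= xK.
  have -> : `|x| = \big[Num.max/0]_ij `|x ij.1 ij.2| by exact: mx_normrE.
  have K0 : 0 <= K := le_trans (r2_ge0 x) xK.
  apply: bigmax_le; first by rewrite ltW// (le_lt_trans _ KM)// addr_ge0.
  move=> [i j] _ /=; rewrite (ord1 i) ltW// (le_lt_trans _ KM)//.
  rewrite -ler_sqr ?nnegrE ?addr_ge0// real_normK ?num_real//.
  by apply: le_trans (sqr_le_r2 x j) _; apply: le_trans xK _; nra.
rewrite (_ : [set x : 'rV[R]_d | _] = @r2 R d @^-1` [set s | s <= K])//.
apply: closed_comp; last exact: closed_le.
by move=> x _; exact: continuous_r2.
Qed.

Lemma csupp_bounded (K : R) f : continuous f -> csupp K f ->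
  exists2 B, 0 <= B & forall x, `|f x| <= B.
Proof.
move=> cf sf; have [K0|K0] := ltP K 0.
  exists 0 => // x; rewrite (sf x) ?normr0//.
  exact: lt_le_trans K0 (r2_ge0 x).
have [|||c _ cm] := @compact_EVT_max 'rV[R]_d R (fun x => `|f x|) [set x : 'rV[R]_d | r2 x <= K].
- by exists 0; rewrite /= /r2 big1// => i _; rewrite mxE expr0n.
- exact: compact_r2_le.
- apply: continuous_subspaceT => x; apply: (@cvg_comp _ _ _ f (fun y => `|y|)).
    exact: cf.
  exact: norm_continuous.
exists `|f c| => // x; have [xK|xK] := leP (r2 x) K.
  by apply: cm; rewrite inE.
by rewrite sf// normr0.
Qed.

Lemma csupp_decaying (b K : R) f : 0 <= b -> continuous f -> csupp K f -> decaying b f.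
Proof.
move=> b0 cf sf; split => //; have [B B0 fB] := csupp_bounded cf sf.
exists (B * (1 + K) `^ b) => x.
have x1 : 0 < 1 + r2 x by rewrite ltr_pwDl// r2_ge0.
have [xK|xK] := leP (r2 x) K; last first.
  by rewrite sf// normr0 !mulr_ge0 ?powR_ge0.
apply: le_trans (fB x) _; rewrite -mulrA ler_peMr// powRN ler_pdivlMr ?powR_gt0//.
rewrite mul1r; apply: ge0_ler_powR => //; rewrite ?nnegrE ?(ltW x1)//.
  by rewrite addr_ge0// (le_trans (r2_ge0 x) xK).
by rewrite lerD2l.
Qed.

Lemma r2D_le x w : r2 x <= 2 * r2 (x + w) + 2 * r2 w.
Proof.
rewrite /r2 !mulr_sumr -big_split; apply: ler_sum => i _ /=; rewrite mxE.
rewrite -subr_ge0 (_ : _ - _ = (x 0 i + 2 * w 0 i) ^+ 2); last by ring.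
exact: sqr_ge0.
Qed.

Lemma r2Z (c : R) v : r2 (c *: v) = c ^+ 2 * r2 v.
Proof. by rewrite /r2 mulr_sumr; apply: eq_bigr => i _; rewrite mxE exprMn. Qed.

Lemma csupp_translate (K : R) f w : csupp K f ->
  csupp (2 * K + 2 * r2 w) (fun x => f (x + w)).
Proof.
move=> sf x xK; apply: sf; have := r2D_le x w; lra.
Qed.

Lemma continuous_translate f w : continuous f -> continuous (fun x => f (x + w)).
Proof.
move=> cf x; apply: (@continuous_comp _ _ _ (fun x => x + w) f); last exact: cf.
apply: (@continuous_addfun R 'rV[R]_d 'rV[R]_d id (fun=> w)).
  by move=> y; exact: cvg_id.
exact: cst_continuous.
Qed.

Lemma csupp_derive (K : R) f v : csupp K f -> csupp K ('D_v f).
Proof.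
move=> sf x xK; rewrite (@near_eq_derive _ _ _ f (cst 0)) ?derive_cst//.
have h : nbhs x (@r2 R d @^-1` [set s | K < s]).
  by apply: continuous_r2; exact: lt_nbhsr.
apply: (@filterS 'rV[R]_d (nbhs x) (nbhs_filter x) _ _ _ h) => y /=; exact: sf.
Qed.

Lemma is_derive_line f x v (t : R) : derivable f (x + t *: v) v ->
  is_derive (t : R) (1 : R) (fun s => f (x + s *: v)) ('D_v f (x + t *: v)).
Proof.
move=> df.
have E : (fun h : R => h^-1 *: (((fun s => f (x + s *: v)) \o shift t) (h *: (1:R)) -
    (fun s => f (x + s *: v)) t)) =
  (fun h : R => h^-1 *: ((f \o shift (x + t *: v)) (h *: v) - f (x + t *: v))).
  apply/funext => h /=; congr (_ *: (f _ - _)).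
  by rewrite [h%:A]mulr1 scalerDl addrCA.
by split; rewrite /derivable /derive E.
Qed.

(** The difference quotients along v have integral 0 by translation invariance, so v may be any
    direction and the order of the integrations never changes. By the mean value theorem they are
    values of the derivative at nearby points, which dominates them. *)
Lemma iint_derive_eq0 (K : R) f v : continuous f -> (forall x, derivable f x v) ->
  continuous ('D_v f) -> csupp K f -> iint ('D_v f) = 0.
Proof.
move=> cf df cDf sf; set b : R := d%:R / 2 + 4^-1.
have b0 : 0 <= b by rewrite addr_ge0 ?divr_ge0.
have sD : csupp K ('D_v f) by exact: csupp_derive.
have [B B0 DB] := csupp_bounded cDf sD.
pose h (n : nat) : R := n.+1%:R^-1.
have h0 n : 0 < h n by rewrite invr_gt0.
have h1 n : h n <= 1 by rewrite invf_le1// ler1n.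
pose q n x := n.+1%:R * (f (x + h n *: v) + (-1) * f x).
have gf : decaying b f := csupp_decaying b0 cf sf.
have gfw w : decaying b (fun x => f (x + w)).
  apply: (@csupp_decaying b (2 * K + 2 * r2 w)) => //; first exact: continuous_translate.
  exact: csupp_translate.
have gfN : decaying b (fun x => (-1) * f x) by exact: decayingZ.
have q0 n : iint (q n) = 0.
  rewrite (@iintZ _ _ b)//; last by apply: decayingD.
  rewrite (@iintD _ _ b)// (@iintZ _ _ b)// (@iint_translation _ _ b)//.
  by rewrite mulN1r subrr mulr0.
have mvt n x : exists2 c, 0 <= c <= 1 & q n x = 'D_v f (x + c *: v).
  have [||c] := @MVT_segment R (fun s => f (x + s *: v))
    (fun s => 'D_v f (x + s *: v)) 0 (h n) (ltW (h0 n)).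
  - by move=> s _; exact: is_derive_line.
  - apply: continuous_subspaceT; apply: is_derive_continuous => s.
    exact: is_derive_line.
  rewrite in_itv/= => /andP[c0 c1]; rewrite scale0r addr0 subr0 => E.
  exists c; first by rewrite c0 (le_trans c1).
  by rewrite /q mulN1r E mulrCA divff ?mulr1// pnatr_eq0.
(* All points x with x + c v in the support, 0 <= c <= 1, satisfy r2 x <= K'. *)
pose K' := 2 * K + 2 * r2 v.
have bq n x : `|q n x| <= B * (1 + K') `^ b * (1 + r2 x) `^ (- b).
  have [c /andP[c0 c1] ->] := mvt n x.
  have x1 : 0 < 1 + r2 x by rewrite ltr_pwDl// r2_ge0.
  have [xK|xK] := leP (r2 (x + c *: v)) K; last first.
    by rewrite sD// normr0 !mulr_ge0 ?powR_ge0.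
  apply: le_trans (DB _) _; rewrite -mulrA ler_peMr// powRN ler_pdivlMr ?powR_gt0//.
  have xK' : r2 x <= K'.
    have := r2D_le x (c *: v); rewrite r2Z.
    have c2 : c ^+ 2 * r2 v <= r2 v.
      by rewrite ler_piMl ?r2_ge0// expr_le1.
    by rewrite /K'; lra.
  rewrite mul1r; apply: ge0_ler_powR => //; rewrite ?nnegrE ?(ltW x1)//.
    by rewrite addr_ge0// (le_trans (r2_ge0 x) xK').
  by rewrite lerD2l.
have cq n : continuous (q n).
  apply: (@continuous_mulfun R 'rV[R]_d (fun=> n.+1%:R)); first exact: cst_continuous.
  apply: (@continuous_addfun R 'rV[R]_d R^o); first exact: continuous_translate.
  by apply: (@continuous_mulfun R 'rV[R]_d (fun=> -1)) => //; exact: cst_continuous.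
have qD x : q n x @[n --> \oo] --> 'D_v f x.
  have := df x; rewrite /derivable => /cvg_ex[/= l L].
  have E : 'D_v f x = l by exact/cvg_lim.
  have hh : h n @[n --> \oo] --> 0^'.
    move=> A hA; have hA' : nbhs (0 : R) [set y | y != 0 -> A y] := hA.
    have [N _ HN] := @cvg_harmonic R _ hA'.
    by exists N => // n Nn; apply: (HN n Nn); rewrite /= gt_eqF// h0.
  have := @cvg_comp _ _ _ h _ _ _ _ hh L; rewrite E.
  apply: cvg_trans; apply: near_eq_cvg; apply: nearW => n /=.
  by rewrite /q mulN1r [h n *: v + x]addrC [(h n)^-1]invrK.
have bD x : `|'D_v f x| <= B * (1 + K') `^ b * (1 + r2 x) `^ (- b).
  have h' : `|q n x| @[n --> \oo] --> `|'D_v f x| by apply: cvg_norm; exact: qD.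
  rewrite -(cvg_lim _ h')//.
  apply: limr_le; first by apply/cvg_ex; eexists; exact: h'.
  by apply: nearW => n; exact: bq.
have [H _] := @iint_dominated R d b 1 _ q ('D_v f) (lexx _) ltr01 cq cDf bq bD qD.
have /cvg_lim <- // := H.
apply/cvg_lim => //; rewrite (_ : (fun n => _) = (fun=> 0)); first exact: cvg_cst.
by apply/funext.
Qed.

End CompactSupport.

Lemma continuous_subfun (R : realType) (T : topologicalType) (f g : T -> R) :
  continuous f -> continuous g -> continuous (fun x => f x - g x).
Proof. by move=> fc gc x; apply: cvgB; [exact: fc|exact: gc]. Qed.

(** * Test functions, Green's identity and Laplacians of radial functions *)

Section TestFunctions.
Variables (R : realType) (d : nat).
Implicit Types (f g phi : 'rV[R]_d -> R) (x v w : 'rV[R]_d).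

Lemma test_fun_continuous phi : test_fun phi -> continuous phi.
Proof. by move=> [dp _] x; apply: differentiable_continuous; exact: (dp [::] x). Qed.

Lemma test_fun_derivable phi x v : test_fun phi -> derivable phi x v.
Proof. by move=> [dp _]; apply: diff_derivable; exact: (dp [::] x). Qed.

Lemma test_fun_csupp phi : test_fun phi -> exists K, csupp K phi.
Proof.
move=> [_ /compact_bounded[M [_ HM]]].
exists (d%:R * (`|M| + 1) ^+ 2) => x xK; apply/eqP/negP => /negP p0.
have xc : closure [set y | phi y != 0] x by exact: subset_closure.
have /= h := HM (`|M| + 1) (le_lt_trans (ler_norm M) (ltr_pwDr ltr01 (lexx _))) x xc.
have : r2 x <= d%:R * (`|M| + 1) ^+ 2.
  apply: le_trans (r2_le_norm x) _; apply: ler_wpM2l => //.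
  by rewrite ler_sqr ?nnegrE ?addr_ge0.
by rewrite leNgt xK.
Qed.

Lemma iD_rcons s (i : 'I_d) f : iD s ('D_(ebasis R i) f) = iD (rcons s i) f.
Proof. by elim: s => //= j s ->. Qed.

Lemma test_fun_derive (i : 'I_d) phi : test_fun phi -> test_fun ('D_(ebasis R i) phi).
Proof.
move=> [dp cp]; split; first by move=> s x; rewrite iD_rcons.
apply: subclosed_compact cp _; first exact: closed_closure.
rewrite [X in _ `<=` X](closure_id _).1; last exact: closed_closure.
apply: closureS => x /= D0; apply: contrapT => xn; move/eqP: D0; apply.
have h : nbhs x (~` closure [set y | phi y != 0]).
  by apply: open_nbhs_nbhs; split=> //; apply: closed_openC; exact: closed_closure.
rewrite (@near_eq_derive _ _ _ phi (cst 0)) ?derive_cst//.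
apply: (@filterS 'rV[R]_d (nbhs x) (nbhs_filter x) _ _ _ h) => y /= yn.
by apply/eqP; apply: contra_notT yn => yn; exact: subset_closure.
Qed.

Lemma iD0 s : iD s (fun _ : 'rV[R]_d => 0) = (fun=> 0).
Proof.
elim: s => //= i s ->; apply/funext => x.
by have := derive_cst (0 : R) x (ebasis R i).
Qed.

Lemma test_fun0 : test_fun (fun _ : 'rV[R]_d => 0).
Proof.
split; first by move=> s x; rewrite iD0; exact: differentiable_cst.
rewrite (_ : [set x | _] = set0); last by apply/seteqP; split => x //=; rewrite eqxx.
by rewrite closure0; exact: compact0.
Qed.

Lemma iDD s f g : (forall s x, differentiable (iD s f) x) ->
  (forall s x, differentiable (iD s g) x) ->
  iD s (f \+ g) = iD s f \+ iD s g.
Proof.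
move=> df dg; elim: s => //= i s ->; apply/funext => x.
by rewrite deriveD//; apply: diff_derivable.
Qed.

Lemma test_funD f g : test_fun f -> test_fun g -> test_fun (f \+ g).
Proof.
move=> [df cf] [dg cg]; split.
  by move=> s x; rewrite iDD//; apply: differentiableD.
apply: (subclosed_compact _ (compactU cf cg)); first exact: closed_closure.
rewrite -closureU; apply: closureS => x /=.
have [->|f0] := eqVneq (f x) 0; last by left.
by rewrite add0r; right.
Qed.

Lemma test_fun_sum n (F : 'I_n -> 'rV[R]_d -> R) : (forall i, test_fun (F i)) ->
  test_fun (fun x => \sum_(i < n) F i x).
Proof.
elim: n F => [|n IH] F tF.
  by under eq_fun do rewrite big_ord0; exact: test_fun0.
under eq_fun do rewrite big_ord_recl.
by apply: (@test_funD (F ord0)) => //; apply: (IH (fun i => F (lift ord0 i))).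
Qed.

Lemma test_fun_lap phi : test_fun phi -> test_fun (lap phi).
Proof. by move=> tp; apply: test_fun_sum => i; do 2 apply: test_fun_derive. Qed.

Lemma csuppM (K : R) f g : csupp K g -> csupp K (fun x => f x * g x).
Proof. by move=> sg x xK; rewrite sg// mulr0. Qed.

Lemma csuppB (K : R) f g : csupp K f -> csupp K g -> csupp K (fun x => f x - g x).
Proof. by move=> sf sg x xK; rewrite sf// sg// subrr. Qed.

Lemma csupp_sum (K : R) n (F : 'I_n -> 'rV[R]_d -> R) : (forall i, csupp K (F i)) ->
  csupp K (fun x => \sum_(i < n) F i x).
Proof. by move=> sF x xK; rewrite big1// => i _; exact: sF. Qed.

Lemma iint_sum (b : R) n (F : 'I_n -> 'rV[R]_d -> R) : d%:R / 2 + 4^-1 <= b ->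
  (forall i, decaying b (F i)) ->
  decaying b (fun x => \sum_(i < n) F i x) /\
  iint (fun x => \sum_(i < n) F i x) = \sum_(i < n) iint (F i).
Proof.
move=> db; elim: n F => [|n IH] F gF.
  under eq_fun do rewrite big_ord0; rewrite big_ord0 iint0; split => //.
  split; first exact: cst_continuous.
  by exists 0 => x; rewrite normr0 mul0r.
have [g1 E] := IH (fun i => F (lift ord0 i)) (fun i => gF _).
rewrite big_ord_recl -E; split.
  by under eq_fun do rewrite big_ord_recl; exact: decayingD.
under eq_fun do rewrite big_ord_recl.
by rewrite (iintD db).
Qed.

Lemma csupp_iintB (K : R) f g : continuous f -> continuous g ->
  csupp K f -> csupp K g -> iint (fun x => f x - g x) = iint f - iint g.
Proof.
move=> cf cg sf sg; set b : R := d%:R / 2 + 4^-1.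
have b0 : 0 <= b by rewrite addr_ge0 ?divr_ge0.
have gf := csupp_decaying b0 cf sf; have gg := csupp_decaying b0 cg sg.
rewrite -mulN1r -(iintZ (-1) (lexx b) gg) -(iintD (lexx b) gf (decayingZ (-1) gg)).
by apply: eq_iint => x; rewrite mulN1r.
Qed.

(** The difference of the integrands is the divergence of the field u D_i phi - (D_i u) phi, the
    mixed terms cancelling; each of its partial derivatives has integral 0. *)
Lemma green_identity (u phi : 'rV[R]_d -> R) : test_fun phi -> continuous u ->
  (forall i x, derivable u x (ebasis R i)) ->
  (forall i, continuous ('D_(ebasis R i) u)) ->
  (forall i x, derivable ('D_(ebasis R i) u) x (ebasis R i)) ->
  (forall i, continuous ('D_(ebasis R i) ('D_(ebasis R i) u))) ->
  iint (fun x => u x * lap phi x) = iint (fun x => lap u x * phi x).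
Proof.
move=> tp cu du cDu dDu cDDu.
have [K sp] := test_fun_csupp tp.
have cp := test_fun_continuous tp.
have tD i := test_fun_derive i tp; have tDD i := test_fun_derive i (tD i).
have sD i : csupp K ('D_(ebasis R i) phi) by exact: csupp_derive.
have sDD i : csupp K ('D_(ebasis R i) ('D_(ebasis R i) phi)) by exact: csupp_derive.
have cD i := test_fun_continuous (tD i); have cDD i := test_fun_continuous (tDD i).
have slp : csupp K (lap phi).
  exact: (@csupp_sum K d (fun i => 'D_(ebasis R i) ('D_(ebasis R i) phi)) sDD).
have clp : continuous (lap phi) by exact: test_fun_continuous (test_fun_lap tp).
have clu : continuous (lap u).
  apply: (@continuous_sum_ord R 'rV[R]_d R^o d
    (fun i => 'D_(ebasis R i) ('D_(ebasis R i) u))).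
  exact: cDDu.
have c1 : continuous (fun x => u x * lap phi x).
  exact: (@continuous_mulfun R 'rV[R]_d u (lap phi) cu clp).
have c2 : continuous (fun x => lap u x * phi x).
  exact: (@continuous_mulfun R 'rV[R]_d (lap u) phi clu cp).
have s1 : csupp K (fun x => u x * lap phi x) by exact: (@csuppM K u (lap phi) slp).
have s2 : csupp K (fun x => lap u x * phi x) by exact: (@csuppM K (lap u) phi sp).
apply/eqP; rewrite -subr_eq0; have <- := csupp_iintB c1 c2 s1 s2.
pose F i x := u x * 'D_(ebasis R i) phi x - 'D_(ebasis R i) u x * phi x.
have sF i : csupp K (F i) by apply: csuppB; exact: csuppM.
have isd i x : is_derive x (ebasis R i) (F i)
    (u x * 'D_(ebasis R i) ('D_(ebasis R i) phi) x -
     'D_(ebasis R i) ('D_(ebasis R i) u) x * phi x).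
  have h1 := derivableP (du i x); have h2 := derivableP (dDu i x).
  have h3 : is_derive x (ebasis R i) phi ('D_(ebasis R i) phi x).
    by apply: derivableP; exact: test_fun_derivable.
  have h4 : is_derive x (ebasis R i) ('D_(ebasis R i) phi)
      ('D_(ebasis R i) ('D_(ebasis R i) phi) x).
    by apply: derivableP; exact: test_fun_derivable.
  apply: is_derive_eq (is_deriveB (is_deriveM h1 h4) (is_deriveM h2 h3)) _.
  rewrite /GRing.scale /=.
  generalize ('D_(ebasis R i) ('D_(ebasis R i) u) x)
    ('D_(ebasis R i) ('D_(ebasis R i) phi) x) ('D_(ebasis R i) u x)
    ('D_(ebasis R i) phi x) (u x) (phi x) => *; ring.
have EF i : 'D_(ebasis R i) (F i) = fun x =>
    u x * 'D_(ebasis R i) ('D_(ebasis R i) phi) x -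
     'D_(ebasis R i) ('D_(ebasis R i) u) x * phi x.
  by apply/funext => x; have [_ ->] := isd i x.
have cF i : continuous (F i).
  apply: (@continuous_subfun R 'rV[R]_d).
    exact: (@continuous_mulfun R 'rV[R]_d u ('D_(ebasis R i) phi) cu (cD i)).
  exact: (@continuous_mulfun R 'rV[R]_d ('D_(ebasis R i) u) phi (cDu i) cp).
have cDF i : continuous ('D_(ebasis R i) (F i)).
  rewrite EF; apply: (@continuous_subfun R 'rV[R]_d).
    exact: (@continuous_mulfun R 'rV[R]_d u ('D_(ebasis R i) ('D_(ebasis R i) phi)) cu (cDD i)).
  exact: (@continuous_mulfun R 'rV[R]_d ('D_(ebasis R i) ('D_(ebasis R i) u)) phi (cDDu i) cp).
set b : R := d%:R / 2 + 4^-1.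
have b0 : 0 <= b by rewrite addr_ge0 ?divr_ge0.
have sDF i : csupp K ('D_(ebasis R i) (F i)) by exact: csupp_derive.
have [_ E] := @iint_sum b d (fun i => 'D_(ebasis R i) (F i)) (lexx _)
  (fun i => csupp_decaying b0 (cDF i) (sDF i)).
have -> : (fun x => u x * lap phi x - lap u x * phi x) =
   (fun x => \sum_(i < d) 'D_(ebasis R i) (F i) x).
  apply/funext => x; rewrite /lap mulr_sumr mulr_suml -sumrB.
  by apply: eq_bigr => i _; exact: (esym (congr1 (fun f => f x) (EF i))).
rewrite E big1// => i _; apply: (@iint_derive_eq0 R d K) => //.
Qed.

Lemma is_derive_of_line f x v (D : R) :
  is_derive (0 : R) (1 : R) (fun s => f (x + s *: v)) D -> is_derive x v f D.
Proof.
have E : (fun h : R => h^-1 *: (((fun s => f (x + s *: v)) \o shift 0) (h *: (1:R)) -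
    (fun s => f (x + s *: v)) 0)) =
  (fun h : R => h^-1 *: ((f \o shift x) (h *: v) - f x)).
  apply/funext => h /=.
  by rewrite addr0 [h%:A]mulr1 scale0r addr0 [x + _]addrC.
by move=> [h1 h2]; split; move: h1 h2; rewrite /derivable /derive E.
Qed.

Lemma r2_line x (i : 'I_d) (s : R) :
  r2 (x + s *: ebasis R i) = r2 x + (2 * x 0 i * s + s * s).
Proof.
rewrite /r2 (bigD1 i)//= [in RHS](bigD1 i)//= !mxE !eqxx mulr1.
rewrite (eq_bigr (fun j => x 0 j ^+ 2)); first by ring.
by move=> j ji; rewrite !mxE (negbTE ji) andbF mulr0 addr0.
Qed.

Lemma coord_line x (i : 'I_d) (s : R) : (x + s *: ebasis R i) 0 i = x 0 i + s.
Proof. by rewrite !mxE !eqxx mulr1. Qed.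

(** The offset e is a positive regularisation in the kernels and -1 in the bump function. *)
Lemma is_derive_radial (h : R -> R) (e dh : R) x (i : 'I_d) :
  is_derive (r2 x + e : R) (1 : R) h dh ->
  is_derive x (ebasis R i) (fun y => h (r2 y + e)) (2 * x 0 i * dh).
Proof.
move=> dhh; apply: is_derive_of_line.
pose g (s : R) := r2 x + e + (2 * x 0 i * s + s * s).
rewrite (_ : (fun s => _) = h \o g); last first.
  by apply/funext => s; rewrite /= r2_line /g addrAC.
have dg : is_derive (0 : R) (1 : R) g (2 * x 0 i).
  have := is_derive_addR (is_derive_cstR (r2 x + e) 0) (is_derive_addR
    (is_derive_cmulR (2 * x 0 i) (is_derive_idR 0))
    (is_derive_mulR (is_derive_idR 0) (is_derive_idR 0))).
  by move=> H; apply: is_derive_eq H _; ring.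
have g0 : g 0 = r2 x + e by rewrite /g !mulr0 !addr0.
have := @is_derive1_comp R h g 0 dh (2 * x 0 i).
rewrite g0 => /(_ dhh dg) H; apply: is_derive_eq H _; ring.
Qed.

Lemma is_derive_radial2 (h : R -> R) (e dh : R) x (i : 'I_d) :
  is_derive (r2 x + e : R) (1 : R) h dh ->
  is_derive x (ebasis R i) (fun y => 2 * y 0 i * h (r2 y + e))
    (2 * h (r2 x + e) + 4 * x 0 i ^+ 2 * dh).
Proof.
move=> dhh.
have d1 : is_derive x (ebasis R i) (fun y => 2 * y 0 i) 2.
  apply: is_derive_of_line.
  rewrite (_ : (fun s => _) = fun s => 2 * (x 0 i + s)); last first.
    by apply/funext => s; rewrite coord_line.
  have := is_derive_cmulR 2 (is_derive_addR (is_derive_cstR (x 0 i) 0) (is_derive_idR 0)).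
  by move=> H; apply: is_derive_eq H _; rewrite add0r mulr1.
have := is_deriveM d1 (is_derive_radial i dhh).
by move=> H; apply: is_derive_eq H _; rewrite /GRing.scale /=; ring.
Qed.

(** The sum over i of 2 h' + 4 x_i^2 h'' is 2 d h' + 4 r2 h''. Since e > 0, only the values of h on
    the positive reals enter. *)
Lemma green_radial (h h1 h2 : R -> R) (e : R) phi : 0 < e -> test_fun phi ->
  (forall s : R, 0 < s -> is_derive (s : R) (1 : R) h (h1 s)) ->
  (forall s : R, 0 < s -> is_derive (s : R) (1 : R) h1 (h2 s)) ->
  (forall s : R, 0 < s -> {for s, continuous h2}) ->
  iint (fun x => h (r2 x + e) * lap phi x) =
  iint (fun x => (2 * d%:R * h1 (r2 x + e) + 4 * r2 x * h2 (r2 x + e)) * phi x).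
Proof.
move=> e0 tp dh dh1 ch2.
have p x : 0 < r2 x + e by rewrite ltr_wpDl// r2_ge0.
have ce : continuous (fun x => r2 x + e).
  apply: (@continuous_addfun R 'rV[R]_d R^o (@r2 R d) (fun=> e)).
    exact: continuous_r2.
  exact: cst_continuous.
have cc (k : R -> R) : (forall s : R, 0 < s -> {for s, continuous k}) ->
    continuous (fun x => k (r2 x + e)).
  move=> ck x; apply: (@continuous_comp _ _ _ (fun x => r2 x + e) k); first exact: ce.
  by apply: ck; exact: p.
have cd (k k1 : R -> R) : (forall s : R, 0 < s -> is_derive (s : R) (1 : R) k (k1 s)) ->
    (forall s : R, 0 < s -> {for s, continuous k}).
  move=> dk s s0; apply/differentiable_continuous/derivable1_diffP.
  by have [] := dk s s0.
have ch := cd _ _ dh; have ch1 := cd _ _ dh1.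
have D1 i : 'D_(ebasis R i) (fun y => h (r2 y + e)) = fun x => 2 * x 0 i * h1 (r2 x + e).
  by apply/funext => x; have [_ ->] := is_derive_radial i (dh _ (p x)).
have D2 i : 'D_(ebasis R i) ('D_(ebasis R i) (fun y => h (r2 y + e))) =
    fun x => 2 * h1 (r2 x + e) + 4 * x 0 i ^+ 2 * h2 (r2 x + e).
  by rewrite D1; apply/funext => x; have [_ ->] := is_derive_radial2 i (dh1 _ (p x)).
have ccst (c : R) : continuous (fun _ : 'rV[R]_d => c) by exact: cst_continuous.
have cx i : continuous (fun x : 'rV[R]_d => x 0 i) by exact: coord_continuous.
rewrite (green_identity tp); first last.
- move=> i; rewrite D2; apply: (@continuous_addfun R 'rV[R]_d R^o).
    by apply: (@continuous_mulfun R 'rV[R]_d) => //; exact: cc.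
  apply: (@continuous_mulfun R 'rV[R]_d); last exact: cc.
  apply: (@continuous_mulfun R 'rV[R]_d) => //.
  under eq_fun do rewrite expr2; exact: (@continuous_mulfun R 'rV[R]_d).
- by move=> i x; rewrite D1; have [] := is_derive_radial2 i (dh1 _ (p x)).
- move=> i; rewrite D1; apply: (@continuous_mulfun R 'rV[R]_d); last exact: cc.
  exact: (@continuous_mulfun R 'rV[R]_d).
- by move=> i x; have [] := is_derive_radial i (dh _ (p x)).
- exact: cc.
apply: eq_iint => x; congr (_ * _); rewrite /lap.
rewrite (eq_bigr (fun i => 2 * h1 (r2 x + e) + 4 * x 0 i ^+ 2 * h2 (r2 x + e))).
  2: by move=> i _; exact: (congr1 (fun f => f x) (D2 i)).
rewrite big_split /= sumr_const card_ord -mulr_suml -mulr_sumr.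
by rewrite -/(r2 x) -mulr_natr; ring.
Qed.

End TestFunctions.

(** * Power-logarithm kernels and the passage to the limit in the regularisation *)

Section RadialLimits.
Variable R : realType.

(** For varying coefficients this family is closed under d/ds and multiplication by s, so powers and
    powers times logarithms are treated at once. *)
Definition plog (a al be s : R) : R := s `^ a * (al * ln s + be).

Lemma is_derive_plog (a al be s : R) : 0 < s ->
  is_derive (s : R) (1 : R) (plog a al be) (plog (a - 1) (a * al) (a * be + al) s).
Proof.
move=> s0.
have dl := is_derive_addR (is_derive_cmulR al (is_derive1_ln s0)) (is_derive_cstR be s).
apply: is_derive_eq (is_derive_mulR (is_derive1_powR a s0) dl) _.
by rewrite /plog powRB1//; field; rewrite gt_eqF.
Qed.

Lemma continuous_plog (a al be s : R) : 0 < s -> {for s, continuous (plog a al be)}.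
Proof.
move=> s0; apply/differentiable_continuous/derivable1_diffP.
by have [] := is_derive_plog a al be s0.
Qed.

(** Apply ln t <= 2 t^(1/2) to s and to 1/s. *)
Lemma normr_ln_le (s : R) : 0 < s -> `|ln s| <= 2 * (s `^ 2^-1 + s `^ (- 2^-1)).
Proof.
move=> s0.
have H (t : R) : 0 < t -> ln t <= 2 * t `^ 2^-1.
  move=> t0; have p := powR_gt0 2^-1 t0.
  have : ln (t `^ 2^-1) <= t `^ 2^-1.
    by apply: ltW; exact: ln_sublinear.
  by rewrite ln_powR; lra.
have p1 := powR_ge0 s 2^-1; have p2 := powR_ge0 s (- 2^-1).
have h1 := H s s0.
have si : 0 < s^-1 by rewrite invr_gt0.
have h2 := H s^-1 si; rewrite lnV ?posrE// in h2.
have E : s^-1 `^ 2^-1 = s `^ (- 2^-1).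
  by rewrite -powR_inv1 ?(ltW s0)// -powRrM mulN1r.
rewrite E in h2.
by rewrite ler_norml; apply/andP; split; lra.
Qed.

(** The logarithm costs a factor s^(-1/2) near 0. For q = d/2 + 1/4, as in [iint_singular_cvg],
    every a >= 1 - (d+1)/2 still satisfies the condition, with 1/4 to spare. *)
Lemma plog_bound (a al be q K : R) : 0 <= q -> 0 <= a - 2^-1 + q ->
  exists2 C, 0 <= C & forall s, 0 < s -> s <= K -> `|plog a al be s| <= C * s `^ (- q).
Proof.
move=> q0 aq.
have [K0|K0] := leP K 0.
  by exists 0 => // s s0 sK; have := lt_le_trans s0 (le_trans sK K0); rewrite ltxx.
have k1 : 0 <= K `^ (a + 2^-1 + q) by exact: powR_ge0.
have k2 : 0 <= K `^ (a - 2^-1 + q) by exact: powR_ge0.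
have k3 : 0 <= K `^ (a + q) by exact: powR_ge0.
exists (2 * `|al| * (K `^ (a + 2^-1 + q) + K `^ (a - 2^-1 + q)) + `|be| * K `^ (a + q)).
  by rewrite addr_ge0// !mulr_ge0// addr_ge0.
move=> s s0 sK.
have mono e : 0 <= e + q -> s `^ e <= K `^ (e + q) * s `^ (- q).
  move=> eq0; have -> : s `^ e = s `^ (e + q) * s `^ (- q).
    by rewrite -powRD ?addrK// (gt_eqF s0) implybT.
  rewrite ler_wpM2r ?powR_ge0//; apply: ge0_ler_powR => //; rewrite ?nnegrE ltW//.
rewrite /plog normrM (ger0_norm (powR_ge0 _ _)).
apply: (@le_trans _ _ (s `^ a * (`|al| * (2 * (s `^ 2^-1 + s `^ (- 2^-1))) + `|be|))).
  rewrite ler_wpM2l ?powR_ge0//; apply: le_trans (ler_normD _ _) _.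
  by rewrite lerD2r normrM ler_wpM2l// normr_ln_le.
have E1 : s `^ a * s `^ 2^-1 = s `^ (a + 2^-1).
  by rewrite powRD// (gt_eqF s0) implybT.
have E2 : s `^ a * s `^ (- 2^-1) = s `^ (a - 2^-1).
  by rewrite powRD// (gt_eqF s0) implybT.
have -> : s `^ a * (`|al| * (2 * (s `^ 2^-1 + s `^ (- 2^-1))) + `|be|) =
  2 * `|al| * (s `^ (a + 2^-1) + s `^ (a - 2^-1)) + `|be| * s `^ a.
  by rewrite -E1 -E2; ring.
have m1 : s `^ (a + 2^-1) <= K `^ (a + 2^-1 + q) * s `^ (- q) by apply: mono; lra.
have m2 : s `^ (a - 2^-1) <= K `^ (a - 2^-1 + q) * s `^ (- q) by exact: mono.
have m3 : s `^ a <= K `^ (a + q) * s `^ (- q) by apply: mono; lra.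
rewrite -subr_ge0 (_ : _ - _ =
  2 * `|al| * ((K `^ (a + 2^-1 + q) * s `^ (- q) - s `^ (a + 2^-1)) +
               (K `^ (a - 2^-1 + q) * s `^ (- q) - s `^ (a - 2^-1))) +
  `|be| * (K `^ (a + q) * s `^ (- q) - s `^ a)); last by ring.
apply: addr_ge0; apply: mulr_ge0 => //; last by rewrite subr_ge0.
by apply: addr_ge0; rewrite subr_ge0.
Qed.

Lemma radial_cvg d (C K : R) (w_ : nat -> R -> R) (w : R -> R) (psi : 'rV[R]_d.+1 -> R) :
  continuous psi -> csupp K psi -> 0 <= C ->
  (forall n, continuous (fun x : 'rV[R]_d.+1 => w_ n (r2 x))) ->
  (forall s : R, 0 < s -> {for s, continuous w}) ->
  (forall n s, 0 < s -> s <= K -> `|w_ n s| <= C * s `^ (- (d%:R / 2 + 4^-1))) ->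
  (forall s, 0 < s -> w_ n s @[n --> \oo] --> w s) ->
  iint (fun x : 'rV[R]_d.+1 => w_ n (r2 x) * psi x) @[n --> \oo] -->
  iint (fun x : 'rV[R]_d.+1 => w (r2 x) * psi x).
Proof.
move=> cp sp C0 cw cw0 bw ww; have [B B0 pB] := csupp_bounded cp sp.
have r20 (x : 'rV[R]_d.+1) : x != 0 -> 0 < r2 x.
  move=> x0; rewrite lt_neqAle r2_ge0 andbT eq_sym; apply: contra_neq x0 => /eqP.
  rewrite psumr_eq0; last by move=> i _; exact: sqr_ge0.
  move=> /allP h; apply/rowP => i; rewrite mxE; apply/eqP; rewrite -sqrf_eq0.
  exact: (h i (mem_index_enum i)).
set b' : R := d.+1%:R / 2 + 4^-1.
have b0 : 0 <= b' by rewrite addr_ge0 ?divr_ge0.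
apply: (@iint_singular_cvg R d b' (`|K| + 1) (C * B)) => //.
- move=> n; apply: (@csupp_decaying _ _ b' K) => //; last exact: csuppM.
  exact: (@continuous_mulfun R 'rV[R]_d.+1).
- exact: mulr_ge0.
- move=> t t0; apply: (@continuous_mulfun R 'rV[R]_d).
    move=> x; apply: (@continuous_comp _ _ _ (fun x => r2 (rcons_pt t x)) w).
      exact: (continuous_slice (continuous_r2 (d := d.+1))).
    by apply: cw0; apply: r20; exact: rcons_pt_neq0.
  exact: continuous_slice.
- move=> n x x0; rewrite normrM.
  have [xK|xK] := leP (r2 x) K; last first.
    by rewrite (sp x)// normr0 mulr0 !mulr_ge0 ?powR_ge0.
  rewrite -mulrA [B * _]mulrC mulrA; apply: ler_pM => //.
  by apply: bw => //; exact: r20.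
- move=> n x xK; rewrite sp ?mulr0//; apply: lt_le_trans (sqr_le_r2 x 0).
  rewrite -(real_normK (num_real (x 0 0))).
  have K0 := ler_norm K; have K1 := normr_ge0 K.
  by have := normr_ge0 (x 0 0); nra.
- move=> x x0; apply: cvgM; last exact: cvg_cst.
  apply: ww; apply: r20; apply: contra_neq x0 => ->; exact: mxE.
Qed.

Lemma cvg_shift_harmonic (k : R -> R) (s : R) : {for s, continuous k} ->
  k (s + n.+1%:R^-1) @[n --> \oo] --> k s.
Proof.
move=> ck; apply: (@cvg_comp _ _ _ (fun n : nat => s + n.+1%:R^-1 : R) k _ (nbhs s)) => //.
suff : (s + n.+1%:R^-1 : R) @[n --> \oo] --> s + 0 by rewrite addr0.
by apply: cvgD; [exact: cvg_cst|exact: cvg_harmonic].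
Qed.

Lemma invS_gt0 n : 0 < n.+1%:R^-1 :> R. Proof. by rewrite invr_gt0. Qed.
Lemma invS_le1 n : n.+1%:R^-1 <= 1 :> R. Proof. by rewrite invf_le1// ler1n. Qed.

Lemma r2_shift_gt0 d (x : 'rV[R]_d) (e : R) : 0 < e -> 0 < r2 x + e.
Proof. by move=> e0; rewrite ltr_wpDl// r2_ge0. Qed.

Lemma continuous_r2_shift d (e : R) (k : R -> R) : 0 < e ->
  (forall s : R, 0 < s -> {for s, continuous k}) ->
  continuous (fun x : 'rV[R]_d => k (r2 x + e)).
Proof.
move=> e0 ck x; apply: (@continuous_comp _ _ _ (fun x => r2 x + e) k).
  apply: (@continuous_addfun R 'rV[R]_d R^o (@r2 R d) (fun=> e)).
    exact: continuous_r2.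
  exact: cst_continuous.
by apply: ck; exact: r2_shift_gt0.
Qed.

(** The bound is uniform in n: the shift is at most 1, whence K + 1, and s^(-q) only decreases under
    it. *)
Lemma plog_shift_bound (a al be q K : R) : 0 <= q -> 0 <= a - 2^-1 + q ->
  exists2 C, 0 <= C & forall n s, 0 < s -> s <= K ->
     `|plog a al be (s + n.+1%:R^-1)| <= C * s `^ (- q).
Proof.
move=> q0 aq; have [C C0 HC] := @plog_bound a al be q (K + 1) q0 aq.
exists C => // n s s0 sK.
have e0 := invS_gt0 n; have e1 := invS_le1 n.
apply: le_trans (HC _ _ _) _; [by rewrite addr_gt0|by apply: lerD|].
by apply: ler_wpM2l => //; apply: lerN_powR => //; rewrite lerDl ltW.
Qed.

Lemma plog_reg_cvg d (a al be K : R) (psi : 'rV[R]_d.+1 -> R) :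
  1 - d.+1%:R / 2 <= a -> continuous psi -> csupp K psi ->
  iint (fun x : 'rV[R]_d.+1 => plog a al be (r2 x + n.+1%:R^-1) * psi x) @[n --> \oo] -->
  iint (fun x : 'rV[R]_d.+1 => plog a al be (r2 x) * psi x).
Proof.
move=> ha cp sp; rewrite -natr1 in ha.
have q0 : 0 <= d%:R / 2 + 4^-1 :> R by rewrite addr_ge0 ?divr_ge0.
have [|C C0 HC] := @plog_shift_bound a al be _ K q0; first by lra.
apply: (@radial_cvg d C K (fun n s => plog a al be (s + n.+1%:R^-1))) => //.
- move=> n; apply: continuous_r2_shift; first exact: invS_gt0.
  by move=> s; exact: continuous_plog.
- by move=> s; exact: continuous_plog.
- by move=> s s0; apply: cvg_shift_harmonic; exact: continuous_plog.
Qed.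

(** Since a - 1 >= 1 - m/2, the Laplacian 4 s h'' + 2 m h' of the kernel is again locally
    integrable. Both sides of [green_radial] converge, and no delta appears. *)
Lemma lap_plog d (a al be : R) (phi : 'rV[R]_d.+1 -> R) :
  2 - d.+1%:R / 2 <= a -> test_fun phi ->
  iint (fun x => plog a al be (r2 x) * lap phi x) =
  iint (fun x => plog (a - 1) (4 * a * (a - 1 + d.+1%:R / 2) * al)
    (4 * a * (a - 1 + d.+1%:R / 2) * be + (8 * a - 4 + 2 * d.+1%:R) * al) (r2 x) * phi x).
Proof.
move=> ha tp; set m : R := d.+1%:R.
have tl := test_fun_lap tp.
have [K sp] := test_fun_csupp tp; have [K' sl] := test_fun_csupp tl.
have cp := test_fun_continuous tp; have cl := test_fun_continuous tl.
pose h1 := plog (a - 1) (a * al) (a * be + al).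
pose al2 := (a - 1) * (a * al); pose be2 := (a - 1) * (a * be + al) + a * al.
pose h2 := plog (a - 1 - 1) al2 be2.
have H1 := @plog_reg_cvg d a al be K' (lap phi) _ cl sl.
have ha' : 1 - m / 2 <= a by apply: le_trans ha; rewrite lerD2r; lra.
have {}H1 := H1 ha'.
have E n := @green_radial R d.+1 (plog a al be) h1 h2 _ phi (invS_gt0 n) tp
  (fun s s0 => is_derive_plog a al be s0) (fun s s0 => is_derive_plog _ _ _ s0)
  (fun s s0 => @continuous_plog _ _ _ s s0).
pose w_ n (s : R) := 2 * m * h1 (s + n.+1%:R^-1) + 4 * s * h2 (s + n.+1%:R^-1).
pose w := plog (a - 1) (4 * a * (a - 1 + m / 2) * al)
    (4 * a * (a - 1 + m / 2) * be + (8 * a - 4 + 2 * m) * al).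
have q0 : 0 <= d%:R / 2 + 4^-1 :> R by rewrite addr_ge0 ?divr_ge0.
(* The second derivative alone may be too singular; the factor s in front of it restores the
   exponent a - 1. *)
have sh2 (s : R) : 0 < s -> s * h2 s = plog (a - 1) al2 be2 s.
  by move=> s0; rewrite /h2 /plog (powRB1 _ s0); field; rewrite gt_eqF.
have [|C1 C10 HC1] := @plog_shift_bound (a - 1) (a * al) (a * be + al) _ K q0.
  by move: ha; rewrite -[d.+1%:R]natr1; lra.
have [|C2 C20 HC2] := @plog_shift_bound (a - 1) al2 be2 _ K q0.
  by move: ha; rewrite -[d.+1%:R]natr1; lra.
have ch1 s : 0 < s -> {for s, continuous h1} by exact: continuous_plog.
have ch2 s : 0 < s -> {for s, continuous h2} by exact: continuous_plog.
have H2 : iint (fun x : 'rV[R]_d.+1 => w_ n (r2 x) * phi x) @[n --> \oo] -->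
  iint (fun x : 'rV[R]_d.+1 => w (r2 x) * phi x).
  apply: (@radial_cvg d (2 * m * C1 + 4 * C2) K) => //.
  - by rewrite addr_ge0 ?mulr_ge0// ler0n.
  - move=> n; apply: (@continuous_addfun R 'rV[R]_d.+1 R^o).
      apply: (@continuous_mulfun R 'rV[R]_d.+1); first exact: cst_continuous.
      apply: continuous_r2_shift; first exact: invS_gt0.
      exact: ch1.
    apply: (@continuous_mulfun R 'rV[R]_d.+1).
      apply: (@continuous_mulfun R 'rV[R]_d.+1); first exact: cst_continuous.
      exact: continuous_r2.
    apply: continuous_r2_shift; first exact: invS_gt0.
    exact: ch2.
  - by move=> s; exact: continuous_plog.
  - move=> n s s0 sK; have e0 := invS_gt0 n.
    rewrite mulrDl; apply: le_trans (ler_normD _ _) _; apply: lerD.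
      rewrite normrM ger0_norm; last by rewrite mulr_ge0// ler0n.
      rewrite -mulrA; apply: ler_wpM2l; first by rewrite mulr_ge0// ler0n.
      exact: HC1.
    (* The factor is s while [h2] is taken at the shifted point; s is first enlarged to that point
       so that [sh2] applies. *)
    apply: (@le_trans _ _ (4 * `|plog (a - 1) al2 be2 (s + n.+1%:R^-1)|)).
      rewrite -sh2 ?addr_gt0// !normrM -mulrA [`|4|]ger0_norm//.
      rewrite ler_wpM2l// ler_wpM2r// !ger0_norm ?(ltW s0) ?addr_ge0 ?(ltW e0)//.
        by rewrite lerDl ltW.
      by rewrite ltW.
    by rewrite -mulrA ler_wpM2l//; exact: HC2.
  - move=> s s0; have -> : w s = 2 * m * h1 s + 4 * s * h2 s.
      by rewrite -[4 * s * _]mulrA sh2// /w /h1 /plog /al2 /be2; field.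
    apply: cvgD.
      by apply: cvgMl_tmp; apply: cvg_shift_harmonic; exact: ch1.
    by apply: cvgMl_tmp; apply: cvg_shift_harmonic; exact: ch2.
have H1' : iint (fun x : 'rV[R]_d.+1 => w_ n (r2 x) * phi x) @[n --> \oo] -->
  iint (fun x => plog a al be (r2 x) * lap phi x).
  by rewrite -(funext E).
exact: cvg_unique H1' H2.
Qed.

Lemma le_iint d (b : R) (f g : 'rV[R]_d -> R) : d%:R / 2 + 4^-1 <= b ->
  decaying b f -> decaying b g -> (forall x, f x <= g x) -> iint f <= iint g.
Proof.
elim: d f g => [|d IH] f g db gf gg fg; first exact: fg.
have [db' _] := slice_exponent db; have b0 := exponent_ge0 db.
rewrite !iintS; apply: le_Rintegral => //.
- exact: integrable_iint_slice db gf.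
- exact: integrable_iint_slice db gg.
- by move=> t _; apply: IH => //; exact: decaying_slice.
Qed.

Lemma le_normr_iint d (b : R) (f g : 'rV[R]_d -> R) : d%:R / 2 + 4^-1 <= b ->
  decaying b f -> decaying b g -> (forall x, `|f x| <= g x) -> `|iint f| <= iint g.
Proof.
move=> db gf gg fg; rewrite ler_norml; apply/andP; split; last first.
  by apply: (le_iint db) => // x; exact: le_trans (ler_norm _) (fg x).
rewrite -mulN1r -(iintZ (-1) db gg); apply: (le_iint db) => //; first exact: decayingZ.
by move=> x; rewrite mulN1r; have := fg x; rewrite ler_norml => /andP[].
Qed.

Lemma decaying_jpow d (b b' e : R) : 0 < e -> e <= 1 -> 0 <= b' -> b' <= b ->
  decaying b' (fun x : 'rV[R]_d => (e + r2 x) `^ (- b)).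
Proof.
move=> e0 e1 b'0 b'b.
have p (x : 'rV[R]_d) : 0 < r2 x + e by exact: r2_shift_gt0.
split.
  rewrite (_ : (fun x => _) = fun x : 'rV[R]_d => (r2 x + e) `^ (- b)); last first.
    by apply/funext => x; rewrite addrC.
  apply: (@continuous_r2_shift d e (fun s => s `^ (- b))) => // s s0.
  apply/differentiable_continuous/derivable1_diffP.
  by have [] := is_derive1_powR (- b) s0.
exists (e `^ (- b)) => x; rewrite ger0_norm ?powR_ge0//.
have x1 : 1 <= 1 + r2 x by rewrite lerDl r2_ge0.
apply: (@le_trans _ _ ((e * (1 + r2 x)) `^ (- b))).
  apply: lerN_powR; [by rewrite mulr_gt0// (lt_le_trans ltr01)| |exact: le_trans b'b].
  by rewrite mulrDr mulr1 lerD2l ler_piMl// r2_ge0.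
rewrite powRM ?(ltW e0) ?(le_trans ler01 x1)//; apply: ler_wpM2l; first exact: powR_ge0.
by apply: ler_powR => //; rewrite lerN2.
Qed.

(* This integral is the volume of the unit ball of R^d. *)
Definition ball_vol d : R := brint d (d%:R / 2 + 1).

(** By scaling, the kernel has mass [ball_vol d] for every e = 1/(n+1). Instead of splitting the
    integral into near and far parts, one uses the global bound |phi x - phi 0| <= eta + C sqrt(e +
    r2 x): the square root lowers the power to d/2 + 1/2, and that integral is a multiple of sqrt
    e. *)
Lemma approx_identity d (K : R) (phi : 'rV[R]_d -> R) : continuous phi -> csupp K phi ->
  iint (fun x => n.+1%:R^-1 * (n.+1%:R^-1 + r2 x) `^ (- (d%:R / 2 + 1)) * phi x)
    @[n --> \oo] --> ball_vol d * phi 0.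
Proof.
move=> cp sp; set b : R := d%:R / 2 + 1; set b' : R := d%:R / 2 + 2^-1.
have [B B0 pB] := csupp_bounded cp sp.
have b'0 : 0 <= b' by rewrite addr_ge0 ?divr_ge0.
have b'b : b' <= b by rewrite /b /b'; lra.
have db' : d%:R / 2 + 4^-1 <= b' by rewrite /b'; lra.
have db : d%:R / 2 + 4^-1 <= b by rewrite /b; lra.
have V0 : 0 <= ball_vol d by exact: brint_ge0.
pose e n : R := n.+1%:R^-1.
have e0 n : 0 < e n by exact: invS_gt0.
have e1 n : e n <= 1 by exact: invS_le1.
have gb n : decaying b' (fun x : 'rV[R]_d => (e n + r2 x) `^ (- b)) by exact: decaying_jpow.
have gb' n : decaying b' (fun x : 'rV[R]_d => (e n + r2 x) `^ (- b')) by exact: decaying_jpow.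
have Ib n : iint (fun x : 'rV[R]_d => e n * (e n + r2 x) `^ (- b)) = ball_vol d.
  rewrite (iintZ _ db' (gb n)) iint_jpow// /ball_vol -/b.
  rewrite (_ : d%:R / 2 - b = -1); last by rewrite /b; ring.
  by rewrite powR_inv1 ?(ltW (e0 n))// mulrCA divff ?mulr1// gt_eqF.
have Ib' n : iint (fun x : 'rV[R]_d => e n * (e n + r2 x) `^ (- b')) =
    brint d b' * Num.sqrt (e n).
  rewrite (iintZ _ db' (gb' n)) iint_jpow//.
  rewrite (_ : d%:R / 2 - b' = - 2^-1); last by rewrite /b'; ring.
  rewrite mulrCA; congr (_ * _); rewrite -powR12_sqrt ?(ltW (e0 n))//.
  rewrite -[X in X * _](powRr1 (ltW (e0 n))) -powRD; last by rewrite (gt_eqF (e0 n)) implybT.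
  by congr (_ `^ _); field.
have key (eta : R) : 0 < eta -> exists2 C, 0 <= C & forall n,
    `|ball_vol d * phi 0 - iint (fun x => e n * (e n + r2 x) `^ (- b) * phi x)|
      <= eta * ball_vol d + C * Num.sqrt (e n).
  move=> eta0.
  have [dl dl0 Hdl] : exists2 dl, 0 < dl & forall x, r2 x < dl -> `|phi x - phi 0| <= eta.
    have /cvgrPdist_le /(_ eta eta0) /nbhs_normP[dl dl0 H] := cp 0.
    exists (dl ^+ 2); first by rewrite exprn_gt0.
    move=> x xd; rewrite distrC; apply: H; rewrite /ball_ /= sub0r normrN.
    have -> : `|x| = \big[Num.max/0]_ij `|x ij.1 ij.2| by exact: mx_normrE.
    apply: bigmax_lt => // -[i j] _ /=; rewrite (ord1 i).
    rewrite -ltr_sqr ?nnegrE ?(ltW dl0)// real_normK ?num_real//.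
    exact: le_lt_trans (sqr_le_r2 x j) xd.
  (* For r2 x >= dl this makes C sqrt(e + r2 x) at least 2 B, a bound for |phi x - phi 0|. *)
  pose C := 2 * B / Num.sqrt dl.
  have C0 : 0 <= C by rewrite divr_ge0 ?mulr_ge0 ?sqrtr_ge0.
  exists (C * brint d b'); first by rewrite mulr_ge0 ?brint_ge0.
  move=> n.
  have bd x : `|phi x - phi 0| <= eta + C * Num.sqrt (e n + r2 x).
    have [xd|xd] := ltP (r2 x) dl.
      by rewrite (le_trans (Hdl x xd))// lerDl mulr_ge0 ?sqrtr_ge0.
    apply: (@le_trans _ _ (2 * B)).
      apply: le_trans (ler_normB _ _) _; have := pB x; have := pB 0; lra.
    rewrite -[leLHS]add0r; apply: lerD; first exact: ltW.
    rewrite /C -mulrA ler_peMr ?mulr_ge0// mulrC ler_pdivlMr ?sqrtr_gt0// mul1r.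
    rewrite ler_sqrt; first by rewrite (le_trans xd)// lerDr ltW.
    by rewrite addr_ge0 ?r2_ge0 ?(ltW (e0 n)).
  have gphi : decaying b' (fun x => e n * (e n + r2 x) `^ (- b) * phi x).
    apply: (@csupp_decaying _ _ b' K) => //; last exact: csuppM.
    apply: (@continuous_mulfun R 'rV[R]_d) => //.
    apply: (@continuous_mulfun R 'rV[R]_d); first exact: cst_continuous.
    by case: (gb n).
  have g1 := decayingZ (e n) (gb n).
  have g2 := decayingZ (e n) (gb' n).
  have g3 := decayingZ (- phi 0) g1.
  have <- : iint (fun x : 'rV[R]_d => eta * (e n * (e n + r2 x) `^ (- b)) +
      C * (e n * (e n + r2 x) `^ (- b'))) = eta * ball_vol d + C * brint d b' * Num.sqrt (e n).
    by rewrite (iintD db' (decayingZ eta g1) (decayingZ C g2)) (iintZ _ db' g1) (iintZ _ db' g2)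
      Ib Ib' mulrA.
  rewrite distrC.
  have <- : iint (fun x : 'rV[R]_d => e n * (e n + r2 x) `^ (- b) * phi x +
      - phi 0 * (e n * (e n + r2 x) `^ (- b))) =
      iint (fun x => e n * (e n + r2 x) `^ (- b) * phi x) - ball_vol d * phi 0.
    by rewrite (iintD db' gphi g3) (iintZ _ db' g1) Ib mulNr mulrC.
  apply: (le_normr_iint db').
  - exact: decayingD.
  - by apply: decayingD; exact: decayingZ.
  move=> x; have p : 0 < e n + r2 x by rewrite ltr_pwDl// r2_ge0.
  have E2 : (e n + r2 x) `^ (- b') = (e n + r2 x) `^ (- b) * Num.sqrt (e n + r2 x).
    rewrite -powR12_sqrt ?(ltW p)// -powRD; last by rewrite (gt_eqF p) implybT.
    by congr (_ `^ _); rewrite /b /b'; field.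
  rewrite E2; set P := (e n + r2 x) `^ (- b); set S := Num.sqrt _.
  have P0 : 0 <= e n * P by rewrite mulr_ge0 ?powR_ge0 ?ltW.
  rewrite (_ : _ + _ = e n * P * (phi x - phi 0)); last by ring.
  rewrite (_ : _ + _ = e n * P * (eta + C * S)); last by ring.
  by rewrite normrM (ger0_norm P0); apply: ler_wpM2l.
apply/cvgrPdist_lt => del del0.
have V1 : 0 < 2 * (ball_vol d + 1) by rewrite mulr_gt0// ltr_wpDl.
have [C C0 HC] := key (del / (2 * (ball_vol d + 1))) (divr_gt0 del0 V1).
have hs : C * Num.sqrt (e n) @[n --> \oo] --> C * Num.sqrt 0.
  apply: cvgMl_tmp; apply: (@cvg_comp _ _ _ e (fun s => Num.sqrt s) _ (nbhs (0 : R))).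
    exact: cvg_harmonic.
  exact: sqrt_continuous.
rewrite sqrtr0 mulr0 in hs.
have d2 : 0 < del / 2 by rewrite divr_gt0.
have /cvgrPdist_lt/(_ _ d2) := hs.
apply: filterS => n; rewrite sub0r normrN ger0_norm ?mulr_ge0 ?sqrtr_ge0// => h.
apply: le_lt_trans (HC n) _.
have : del / (2 * (ball_vol d + 1)) * ball_vol d <= del / 2.
  rewrite mulrAC ler_pdivrMr// (_ : _ / 2 * _ = del * (ball_vol d + 1)); last by field.
  by rewrite ler_pM2l// lerDl.
lra.
Qed.

End RadialLimits.

(** * The delta at the critical exponent and the volumes of unit balls *)

Section Constants.
Variable R : realType.

(* At the critical exponent 1 - m/2 the Laplacian of the regularised kernel
   (r2 x + e)^(1 - m/2) is a multiple of e * (e + r2 x)^(- (m/2 + 1)), an approximate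
   identity of mass ball_vol. *)
Lemma lap_plog_critical d (al be : R) (phi : 'rV[R]_d.+1 -> R) :
  (1 - d.+1%:R / 2) * al = 0 -> test_fun phi ->
  iint (fun x => plog (1 - d.+1%:R / 2) al be (r2 x) * lap phi x) =
  2 * d.+1%:R * ball_vol R d.+1 * ((1 - d.+1%:R / 2) * be + al) * phi 0.
Proof.
set m : R := d.+1%:R; set a := 1 - m / 2 => aal tp; set kap := a * be + al.
have tl := test_fun_lap tp.
have [K sp] := test_fun_csupp tp; have [K' sl] := test_fun_csupp tl.
have cp := test_fun_continuous tp; have cl := test_fun_continuous tl.
pose h1 := plog (a - 1) (a * al) (a * be + al).
pose h2 := plog (a - 1 - 1) ((a - 1) * (a * al)) ((a - 1) * kap + a * al).
have H1 := @plog_reg_cvg R d a al be K' (lap phi) (lexx _) cl sl.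
have E n := @green_radial R d.+1 (plog a al be) h1 h2 _ phi (invS_gt0 R n) tp
  (fun s s0 => is_derive_plog a al be s0) (fun s s0 => is_derive_plog _ _ _ s0)
  (fun s s0 => @continuous_plog _ _ _ _ s s0).
have cA := approx_identity cp sp.
pose F n := iint (fun x => n.+1%:R^-1 * (n.+1%:R^-1 + r2 x) `^ (- (m / 2 + 1)) * phi x).
have E2 n : iint (fun x => plog a al be (r2 x + n.+1%:R^-1) * lap phi x) = 2 * m * kap * F n.
  rewrite E; set b' : R := m / 2 + 4^-1.
  have gF : decaying b' (fun x => n.+1%:R^-1 * (n.+1%:R^-1 + r2 x) `^ (- (m / 2 + 1)) * phi x).
    apply: (@csupp_decaying _ _ b' K) => //; last exact: csuppM.
      by rewrite addr_ge0 ?divr_ge0 ?ler0n.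
    apply: (@continuous_mulfun R 'rV[R]_d.+1) => //.
    apply: (@continuous_mulfun R 'rV[R]_d.+1); first exact: cst_continuous.
    have m0 : 0 <= m / 2 + 1 by rewrite addr_ge0 ?divr_ge0 ?ler0n.
    by case: (@decaying_jpow R d.+1 (m / 2 + 1) 0 n.+1%:R^-1
      (invS_gt0 R n) (invS_le1 R n) (lexx 0) m0).
  rewrite -(iintZ _ (lexx b') gF); apply: eq_iint => x.
  (* [aal] removes the logarithms from [h1] and [h2]. Put e = 1/(n+1) and r2 x = S - e: as 4 (a - 1)
     = -2 m, the terms in S cancel and 2 m kap e S^(a - 2) remains, where a - 2 = -(m/2 + 1). *)
  rewrite [RHS]mulrA; congr (_ * _); rewrite /h1 /h2 aal mulr0 addr0.
  have s0 := r2_shift_gt0 x (invS_gt0 R n).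
  rewrite /plog !(mul0r, add0r) [n.+1%:R^-1 + _]addrC.
  set S := r2 x + n.+1%:R^-1 in s0 *.
  have -> : r2 x = S - n.+1%:R^-1 by rewrite /S; ring.
  clearbody S.
  have -> : a - 1 = - (m / 2 + 1) + 1 by rewrite /a; ring.
  rewrite [- (m / 2 + 1) + 1 - 1]addrK powRD; last by rewrite (gt_eqF s0) implybT.
  rewrite powRr1 ?(ltW s0)//.
  rewrite -/m -/kap; field.
  by rewrite gt_eqF// ltr_pwDl.
have H2 : iint (fun x => plog a al be (r2 x + n.+1%:R^-1) * lap phi x) @[n --> \oo] -->
   2 * m * kap * (ball_vol R d.+1 * phi 0).
  by rewrite (funext E2); apply: cvgMl_tmp.
rewrite (cvg_unique _ H1 H2)//; ring.
Qed.

(** With u = tan t this is the Wallis integral of cos^(k+1) over ]-pi/2, pi/2[. *)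
Definition wallis k : R := jint (k%:R / 2 + 3 / 2).

Lemma ball_volE d : ball_vol R d = \prod_(i < d) wallis i.
Proof.
have H b : brint d b = \prod_(i < d) jint (b - i%:R / 2) :> R.
  by elim: d => [|d IH]; rewrite /= ?big_ord0// big_ord_recr /= IH.
rewrite /ball_vol H (reindex_inj rev_ord_inj) /=; apply: eq_bigr => i _.
rewrite /wallis; congr (jint _).
have : (d - i.+1)%:R = d%:R - i%:R - 1 :> R.
  by rewrite natrB ?ltn_ord// -natr1; ring.
by move=> ->; field.
Qed.

Lemma wallis_rec k : wallis k.+2 = wallis k * (k%:R + 2) / (k%:R + 3).
Proof.
rewrite /wallis (_ : k.+2%:R / 2 + 3 / 2 = k%:R / 2 + 3 / 2 + 1); last first.
  by rewrite -addn2 natrD; field.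
have k0 : 0 <= k%:R :> R by [].
rewrite jint_rec; last by lra.
by field; lra.
Qed.

(** Consecutive products telescope by [wallis_rec], starting from [jint32] and [jint2]. This gives
    the classical recursion of ball volumes in steps of two dimensions. *)
Lemma wallisM k : wallis k * wallis k.+1 = 2 * pi / (k%:R + 2).
Proof.
elim: k => [|k IH].
  rewrite /wallis mul0r add0r jint32 (_ : 1 / 2 + 3 / 2 = 2); last by field.
  by rewrite jint2 add0r; field.
have k0 : 0 <= k%:R :> R by [].
rewrite wallis_rec (_ : _ * _ = (wallis k * wallis k.+1) * ((k%:R + 2) / (k%:R + 3))); last by ring.
by rewrite IH -natr1; field; lra.
Qed.

Lemma ball_vol_rec d : ball_vol R d.+2 = ball_vol R d * (pi / (d%:R / 2 + 1)).
Proof.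
rewrite !ball_volE !big_ord_recr /= -mulrA wallisM; congr (_ * _).
have k0 : 0 <= d%:R :> R by [].
by field; lra.
Qed.

Lemma ball_vol0 : ball_vol R 0 = 1. Proof. by []. Qed.

Lemma ball_vol1 : ball_vol R 1 = 2.
Proof. by rewrite ball_volE big_ord1 /wallis mul0r add0r jint32. Qed.

Lemma ball_vol_gt0 d : 0 < ball_vol R d.
Proof.
suff : 0 < ball_vol R d /\ 0 < ball_vol R d.+1 by case.
elim: d => [|d [h1 h2]]; first by rewrite ball_vol0 ball_vol1.
split => //; rewrite ball_vol_rec mulr_gt0// divr_gt0 ?pi_gt0//.
Qed.

End Constants.

(** * The Euler integral at positive half-integers *)

Section GammaHalf.
Variable R : realType.
Local Notation mu := (@lebesgue_measure R).

Lemma exprn_le_fact_expR (v : R) k : 0 <= v -> v ^+ k <= (k`!)%:R * expR v.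
Proof.
move=> v0; case: k => [|k].
  by rewrite expr0 fact0 mul1r; have := expR_ge1Dx v; lra.
have := expR_ge1Dxn k v0; set f : R := (k.+1)`!%:R => h.
have f0 : 0 < f by rewrite ltr0n fact_gt0.
by rewrite mulrC -ler_pdivrMr//; lra.
Qed.

Definition gmom i (u : R) : R := u ^+ i.*2 * gauss_fun u.

Lemma gmom_ge0 i u : 0 <= gmom i u.
Proof. by rewrite mulr_ge0 ?gauss_fun_ge0// exprn_even_ge0// odd_double. Qed.

Lemma continuous_gmom i : continuous (gmom i).
Proof.
apply: (@continuous_mulfun R R); last exact: continuous_gauss_fun.
by move=> x; exact: exprn_continuous.
Qed.

Lemma gmom_bound i : exists2 C : R, 0 <= C & forall u, gmom i u <= C * (1 + u ^+ 2) `^ (- 1).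
Proof.
exists (i`!%:R + (i.+1)`!%:R); first by rewrite addr_ge0.
move=> u; have q := sqrD_gt0 u (@ltr01 R).
rewrite powR_inv1 ?(ltW q)// ler_pdivlMr// /gmom /gauss_fun expRN.
rewrite mulrAC ler_pdivrMr ?expR_gt0// -mul2n exprM mulrDr mulr1 -exprSr.
have v0 := sqr_ge0 u.
have h1 := exprn_le_fact_expR i v0; have h2 := exprn_le_fact_expR i.+1 v0.
by rewrite mulrDl; exact: lerD.
Qed.

Lemma integrable_gmom i : mu.-integrable setT (EFin \o gmom i).
Proof.
have [C C0 HC] := gmom_bound i.
have h1 : (3/4 : R) <= 1 by lra.
have := integrableZl (mu := mu) measurableT C (integrable_jpow1 h1).
apply: le_integrable => //.
  by apply/measurable_EFinP; apply: continuous_measurable_fun; exact: continuous_gmom.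
move=> x _ /=; rewrite lee_fin ger0_norm ?gmom_ge0// (le_trans (HC x))//.
exact: ler_norm.
Qed.

Lemma is_derive_gauss (x : R) : is_derive (x : R) (1 : R) gauss_fun (- 2 * x * gauss_fun x).
Proof.
have d1 := is_derive_cmulR (-1) (is_derive_mulR (is_derive_idR x) (is_derive_idR x)).
have d2 := @is_derive1_comp R expR (fun u : R => -1 * (u * u)) x _ _ (is_derive_expR _) d1.
rewrite (_ : gauss_fun = expR \o (fun u : R => -1 * (u * u))).
  by apply: is_derive_eq d2 _; rewrite /=; ring.
by apply/funext => u; rewrite /gauss_fun /= mulN1r expr2.
Qed.

Lemma is_derive_expn n (x : R) :
  is_derive (x : R) (1 : R) (fun u => u ^+ n.+1) (n.+1%:R * x ^+ n).
Proof.
elim: n => [|n IH].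
  by apply: is_derive_eq (is_derive_idR x) _; rewrite expr0 mulr1.
rewrite (_ : (fun u => _) = (fun u : R => u * u ^+ n.+1)); last first.
  by apply/funext => u; rewrite exprS.
apply: is_derive_eq (is_derive_mulR (is_derive_idR x) IH) _.
by rewrite -[in RHS]natr1 [x ^+ n.+1]exprS; ring.
Qed.

(** The odd function u^(2i+1) exp(-u^2) vanishes at infinity, so its derivative has integral 0. *)
Lemma Rintegral_gmom_rec i :
  \int[mu]_u gmom i.+1 u = (i%:R + 2^-1) * \int[mu]_u gmom i u.
Proof.
have I0 := integrable_gmom i; have I1 := integrable_gmom i.+1.
have c0 := @continuous_gmom i; have c1 := @continuous_gmom i.+1.
have I0' := integrableZl (mu := mu) measurableT (i.*2.+1%:R) I0.
have I1' := integrableZl (mu := mu) measurableT (-2) I1.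
pose f (u : R) := i.*2.+1%:R * gmom i u + (-2) * gmom i.+1 u.
have : \int[mu]_u f u = 0 *+ 2.
  apply: (@RintegralT_FTC_odd R f (fun u : R => u ^+ i.*2.+1 * gauss_fun u)).
  - apply: (@continuous_addfun R R R^o); apply: (@continuous_mulfun R R) => //;
      exact: cst_continuous.
  - exact: (integrableD measurableT I0' I1').
  - move=> x; apply: is_derive_eq (is_derive_mulR (is_derive_expn _ x) (is_derive_gauss x)) _.
    rewrite /f /gmom doubleS !exprS; ring.
  - by move=> x; rewrite exprNn -signr_odd /= odd_double /= expr1 mulN1r /gauss_fun sqrrN mulNr.
  - have [C C0 HC] := gmom_bound i.
    have h : C * (u * (1 + u ^+ 2) `^ (- 1)) @[u --> +oo] --> C * 0.
      by apply: cvgMl_tmp; exact: cvgy_jpow.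
    rewrite mulr0 in h.
    apply: (@squeeze_cvgr _ _ _ _ (cst 0) (fun u => C * (u * (1 + u ^+ 2) `^ (- 1)))).
    + near=> u; have u0 : 0 <= u by near: u; apply: nbhs_pinfty_ge; rewrite num_real.
      rewrite exprS -mulrA -/(gmom i u) /= mulr_ge0 ?gmom_ge0//=.
      by rewrite [leRHS]mulrCA; exact: (ler_wpM2l u0 (HC u)).
    + exact: cvg_cst.
    + exact: h.
rewrite /f RintegralD// RintegralZl// RintegralZl// mul0rn => /eqP.
rewrite addr_eq0 mulNr opprK -addn1 natrD -mul2n natrM => /eqP h.
have : 2 * ((i%:R + 2^-1) * \int[mu]_u gmom i u) = 2 * \int[mu]_u gmom i.+1 u.
  by rewrite -h; field.
by move=> /mulfI -> //; rewrite pnatr_eq0.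
Unshelve. all: by end_near. Qed.

Lemma Rintegral_gmom i :
  \int[mu]_u gmom i u = Num.sqrt pi * \prod_(j < i) (j%:R + 2^-1).
Proof.
elim: i => [|i IH]; last by rewrite Rintegral_gmom_rec IH big_ord_recr /=; ring.
rewrite big_ord0 mulr1 (_ : gmom 0 = gauss_fun); last first.
  by apply/funext => x; rewrite /gmom expr0 mul1r.
by rewrite /Rintegral integralT_gauss.
Qed.

(** The exponent k is a parameter so that t = u^2 maps the segments of the exhaustion for k = 0 onto
    those for k = 1. *)
Lemma integral_pos_cover k (f : R -> R) : measurable_fun setT f ->
  (forall x, 0 <= f x) ->
  (\int[mu]_(x in `[(n.+1%:R^-1 ^+ k.+1)%R, (n.+1%:R ^+ k.+1)%R]) (f x)%:E)%E @[n --> \oo] -->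
  (\int[mu]_(x in `]0%R, +oo[) (f x)%:E)%E.
Proof.
move=> mf f0.
pose A n : set R := `[(n.+1%:R^-1 ^+ k.+1)%R, (n.+1%:R ^+ k.+1)%R]%classic.
have AU : \bigcup_n A n = `]0%R, +oo[%classic.
  apply/seteqP; split => [x [n _]|x] /=; rewrite /A/= !in_itv/= ?andbT.
    by move=> /andP[h _]; apply: lt_le_trans h; rewrite exprn_gt0// invr_gt0.
  move=> x0; pose M := Num.max x x^-1.
  have xM : x <= M by rewrite le_max lexx.
  have iM : x^-1 <= M by rewrite le_max lexx orbT.
  have [n hn] : exists n : nat, M <= n.+1%:R.
    by exists (Num.truncn M); apply: ltW; exact: truncnS_gt.
  exists n => //; rewrite /A/= in_itv/=.
  have n1 : 1 <= n.+1%:R :> R by rewrite ler1n.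
  have nk : n.+1%:R <= n.+1%:R ^+ k.+1 :> R by rewrite exprS ler_peMr// exprn_ege1.
  apply/andP; split; last by apply: le_trans nk; exact: le_trans hn.
  rewrite exprVn invf_ple ?posrE ?exprn_gt0//.
  by apply: le_trans nk; exact: le_trans hn.
rewrite -AU; apply: ge0_nondecreasing_set_cvg_integral => //.
- move=> n p np; apply/subsetPset => x; rewrite /A/= !in_itv/= => /andP[h1 h2].
  have np' : n.+1%:R <= p.+1%:R :> R by rewrite ler_nat.
  apply/andP; split.
    apply: le_trans h1; apply: lerXn2r; rewrite ?nnegrE ?invr_ge0//.
    by rewrite lef_pV2 ?posrE.
  by apply: le_trans h2 _; apply: lerXn2r; rewrite ?nnegrE ?ler0n.
- by move=> n; apply/measurable_EFinP/measurable_funTS.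
- by move=> n x _; rewrite lee_fin.
Qed.

(** The substitution t = u^2, made on each segment of the exhaustion, turns the Euler integral into
    twice a Gaussian moment over u > 0, that is, by evenness, the moment over the line. *)
Lemma Gamma_pos_half i :
  Gamma_pos (i%:R + 2^-1) = Num.sqrt pi * \prod_(j < i) (j%:R + 2^-1) :> R.
Proof.
rewrite -Rintegral_gmom /Gamma_pos /Rintegral; congr fine.
pose z : R := i%:R + 2^-1 - 1.
pose G (t : R) := t `^ z * expR (- t).
have G0 t : 0 <= G t by rewrite mulr_ge0 ?powR_ge0 ?expR_ge0.
have mG : measurable_fun setT G.
  apply: measurable_funM; first exact: measurable_powR.
  by apply: measurableT_comp => //; exact: measurableT_comp.
have H1 := @integral_pos_cover 1 G mG G0.
have mg : measurable_fun setT (fun u : R => 2 * gmom i u).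
  apply: continuous_measurable_fun; apply: (@continuous_mulfun R R).
    exact: cst_continuous.
  exact: continuous_gmom.
have g0 u : 0 <= 2 * gmom i u by rewrite mulr_ge0 ?gmom_ge0.
have H2 := @integral_pos_cover 0 _ mg g0.
have E n : (\int[mu]_(x in `[(n.+1%:R^-1 ^+ 2)%R, (n.+1%:R ^+ 2)%R]) (G x)%:E =
  \int[mu]_(x in `[(n.+1%:R^-1 ^+ 1)%R, (n.+1%:R ^+ 1)%R]) (2 * gmom i x)%:E)%E.
  have a0 : 0 < n.+1%:R^-1 :> R by exact: invS_gt0.
  have ab : n.+1%:R^-1 <= n.+1%:R :> R.
    by apply: le_trans (invS_le1 R n) _; rewrite ler1n.
  pose F (u : R) := u ^+ 2.
  have dF (x : R) : is_derive (x : R) (1 : R) F (2 * x).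
    by apply: is_derive_eq (is_derive_expn 1 x) _; rewrite expr1.
  have d1 : derive1 F = (fun x => 2 * x).
    by apply/funext => x; rewrite derive1E; have [_ ->] := dF x.
  have c2 : continuous (fun x : R => 2 * x).
    apply: (@continuous_mulfun R R); first exact: cst_continuous.
    by move=> x; exact: cvg_id.
  have cF : continuous F by exact: is_derive_continuous dF.
  rewrite !expr1 (@integration_by_substitution_increasing R F G)//.
  - apply: eq_integral => x; rewrite inE/= in_itv/= => /andP[x1 _]; congr EFin.
    have x0 : 0 < x by exact: lt_le_trans x1.
    have -> : ((G \o F) * derive1 F) x = G (x ^+ 2) * (2 * x) by rewrite d1.
    rewrite /G /gmom /gauss_fun.
    have -> : (x ^+ 2) `^ z = x ^+ i.*2 / x.
      rewrite -powR_mulrn ?(ltW x0)// -powRrM.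
      rewrite (_ : 2%:R * z = i.*2%:R - 1); last by rewrite /z -mul2n natrM; field.
      by rewrite powRB1// powR_mulrn// ltW.
    by field; rewrite gt_eqF.
  - move=> x y; rewrite !in_itv/= => /andP[x0 _] /andP[y0 _] xy.
    by rewrite /F ltr_pXn2r ?nnegrE ?(le_trans (ltW a0)).
  - by move=> x _; rewrite d1; exact: c2.
  - by rewrite d1; apply: cvgP; apply: cvg_at_right_filter; exact: c2.
  - by rewrite d1; apply: cvgP; apply: cvg_at_left_filter; exact: c2.
  - split; first by move=> x _; have [] := dF x.
      by apply: cvg_at_right_filter; exact: cF.
    by apply: cvg_at_left_filter; exact: cF.
  - apply: continuous_in_subspaceT => x; rewrite inE/= in_itv/= => /andP[x1 _].
    have x0 : 0 < x by apply: lt_le_trans x1; rewrite exprn_gt0.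
    apply: (@cvgM _ _ _ _ (fun t : R => t `^ z) (fun t : R => expR (- t))).
      suff : {for x, continuous (fun t : R => t `^ z)} by [].
      apply/differentiable_continuous/derivable1_diffP.
      by have [] := is_derive1_powR z x0.
    suff : {for x, continuous (fun t : R => expR (- t))} by [].
    apply: (@continuous_comp _ _ _ -%R expR); first exact: opp_continuous.
    exact: continuous_expR.
have H3 := H1; rewrite (funext E) in H3.
have -> : (\int[mu]_(x in `]0%R, +oo[) (G x)%:E =
  \int[mu]_(x in `]0%R, +oo[) (2 * gmom i x)%:E)%E by exact: (cvg_unique _ H3 H2).
rewrite [RHS]ge0_symfun_integralT//.
- rewrite (_ : [set x : R | 0 <= x] = `[0, +oo[%classic); last first.
    by apply/seteqP; split => x/=; rewrite in_itv/= andbT.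
  rewrite -integral_itv_obnd_cbnd; last first.
    apply/measurable_EFinP/measurable_funTS; apply: continuous_measurable_fun.
    exact: continuous_gmom.
  under eq_integral do rewrite EFinM.
  rewrite ge0_integralZl_EFin//.
  + by move=> x _; rewrite lee_fin gmom_ge0.
  + apply/measurable_EFinP/measurable_funTS; apply: continuous_measurable_fun.
    exact: continuous_gmom.
- exact: gmom_ge0.
- exact: continuous_gmom.
- by move=> x; rewrite /gmom /gauss_fun /= sqrrN exprNn -signr_odd odd_double expr0 mul1r.
Qed.

End GammaHalf.

Local Close Scope classical_set_scope.

(** * Subsets of the generators that are unions of pairs *)

Section Pairing.
Variable n : nat.
Implicit Types (A C : {set 'I_(n.*2)}) (i : 'I_(n.*2)) (j : 'I_n).

Lemma half_idx_proof i : ((val i)./2 < n)%N.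
Proof. by rewrite ltn_half_double ltn_ord. Qed.

Definition half_idx i : 'I_n := Ordinal (half_idx_proof i).

Definition pair_set j : {set 'I_(n.*2)} := [set fo j; fe j].

Definition paired A : bool := [forall j, (fo j \in A) == (fe j \in A)].

(** Pairs are counted by their first generators; for a [paired] set this is the number of pairs in
    it. *)
Definition npairs A : nat := #|[set j | fo j \in A]|.

Lemma fo_inj : injective (@fo n).
Proof. by move=> j k /(congr1 val)/= /double_inj h; apply: val_inj. Qed.

Lemma fe_inj : injective (@fe n).
Proof. by move=> j k /(congr1 val)/= [/double_inj h]; apply: val_inj. Qed.

Lemma fo_neq_fe j k : (fo j == fe k) = false.
Proof.
apply/eqP => /(congr1 (fun i : 'I_(n.*2) => odd (val i))) /=.
by rewrite !odd_double.
Qed.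

Lemma fo_fe_cases i : exists j, i = fo j \/ i = fe j.
Proof.
exists (half_idx i); have := odd_double_half (val i).
case E : (odd (val i)) => /= h; [right|left]; apply: val_inj => /=; rewrite -[LHS]h.
  by rewrite add1n.
by rewrite add0n.
Qed.

Lemma fo_lt_fe j : (fo j < fe j)%N. Proof. exact: ltnSn. Qed.

Lemma in_pair_fo j k : (fo k \in pair_set j) = (k == j).
Proof. by rewrite !inE fo_neq_fe orbF (inj_eq fo_inj). Qed.

Lemma in_pair_fe j k : (fe k \in pair_set j) = (k == j).
Proof. by rewrite !inE eq_sym fo_neq_fe (inj_eq fe_inj). Qed.

Lemma pair_subset j A : (pair_set j \subset A) = (fo j \in A) && (fe j \in A).
Proof. by rewrite finset.subUset !finset.sub1set. Qed.

(** The two indices of a pair are consecutive. *)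
Lemma lt_pair j i : i \notin pair_set j -> (i < fe j)%N = (i < fo j)%N.
Proof.
rewrite !inE negb_or => /andP[h _]; rewrite /= ltnS leq_eqVlt.
have hn : (i : nat) != j.*2 by apply: contraNneq h => E; apply/eqP; apply: val_inj.
by rewrite (negbTE hn).
Qed.

Lemma paired_setD j A : pair_set j \subset A -> paired (A :\: pair_set j) = paired A.
Proof.
rewrite pair_subset => /andP[h1 h2]; apply: eq_forallb => k.
rewrite !finset.in_setD in_pair_fo in_pair_fe; case: (eqVneq k j) => //= ->.
by rewrite h1 h2.
Qed.

Lemma npairs_setD j A : pair_set j \subset A ->
  npairs A = (npairs (A :\: pair_set j)).+1.
Proof.
rewrite pair_subset => /andP[h1 h2]; rewrite /npairs.
rewrite (cardsD1 j) finset.inE h1 add1n; congr _.+1; apply: eq_card => k.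
rewrite finset.in_setD1 [k \in [set _ | _]]finset.in_set [RHS]finset.in_set.
by rewrite finset.in_setD in_pair_fo.
Qed.

Lemma paired_setU j A : fo j \notin A -> fe j \notin A ->
  paired (fe j |: (fo j |: A)) = paired A.
Proof.
move=> h1 h2; apply: eq_forallb => k; rewrite !finset.in_setU !finset.in_set1.
rewrite fo_neq_fe (inj_eq fo_inj) (inj_eq fe_inj) [fe k == _]eq_sym fo_neq_fe /=.
by case: (eqVneq k j) => //= ->; rewrite (negbTE h1) (negbTE h2).
Qed.

Lemma npairs_setU j A : fo j \notin A ->
  npairs (fe j |: (fo j |: A)) = (npairs A).+1.
Proof.
move=> h1; rewrite /npairs (cardsD1 j) !finset.inE eqxx orbT /= add1n.
congr _.+1; apply: eq_card => k; rewrite !finset.inE.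
rewrite fo_neq_fe (inj_eq fo_inj) /=.
by case: eqP => //= ->; rewrite (negbTE h1).
Qed.

Lemma card_unpaired A : paired A ->
  #|[set j | (fo j \notin A) && (fe j \notin A)]| = (n - npairs A)%N.
Proof.
move=> /forallP pA; have := cardsC [set j | fo j \in A].
rewrite card_ord -/(npairs A) => h; rewrite -[in RHS]h addKn; apply: eq_card => j.
by rewrite !finset.inE -(eqP (pA j)) andbb.
Qed.

Lemma npairs_le A : (npairs A <= n)%N.
Proof. by rewrite -[leqRHS]card_ord max_card. Qed.

End Pairing.

(** * Powers of the fermionic square *)

Section GrassmannSquare.
Variables (R : realType) (n : nat).
Implicit Types (A C : {set 'I_(n.*2)}) (j : 'I_n).

Lemma gmul_ggen (a b : 'I_(n.*2)) A : (a < b)%N ->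
  gmul (@ggen R _ a) (ggen R b) A = (A == [set a; b])%:R.
Proof.
move=> ab; have anb : a != b by apply: contraTneq ab => ->; rewrite ltnn.
rewrite /gmul /ggen; have [->|nA] := eqVneq A [set a; b].
  rewrite (bigD1 [set a]) /=; last by rewrite finset.sub1set finset.set21.
  have -> : [set a; b] :\: [set a] = [set b].
    by apply/setP => x; rewrite !inE; case: (eqVneq x a) => [->|] //=; rewrite (negbTE anb).
  rewrite !eqxx !mulr1 big1 ?addr0.
    rewrite /gsign (_ : #|_| = 0)%N ?expr0//; apply: eq_card0 => -[p q].
    rewrite !inE /=; apply/negP => /and3P[/eqP-> /eqP->].
    by rewrite ltnNge ltnW.
  by move=> B /andP[_ /negbTE->]; rewrite mulr0 mul0r.
rewrite big1// => B BA; case: (eqVneq B [set a]) => [Ba|_]; last by rewrite mulr0 mul0r.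
case: (eqVneq (A :\: B) [set b]) => [Eb|_]; last by rewrite mulr0.
by case/eqP: nA; rewrite -(finset.setID A B) (finset.setIidPr BA) Eb Ba.
Qed.

Lemma xsqE A : xsq R A = \sum_(j < n) (A == pair_set j)%:R.
Proof. by apply: eq_bigr => j _; rewrite gmul_ggen// fo_lt_fe. Qed.

(** An index of C is passed by both members of the pair or by neither, so the number of inversions
    is even. *)
Lemma gsign_pair j C : [disjoint pair_set j & C] -> @gsign R _ (pair_set j) C = 1.
Proof.
move=> dC; rewrite /gsign.
have -> : [set p : 'I_(n.*2) * 'I_(n.*2) | [&& p.1 \in pair_set j, p.2 \in C & (p.2 < p.1)%N]]
   = finset.setX (pair_set j) [set c in C | (c < fo j)%N].
  apply/setP => -[p q]; rewrite !finset.inE /=; case pj : (p \in pair_set j) => //=.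
    case qC : (q \in C) => //=; have qn : q \notin pair_set j.
      by apply: contraL dC => qj; rewrite -setI_eq0; apply/set0Pn; exists q; rewrite inE qj.
    move: pj; rewrite !inE => /orP[]/eqP->; rewrite ?eqxx ?orbT//=.
    by rewrite lt_pair.
  by move: pj; rewrite !inE => ->.
rewrite cardsX cards2 fo_neq_fe /= mulSn mul1n addnn -signr_odd odd_double.
by rewrite expr0.
Qed.

Lemma gmul_xsq (g : {set 'I_(n.*2)} -> R) A :
  gmul (xsq R (n := n)) g A = \sum_(j < n | pair_set j \subset A) g (A :\: pair_set j).
Proof.
rewrite /gmul; under eq_bigr do rewrite xsqE mulr_sumr mulr_suml.
rewrite exchange_big [RHS]big_mkcond /=; apply: eq_bigr => j _.
case: ifP => jA; last first.
  rewrite big1// => B BA; case: eqP => [Bj|_]; last by rewrite mulr0 mul0r.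
  by rewrite -Bj BA in jA.
rewrite (bigD1 (pair_set j)) //= eqxx mulr1 gsign_pair ?mul1r.
  rewrite big1 ?addr0// => B /andP[_ /negbTE->]; by rewrite mulr0 mul0r.
rewrite finset.disjoints_subset; apply/fintype.subsetP => x xj.
by rewrite finset.in_setC finset.in_setD xj.
Qed.

(** A product of k pairs arises once for each order in which its pairs are removed, hence k! times.
    This cancels the 1/k! in the definition of h(R^2). *)
Lemma gpow_xsq k A :
  gpow (xsq R (n := n)) k A = (paired A && (npairs A == k))%:R * (k`!)%:R.
Proof.
elim: k A => [|k IH] A.
  rewrite /gpow /= /gone fact0 mulr1; congr ((nat_of_bool _)%:R); apply/eqP/andP => [->|[pA cA]].
    split; first by apply/forallP => j; rewrite !finset.inE.
    by rewrite /npairs eq_card0// => j; rewrite !finset.inE.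
  move: cA; rewrite /npairs cards_eq0 => /eqP h; apply/setP => i; rewrite finset.inE.
  have hf j : (fo j \in A) = false.
    by have := congr1 (fun B : {set 'I_n} => j \in B) h; rewrite !finset.inE.
  have [j [->|->]] := fo_fe_cases i; first exact: hf.
  by have /forallP/(_ j)/eqP <- := pA.
rewrite /gpow iterS -/(gpow _ k) gmul_xsq.
rewrite (eq_bigr (fun=> (paired A && (npairs A == k.+1))%:R * (k`!)%:R)); last first.
  by move=> j jA; rewrite IH paired_setD// (npairs_setD jA).
rewrite sumr_const; case pA : (paired A) => //=; last by rewrite !mul0r mul0rn.
case: eqP => [cA|_]; last by rewrite !mul0r mul0rn.
rewrite !mul1r factS natrM mulr_natl; congr (_ *+ _).
rewrite -cA /npairs; apply: eq_card => j; rewrite finset.inE [LHS]unfold_in pair_subset.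
by move/forallP: pA => /(_ j)/eqP <-; rewrite andbb.
Qed.

End GrassmannSquare.

(** * The super Laplacian on coefficients *)

Section SuperLaplacian.
Variables (R : realType) (m n : nat).
Implicit Types (A : {set 'I_(n.*2)}) (T : superdist R m n).

(** The sign exponents of the two derivatives differ by exactly one, as [fo j] itself lies below
    [fe j]; the product of the signs is -1. *)
Lemma fder2 T j A phi : fder (fo j) (fder (fe j) T) A phi =
  if (fo j \notin A) && (fe j \notin A) then - T (fe j |: (fo j |: A)) phi else 0.
Proof.
rewrite /fder; case: ifP => //= h1.
rewrite finset.in_setU finset.in_set1 eq_sym fo_neq_fe /=.
case: ifP => //= h2; first by rewrite mulr0.
rewrite mulrA -exprD.
rewrite (_ : #|[set a in fo j |: A | (a < fe j)%N]| = #|[set a in A | (a < fo j)%N]|.+1).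
  by rewrite addnS addnn exprS -signr_odd odd_double expr0 mulr1 mulN1r.
rewrite (cardsD1 (fo j)) !finset.inE eqxx fo_lt_fe /= add1n; congr _.+1.
apply: eq_card => a; rewrite !finset.inE; case: (eqVneq a (fo j)) => [->|na] /=.
  by rewrite h1.
case aA : (a \in A) => //=; apply: lt_pair; rewrite !finset.inE negb_or na /=.
by apply: contraFneq h2 => <-.
Qed.

Lemma slapE T A phi : slap T A phi = T A (lap phi) +
  4 * \sum_(j < n | (fo j \notin A) && (fe j \notin A)) T (fe j |: (fo j |: A)) phi.
Proof.
rewrite /slap; under eq_bigr do rewrite fder2.
by rewrite -big_mkcond /= sumrN mulrN opprK.
Qed.

(* In h(R^2) only products of k full pairs occur, with the coefficient (-1)^k h^(k)(r^2)
   depending only on k; u k stands for the distribution h^(k)(r^2). *)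
Definition radial_dist (u : nat -> ('rV[R]_m -> R) -> R) : superdist R m n :=
  fun A phi => if paired A then (-1) ^+ npairs A * u (npairs A) phi else 0.

(** Each of the n - k pairs missing from A can be added, giving the same term with k + 1 pairs and
    the opposite sign. *)
Lemma slap_radial u A phi : slap (radial_dist u) A phi =
  radial_dist (fun k phi => u k (lap phi) - 4 * (n - k)%:R * u k.+1 phi) A phi.
Proof.
rewrite slapE /radial_dist; case: ifP => pA; last first.
  rewrite big1 ?mulr0 ?addr0// => j /andP[h1 h2].
  by rewrite paired_setU// pA.
rewrite (eq_bigr (fun=> (-1) ^+ (npairs A).+1 * u (npairs A).+1 phi)); last first.
  by move=> j /andP[h1 h2]; rewrite paired_setU// pA npairs_setU.
rewrite sumr_const -(card_unpaired pA) cardsE exprS -mulr_natr; ring.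
Qed.

(** Distributions are compared on test functions only. Iteration is compatible with this because the
    Laplacian preserves test functions. *)
Lemma iter_slap_eq l (T T' : superdist R m n) :
  (forall A phi, test_fun phi -> T A phi = T' A phi) ->
  forall A phi, test_fun phi -> iter l (@slap R m n) T A phi = iter l (@slap R m n) T' A phi.
Proof.
elim: l T T' => [//|l IH] T T' TT A phi tp; rewrite !iterSr; apply: IH => // B psi tpsi.
rewrite !slapE TT; last exact: test_fun_lap.
by congr (_ + _ * _); apply: eq_bigr => j _; exact: TT.
Qed.

Lemma superR2E (h : R -> R) A x :
  @superR2 R m n h A x = (if paired A then (-1) ^+ npairs A else 0) *
     iter (npairs A) (fun g : R -> R => derive1 g) h (r2 x).
Proof.
rewrite /superR2; case: ifP => pA; last first.
  rewrite mul0r big1// => j _; by rewrite gpow_xsq pA mul0r mulr0 mul0r.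
have kn : (npairs A < n.+1)%N by rewrite ltnS npairs_le.
rewrite (bigD1 (Ordinal kn)) //= big1 ?addr0.
  rewrite gpow_xsq pA eqxx mul1r divfK// pnatr_eq0 -lt0n; exact: fact_gt0.
move=> j jn; rewrite gpow_xsq pA /= (_ : (npairs A == j) = false) ?mul0r ?mulr0 ?mul0r//.
by apply: contraNF jn => /eqP E; apply/eqP; apply: val_inj.
Qed.

End SuperLaplacian.

Local Open Scope classical_set_scope.

(** * Pairing power-logarithm kernels with test functions *)

Section PowerLogPairing.
Variables (R : realType) (d : nat).
Local Notation m := (d.+1%:R : R).
Implicit Types (phi : 'rV[R]_d.+1 -> R).

Definition plog_pair (a al be : R) phi : R := iint (fun x => plog a al be (r2 x) * phi x).

(** The values at s = 0, where powers, logarithms and derivatives are mere conventions, must not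
    matter. Both integrals are limits of the same regularised integrals, hence equal. *)
Lemma plog_pair_ext (w : R -> R) (a al be : R) phi : 1 - m / 2 <= a -> test_fun phi ->
  (forall s, 0 < s -> w s = plog a al be s) ->
  iint (fun x => w (r2 x) * phi x) = plog_pair a al be phi.
Proof.
move=> ha tp ww; have cp := test_fun_continuous tp; have [K sp] := test_fun_csupp tp.
have H1 := @plog_reg_cvg R d a al be K phi ha cp sp.
rewrite -natr1 in ha.
have q0 : 0 <= d%:R / 2 + 4^-1 :> R by rewrite addr_ge0 ?divr_ge0.
have [|C C0 HC] := @plog_shift_bound R a al be _ K q0; first by lra.
have H2 : iint (fun x : 'rV[R]_d.+1 => plog a al be (r2 x + n.+1%:R^-1) * phi x) @[n --> \oo] -->
    iint (fun x : 'rV[R]_d.+1 => w (r2 x) * phi x).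
  apply: (@radial_cvg R d C K (fun n s => plog a al be (s + n.+1%:R^-1))) => //.
  - move=> n; apply: continuous_r2_shift; first exact: invS_gt0.
    by move=> s; exact: continuous_plog.
  - move=> s s0; have c := @continuous_plog R a al be s s0.
    rewrite /prop_for /continuous_at ww//; apply: cvg_trans c.
    by apply: near_eq_cvg; near=> t; rewrite ww//; near: t; exact: lt_nbhsr.
  - by move=> s s0; rewrite ww//; apply: cvg_shift_harmonic; exact: continuous_plog.
exact: cvg_unique H2 H1.
Unshelve. all: by end_near. Qed.

(** [iintD] and [iintZ] are for continuous decaying functions; the singular kernels inherit
    linearity in the limit of the regularisation. *)
Lemma plog_pair_lin (c a al be al' be' : R) phi : 1 - m / 2 <= a -> test_fun phi ->
  plog_pair a al be phi + c * plog_pair a al' be' phi =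
  plog_pair a (al + c * al') (be + c * be') phi.
Proof.
move=> ha tp; have cp := test_fun_continuous tp; have [K sp] := test_fun_csupp tp.
have H1 := @plog_reg_cvg R d a al be K phi ha cp sp.
have H2 := @plog_reg_cvg R d a al' be' K phi ha cp sp.
have H3 := @plog_reg_cvg R d a (al + c * al') (be + c * be') K phi ha cp sp.
set b : R := m / 2 + 4^-1.
have b0 : 0 <= b by rewrite addr_ge0 ?divr_ge0 ?ler0n.
have gd n u v : decaying b (fun x : 'rV[R]_d.+1 => plog a u v (r2 x + n.+1%:R^-1) * phi x).
  apply: (@csupp_decaying _ _ b K) => //; last exact: csuppM.
  apply: (@continuous_mulfun R 'rV[R]_d.+1) => //.
  apply: continuous_r2_shift; first exact: invS_gt0.
  by move=> s; exact: continuous_plog.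
have E n : iint (fun x : 'rV[R]_d.+1 =>
      plog a (al + c * al') (be + c * be') (r2 x + n.+1%:R^-1) * phi x) =
    iint (fun x => plog a al be (r2 x + n.+1%:R^-1) * phi x) +
    c * iint (fun x => plog a al' be' (r2 x + n.+1%:R^-1) * phi x).
  rewrite -(iintZ c (lexx b) (gd n _ _)) -(iintD (lexx b) (gd n _ _) (decayingZ c (gd n _ _))).
  by apply: eq_iint => x; rewrite /plog; ring.
rewrite (funext E) in H3.
symmetry; apply: (cvg_unique _ H3) => //.
by apply: cvgD; [exact: H1|apply: cvgMl_tmp; exact: H2].
Qed.

Lemma plog_pair0 a phi : plog_pair a 0 0 phi = 0.
Proof.
rewrite /plog_pair -[RHS](iint0 R d.+1); apply: eq_iint => x.
by rewrite /plog mul0r add0r mulr0 mul0r.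
Qed.

Lemma plog_pairZ (c a al be : R) phi : 1 - m / 2 <= a -> test_fun phi ->
  plog_pair a (c * al) (c * be) phi = c * plog_pair a al be phi.
Proof.
move=> ha tp; have := plog_pair_lin c 0 0 al be ha tp.
by rewrite plog_pair0 !add0r => ->.
Qed.

End PowerLogPairing.

(** * One super Laplacian on a radial power-logarithm superfunction *)

Section SuperRecursion.
Variable R : realType.

(* The k-th derivative of plog a c.1 c.2 is plog (a - k) applied to plog_der a c k. *)
Fixpoint plog_der (a : R) (c : R * R) (k : nat) : R * R :=
  if k is k'.+1 then
    let p := plog_der a c k' in ((a - k'%:R) * p.1, (a - k'%:R) * p.2 + p.1)
  else c.

Lemma derive1_near (f g : R -> R) (s : R) : 0 < s ->
  (forall t, 0 < t -> f t = g t) -> derive1 f s = derive1 g s.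
Proof.
move=> s0 fg; rewrite !derive1E; apply: near_eq_derive.
by near=> t; apply: fg; near: t; exact: lt_nbhsr.
Unshelve. all: by end_near. Qed.

Lemma iter_derive1_plog (h : R -> R) (a : R) (c : R * R) k :
  (forall s, 0 < s -> h s = plog a c.1 c.2 s) ->
  forall s, 0 < s -> iter k (fun g : R -> R => derive1 g) h s =
    plog (a - k%:R) (plog_der a c k).1 (plog_der a c k).2 s.
Proof.
move=> hE; elim: k => [|k IH] s s0; first by rewrite subr0 /= hE.
rewrite iterS (@derive1_near _ (plog (a - k%:R) (plog_der a c k).1 (plog_der a c k).2))//.
rewrite derive1E; have [_ ->] := is_derive_plog (a - k%:R)
  (plog_der a c k).1 (plog_der a c k).2 s0.
by rewrite /= -natr1 opprD addrA.
Qed.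

(* Radial Laplacian on s^a (c.1 log s + c.2) in dimension 2 mu; on the super side
   mu = M/2, so the superdimension M replaces the dimension m. *)
Definition lap_state (mu a : R) (c : R * R) : R * R :=
  (4 * a * (a - 1 + mu) * c.1,
   4 * a * (a - 1 + mu) * c.2 + (8 * a - 4 + 4 * mu) * c.1).

Lemma plog_der_lap (mu a : R) (c : R * R) k :
  plog_der (a - 1) (lap_state mu a c) k =
  (4 * (a - k%:R) * (a - 1 + mu) * (plog_der a c k).1,
   4 * (a - k%:R) * (a - 1 + mu) * (plog_der a c k).2 +
     (8 * a - 4 * k%:R - 4 + 4 * mu) * (plog_der a c k).1).
Proof.
elim: k => [|k IH]; first by rewrite /lap_state /= mulr0 !subr0.
by rewrite [LHS]/= IH [plog_der a c k.+1]/= -natr1 /=; congr (_, _); ring.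
Qed.

Variables (d n : nat).
Local Notation m := (d.+1%:R : R).
Local Notation mu := (m / 2 - n%:R : R).
Implicit Types (A : {set 'I_(n.*2)}) (phi : 'rV[R]_d.+1 -> R).

Definition plog_dist (a : R) (c : R * R) : superdist R d.+1 n :=
  @radial_dist R d.+1 n (fun k phi =>
    plog_pair (a - k%:R) (plog_der a c k).1 (plog_der a c k).2 phi).

(** The condition on a keeps every derivative up to order n locally integrable: a - k >= 1 - m/2 for
    k <= n. *)
Lemma sf_dist_superR2 (h : R -> R) (a : R) (c : R * R) A phi :
  1 - mu <= a -> test_fun phi ->
  (forall s, 0 < s -> h s = plog a c.1 c.2 s) ->
  sf_dist (@superR2 R d.+1 n h) A phi = plog_dist a c A phi.
Proof.
move=> ha tp hE; rewrite /sf_dist /plog_dist /radial_dist.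
case pA : (paired A); last first.
  rewrite -[RHS](iint0 R d.+1); apply: eq_iint => x.
  by rewrite superR2E pA !mul0r.
have kn := npairs_le A; set k := npairs A in kn *.
have hk : 1 - m / 2 <= a - k%:R.
  have : k%:R <= n%:R :> R by rewrite ler_nat.
  lra.
rewrite -plog_pairZ//.
rewrite (_ : (fun x => _) = fun x => (fun s =>
    (-1) ^+ k * iter k (fun g : R -> R => derive1 g) h s) (r2 x) * phi x); last first.
  by apply/funext => x; rewrite superR2E pA.
apply: (@plog_pair_ext R d (fun s => (-1) ^+ k * iter k
   (fun g : R -> R => derive1 g) h s) _ _ _ phi hk tp) => s s0.
by rewrite (iter_derive1_plog k hE s0) /plog; ring.
Qed.

(** The bosonic part of coefficient k is 4 s h^(k+2) + 2 m h^(k+1), the fermionic part -4 (n - k)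
    h^(k+1). Their sum is the k-th derivative of 4 s h'' + 2 (m - 2n) h'. *)
Lemma slap_plog_dist (a : R) (c : R * R) A phi : 2 - mu <= a -> test_fun phi ->
  slap (plog_dist a c) A phi = plog_dist (a - 1) (lap_state mu a c) A phi.
Proof.
move=> ha tp; rewrite /plog_dist slap_radial /radial_dist; case pA : (paired A) => //.
have kn := npairs_le A; set k := npairs A in kn *; congr (_ * _).
have kn' : k%:R <= n%:R :> R by rewrite ler_nat.
have hk : 2 - m / 2 <= a - k%:R by lra.
rewrite /plog_pair lap_plog// -!/(plog_pair _ _ _ _) plog_der_lap.
have -> : a - k.+1%:R = a - k%:R - 1 by rewrite -natr1; ring.
have -> : a - 1 - k%:R = a - k%:R - 1 by ring.
rewrite -mulNr plog_pair_lin//; last by lra.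
by congr (plog_pair _ _ _ _); rewrite /= natrB//; field.
Qed.

(** A logarithm can survive only while the exponent is 0. The second expression is what
    [lap_plog_critical] multiplies by delta; one more derivative multiplies it by the next exponent
    -(mu + k). *)
Lemma plog_der_critical (c : R * R) k : (1 - mu) * c.1 = 0 ->
  (1 - mu - k%:R) * (plog_der (1 - mu) c k).1 = 0 /\
  (1 - mu - k%:R) * (plog_der (1 - mu) c k).2 + (plog_der (1 - mu) c k).1 =
    ((1 - mu) * c.2 + c.1) * \prod_(i < k) (- (mu + i%:R)).
Proof.
move=> h; elim: k => [|k [IH1 IH2]]; first by rewrite big_ord0 mulr1 subr0.
rewrite /= IH1 IH2 mulr0; split => //.
by rewrite addr0 big_ord_recr /= -natr1; ring.
Qed.

(** In coefficient k the exponent is 1 - mu - k. It equals the bosonic critical value 1 - m/2 for k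
    = n and is at least 2 - m/2 for k < n, where [lap_plog] applies. *)
Lemma slap_plog_dist_critical (c : R * R) A phi : (1 - mu) * c.1 = 0 -> test_fun phi ->
  slap (plog_dist (1 - mu) c) A phi =
  (paired A && (npairs A == n))%:R * (2 * m * ball_vol R d.+1 *
    \prod_(i < n) (mu + i%:R) * ((1 - mu) * c.2 + c.1)) * phi 0.
Proof.
move=> hc tp; rewrite /plog_dist slap_radial /radial_dist.
case pA : (paired A) => /=; last by rewrite !mul0r.
have kn := npairs_le A; set k := npairs A in kn *.
have [h1 h2] := plog_der_critical k hc.
case: eqP => [kE|/eqP kE].
  rewrite -kE in h1 h2 *.
  rewrite subnn mulr0 mul0r subr0 mul1r /plog_pair.
  have E : 1 - (m / 2 - k%:R) - k%:R = 1 - m / 2 by ring.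
  rewrite E in h1 h2; rewrite E lap_plog_critical// h2 prodrN card_ord.
  (* One sign comes from [radial_dist], the other from the k factors -(mu + i). *)
  have sq : (-1) ^+ k * (-1) ^+ k = 1 :> R.
    by rewrite -exprD addnn -signr_odd odd_double.
  rewrite (_ : _ * _ = ((-1) ^+ k * (-1) ^+ k) * (2 * m * ball_vol R d.+1 *
    \prod_(i < k) (m / 2 - k%:R + i%:R) * ((1 - (m / 2 - k%:R)) * c.2 + c.1) * phi 0)).
    by rewrite sq mul1r.
  by ring.
rewrite !mul0r; have ltkn : (k < n)%N by rewrite ltn_neqAle kE.
have kn' : k%:R + 1 <= n%:R :> R by rewrite natr1 ler_nat.
have hk : 2 - m / 2 <= 1 - mu - k%:R by lra.
rewrite /plog_pair lap_plog// -!/(plog_pair _ _ _ _).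
have -> : 1 - mu - k.+1%:R = 1 - mu - k%:R - 1 by rewrite -natr1; ring.
rewrite -mulNr plog_pair_lin//; last by lra.
set al := (plog_der _ c k).1 in h1 h2 *; set be := (plog_der _ c k).2 in h2 *.
have -> : 4 * (1 - mu - k%:R) * (1 - mu - k%:R - 1 + m / 2) * al +
    - (4 * (n - k)%:R) * (plog_der (1 - mu) c k.+1).1 = 0.
  rewrite /= -/al natrB//; transitivity
    (4 * (1 - mu - k%:R - 1 + m / 2 - n%:R + k%:R) * ((1 - mu - k%:R) * al)); first by ring.
  by rewrite h1 mulr0.
(* The terms in [be] cancel at the critical exponent, and what is left is a multiple of (1 - mu - k)
   al, zero by [h1]. *)
have -> : 4 * (1 - mu - k%:R) * (1 - mu - k%:R - 1 + m / 2) * be +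
    (8 * (1 - mu - k%:R) - 4 + 2 * m) * al +
    - (4 * (n - k)%:R) * (plog_der (1 - mu) c k.+1).2 = 0.
  rewrite /= -/al -/be natrB//; transitivity (4 * ((1 - mu - k%:R) * al)); first by field.
  by rewrite h1 mulr0.
by rewrite plog_pair0 mulr0.
Qed.

End SuperRecursion.

(** * Iterated super Laplacians down to the delta *)

Section ClosedForm.
Variables (R : realType) (d n : nat).
Local Notation m := (d.+1%:R : R).
Local Notation mu := (m / 2 - n%:R : R).
Implicit Types (A : {set 'I_(n.*2)}) (phi : 'rV[R]_d.+1 -> R).

(** At exponent a = j - mu a step contributes 4 a (a - 1 + mu) = 4 (j - mu)(j - 1): the factors j -
    1 build the factorial, the factors j - mu the product. *)
Lemma iter_slap_pow l be A phi : test_fun phi ->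
  iter l.+1 (@slap R d.+1 n) (plog_dist (l.+1%:R - mu) (0, be)) A phi =
  (paired A && (npairs A == n))%:R * (2 * m * ball_vol R d.+1 *
    (\prod_(i < n) (mu + i%:R)) *
    (4 ^+ l * (l`!)%:R * be * \prod_(j < l.+1) (j.+1%:R - mu))) * phi 0.
Proof.
elim: l be A phi => [|l IH] be A phi tp.
  rewrite [iter 1 _ _]/= slap_plog_dist_critical//=; last by rewrite mulr0.
  rewrite (_ : \prod_(j < 1) (j.+1%:R - mu) = 1 - mu); last by rewrite big_ord1.
  by rewrite expr0 fact0 addr0; congr (_ * _ * _); ring.
rewrite iterSr (@iter_slap_eq R d.+1 n l.+1 _ (plog_dist (l.+1%:R - mu)
   (0, 4 * (l.+2%:R - mu) * l.+1%:R * be)))//.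
  rewrite IH// [in RHS]big_ord_recr /= factS natrM [4 ^+ l.+1]exprS.
  by congr (_ * _ * _); ring.
move=> B psi tpsi; rewrite slap_plog_dist//; last first.
  by have h : 2 <= l.+2%:R :> R; [rewrite ler_nat|lra].
rewrite /lap_state /= !mulr0 addr0.
have -> : l.+2%:R - mu - 1 = l.+1%:R - mu by rewrite -[l.+2%:R]natr1; ring.
by congr (plog_dist _ (_, _)); ring.
Qed.

(** The exponent j - p reaches 0 at j = p. There the factor j - mu kills the pure power, so c.2
    leaves no trace, while the derivative of the logarithm contributes c.1 with the factor j - mu
    replaced by 1. *)
Lemma iter_slap_log l p c A phi : mu = p%:R -> (0 < p)%N -> (p <= l.+1)%N -> test_fun phi ->
  iter l.+1 (@slap R d.+1 n) (plog_dist (l.+1%:R - mu) c) A phi =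
  (paired A && (npairs A == n))%:R * (2 * m * ball_vol R d.+1 *
    (\prod_(i < n) (mu + i%:R)) *
    (4 ^+ l * (l`!)%:R * c.1 * \prod_(j < l.+1 | j.+1 != p) (j.+1%:R - mu))) * phi 0.
Proof.
move=> mup p0; elim: l c A phi => [|l IH] c A phi pl tp.
  have p1 : p = 1%N by apply/eqP; rewrite eqn_leq pl p0.
  have mu1 : mu = 1 by rewrite mup p1.
  rewrite [iter 1 _ _]/= slap_plog_dist_critical//=; last by rewrite mu1 subrr mul0r.
  rewrite (_ : \prod_(j < 1 | j.+1 != p) (j.+1%:R - mu) = 1); last first.
    by rewrite big_pred0// => j; rewrite (ord1 j) p1.
  by rewrite mu1 subrr mul0r add0r expr0 fact0 mulr1 !mul1r.
have S (B : {set 'I_(n.*2)}) (psi : 'rV[R]_d.+1 -> R) : test_fun psi ->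
    slap (plog_dist (l.+2%:R - mu) c) B psi =
    plog_dist (l.+1%:R - mu) (lap_state mu (l.+2%:R - mu) c) B psi.
  move=> tpsi; rewrite slap_plog_dist//; last first.
    by have h : 2 <= l.+2%:R :> R; [rewrite ler_nat|lra].
  by have -> : l.+2%:R - mu - 1 = l.+1%:R - mu by rewrite -[l.+2%:R]natr1; ring.
rewrite iterSr (iter_slap_eq _ S)//.
have e1 : l.+2%:R - mu - 1 + mu = l.+1%:R by rewrite -[l.+2%:R]natr1; ring.
rewrite (_ : \prod_(j < l.+2 | j.+1 != p) (j.+1%:R - mu) =
  \prod_(j < l.+1 | j.+1 != p) (j.+1%:R - mu) *
  (if l.+2 != p then l.+2%:R - mu else 1)); last first.
  by rewrite big_mkcond big_ord_recr /= -big_mkcond.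
have [pl'|pl'] := leqP p l.+1.
  rewrite IH// ifT; last by rewrite neq_ltn ltnS pl' orbT.
  rewrite /lap_state e1 [(_, _).1]/= factS natrM [4 ^+ l.+1]exprS.
  by congr (_ * _ * _); ring.
have pE : p = l.+2 by apply/eqP; rewrite eqn_leq pl pl'.
have muE : l.+2%:R - mu = 0 by rewrite mup pE subrr.
rewrite pE eqxx [in RHS]mulr1.
(* Here the exponent is 0; the logarithm disappears and the remaining steps act on a pure power. *)
have -> : lap_state mu (l.+2%:R - mu) c = (0, 4 * l.+1%:R * c.1).
  rewrite /lap_state muE !mulr0 !mul0r; congr (_, _).
  by rewrite mup pE -[l.+2%:R]natr1; ring.
rewrite iter_slap_pow// factS natrM [4 ^+ l.+1]exprS.
rewrite [X in _ = _ * (_ * (_ * X)) * _](eq_bigl xpredT); last first.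
  by move=> j; rewrite /= eqSS neq_ltn ltn_ord.
by congr (_ * _ * _); ring.
Qed.

End ClosedForm.

(** * The multiple of delta belonging to an unnormalised kernel *)

Section ShapeConstants.
Variable R : realType.

(** [nu_b] with its normalising constant left free. *)
Definition nu_shape (m j : nat) (c : R) : R -> R :=
  if odd m then pow_shape j m%:R c else even_shape m j c.

Definition pure_power (m j : nat) : bool := odd m || (j.*2 < m)%N.

Lemma nu_shapeE m j c (s : R) : 0 < s -> nu_shape m j c s =
  plog (j%:R - m%:R / 2) (if pure_power m j then 0 else - (c^-1 / 2))
    (if pure_power m j then c^-1 else 0) s.
Proof.
move=> s0; have E : ((j.*2)%:R - m%:R) / 2 = j%:R - m%:R / 2 :> R.
  by rewrite -mul2n natrM; field.
rewrite /nu_shape /even_shape /pure_power /pow_shape /log_shape /plog E.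
by case: (odd m) => /=; [|case: ifP => _]; ring.
Qed.

(* nabla^(2l) of nu_shape m (l + n) 1 is this multiple of delta. When a logarithm is present
   the factor j = M/2 of the product vanishes, and differentiating the logarithm replaces
   it by a constant. *)
Definition shape_const (m n l : nat) : R :=
  let mu := m%:R / 2 - n%:R in
  2 * m%:R * ball_vol R m * (\prod_(i < n) (mu + i%:R)) * (4 ^+ l.-1 * (l.-1)`!%:R) *
  (if pure_power m (l + n) then \prod_(j < l) (j.+1%:R - mu)
   else - (\prod_(j < l | j.+1 != (m./2 - n)%N) (j.+1%:R - mu) / 2)).

(** The exclusion of M = 0, -2, -4, ... in terms of m and n, see [admissibleP]. *)
Definition admissible (m n : nat) : bool := odd m || (n.*2 < m)%N.

Lemma iter_slap_shape (d n l : nat) (e : R) (h : R -> R) (A : {set 'I_(n.*2)})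
    (phi : 'rV[R]_d.+1 -> R) :
  (0 < l)%N -> admissible d.+1 n -> test_fun phi ->
  (forall s, 0 < s -> h s = e * nu_shape d.+1 (l + n) 1 s) ->
  iter l (@slap R d.+1 n) (sf_dist (@superR2 R d.+1 n h)) A phi =
  (paired A && (npairs A == n))%:R * (e * shape_const d.+1 n l) * phi 0.
Proof.
case: l => // l _ adm tp hE.
set mu : R := d.+1%:R / 2 - n%:R.
pose c : R * R := (if pure_power d.+1 (l.+1 + n) then 0 else - (e / 2),
                   if pure_power d.+1 (l.+1 + n) then e else 0).
have hc s : 0 < s -> h s = plog (l.+1%:R - mu) c.1 c.2 s.
  move=> s0; rewrite hE// nu_shapeE// /c /plog.
  rewrite (_ : (l.+1 + n)%:R - d.+1%:R / 2 = l.+1%:R - mu); last first.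
    by rewrite natrD /mu; ring.
  by case: ifP => _ /=; field.
have S B psi : test_fun psi -> sf_dist (@superR2 R d.+1 n h) B psi =
    plog_dist (l.+1%:R - mu) c B psi.
  move=> tpsi; apply: sf_dist_superR2 => //.
  by rewrite lerD2r ler1n.
rewrite (iter_slap_eq _ S)// /shape_const -/mu.
have [pp|pp] := boolP (pure_power d.+1 (l.+1 + n)).
  rewrite /c pp iter_slap_pow//= -/mu; congr (_ * _ * _); ring.
move: pp; rewrite /pure_power negb_or -leqNgt => /andP[ev ml].
have pE : mu = (d.+1./2 - n)%N%:R.
  have n2 : (n <= d.+1./2)%N.
    by rewrite -(doubleK n) half_leq//; move: adm; rewrite /admissible (negbTE ev); exact: ltnW.
  rewrite natrB// /mu -[in LHS](odd_double_half d.+1) (negbTE ev) add0n -mul2n natrM.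
  by field.
rewrite (@iter_slap_log R d n l (d.+1./2 - n)%N)//.
- rewrite /c /pure_power (negbTE ev) ltnNge ml /=; congr (_ * _ * _); ring.
- rewrite subn_gt0; move: adm; rewrite /admissible (negbTE ev) /=.
  by rewrite -[X in (_ < X)%N](odd_double_half d.+1) (negbTE ev) add0n ltn_double.
- rewrite leq_subLR addnC -leq_double.
  rewrite -[X in (X <= _)%N](add0n) -[X in (X + _ <= _)%N]/(false : nat) -(negbTE ev).
  by rewrite odd_double_half.
Qed.

Lemma iter_slap0 d l (T : superdist R d 0) A phi :
  iter l (@slap R d 0) T A phi = T A (iter l (@lap R d) phi).
Proof.
elim: l phi => // l IH phi; rewrite iterS slapE big_ord0 mulr0 addr0 IH.
by rewrite -iterSr.
Qed.

Lemma bos_shape d j (e : R) (h : R -> R) (phi : 'rV[R]_d.+1 -> R) :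
  (0 < j)%N -> test_fun phi ->
  (forall s, 0 < s -> h s = e * nu_shape d.+1 j 1 s) ->
  iint (fun x => h (r2 x) * iter j (@lap R d.+1) phi x) = e * shape_const d.+1 0 j * phi 0.
Proof.
move=> j0 tp hE.
have := @iter_slap_shape d 0 j e h finset.set0 phi j0.
rewrite /admissible ltn0Sn orbT addn0 => /(_ isT tp hE).
have p0 : paired (finset.set0 : {set 'I_(0.*2)}) by apply/forallP => -[].
have c0 : npairs (finset.set0 : {set 'I_(0.*2)}) = 0%N.
  by rewrite /npairs eq_card0// => -[].
rewrite p0 c0 eqxx mul1r iter_slap0 => <-; apply: eq_iint => x.
by rewrite superR2E p0 c0 /= expr0 mul1r.
Qed.

Lemma nat_half_neq (m k : nat) : odd m -> m%:R / 2 != k%:R :> R.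
Proof.
move=> om; apply/eqP => E.
have : m%:R = (k.*2)%:R :> R by rewrite -mul2n natrM -E; field.
by move/eqP; rewrite eqr_nat => /eqP mk; move: om; rewrite mk odd_double.
Qed.

(** A factor i - m/2 with 1 <= i <= j vanishes only when m is even and m/2 <= j, and precisely then
    it is left out of the product. *)
Lemma shape_const_neq0 m j : (0 < m)%N -> shape_const m 0 j != 0.
Proof.
move=> m0; rewrite /shape_const big_ord0 mulr1 subr0 addn0 subn0.
have h1 : 2 * m%:R * ball_vol R m != 0.
  by rewrite !mulf_neq0 ?pnatr_eq0 -?lt0n// gt_eqF// ball_vol_gt0.
have h2 : 4 ^+ j.-1 * (j.-1)`!%:R != 0 :> R.
  by rewrite mulf_neq0 ?expf_neq0 ?pnatr_eq0// -lt0n fact_gt0.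
apply: mulf_neq0; first exact: mulf_neq0.
have [pp|pp] := boolP (pure_power m j).
  apply/prodf_neq0 => i _; rewrite subr_eq0 eq_sym.
  case/orP: pp => [om|jm]; first exact: nat_half_neq.
  rewrite gt_eqF// ltr_pdivlMr// -natrM ltr_nat muln2.
  by apply: leq_ltn_trans jm; rewrite leq_double.
rewrite oppr_eq0 mulf_neq0 ?invr_eq0 ?pnatr_eq0//.
apply/prodf_neq0 => i ip; rewrite subr_eq0.
move: pp; rewrite /pure_power negb_or => /andP[om _].
have -> : m%:R / 2 = (m./2)%:R :> R.
  rewrite -[in LHS](odd_double_half m) (negbTE om) add0n -mul2n natrM; by field.
by rewrite eqr_nat eq_sym; apply: contra ip => /eqP->.
Qed.

(** Split the product over l + n factors: the first n are, in reverse order, the negatives of mu +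
    i, and the others become the factors j - mu after a shift by n. So the kernel of order l + n in
    dimension m fits order l on the super side. *)
Lemma shape_const_shift m n l : (0 < l)%N -> admissible m n ->
  shape_const m 0 (l + n) = (-4) ^+ n * ((l + n).-1)`!%:R / (l.-1)`!%:R * shape_const m n l.
Proof.
case: l => // l _ adm; rewrite /shape_const big_ord0 mulr1 subr0 addn0 subn0 addSn /=.
set f := (l`!)%:R; have f0 : f != 0 by rewrite pnatr_eq0 -lt0n fact_gt0.
set mu : R := m%:R / 2 - n%:R.
have P1 : \prod_(i < n) (i.+1%:R - m%:R / 2) = (-1) ^+ n * \prod_(i < n) (mu + i%:R).
  rewrite -[X in _ ^+ X]card_ord -prodrN (reindex_inj rev_ord_inj) /=.
  apply: eq_bigr => i _; rewrite -subSn// subSS natrB ?(ltnW (ltn_ord i))// /mu; ring.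
rewrite -[(-4)]mulN1r exprMn.
case: ifP => pp.
  have -> : \prod_(j < (l + n).+1) (j.+1%:R - m%:R / 2) =
     (-1) ^+ n * \prod_(i < n) (mu + i%:R) * \prod_(j < l.+1) (j.+1%:R - mu).
    rewrite -P1 -addSn addnC big_split_ord /=; congr (_ * _).
    by apply: eq_bigr => i _; rewrite -addnS natrD /mu; ring.
  rewrite exprD; field; exact: f0.
have -> : \prod_(j < (l + n).+1 | j.+1 != m./2) (j.+1%:R - m%:R / 2) =
     (-1) ^+ n * \prod_(i < n) (mu + i%:R) *
     \prod_(j < l.+1 | j.+1 != (m./2 - n)%N) (j.+1%:R - mu).
  have nm : (n < m./2)%N.
    move: pp adm; rewrite /pure_power /admissible; case om : (odd m) => //= _.
    by rewrite -[X in (_ < X)%N -> _](odd_double_half m) om add0n ltn_double.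
  rewrite -P1 -addSn addnC big_mkcond big_split_ord /=; congr (_ * _).
    apply: eq_bigr => i _; rewrite ifT//= neq_ltn.
    by rewrite (leq_ltn_trans (ltn_ord i) nm).
  rewrite [RHS]big_mkcond /=; apply: eq_bigr => i _.
  rewrite -addnS -[m./2 in LHS](subnKC (ltnW nm)) eqn_add2l.
  by case: ifP => // _; rewrite natrD /mu; ring.
rewrite exprD; field; exact: f0.
Qed.

(** All factors but the sphere area and the product of the mu + i depend on mu = M/2 only. Adding
    two dimensions turns d V_d into 2 pi V_d, so with the factor d/2 of that product a single pi is
    gained. *)
Lemma shape_const_dim M n l : (0 < M)%N ->
  shape_const (M + n.*2) n l = pi ^+ n * shape_const M 0 l.
Proof.
move=> M0; rewrite /shape_const big_ord0 mulr1 subr0 addn0 subn0.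
have M0' : 0 < M%:R :> R by rewrite ltr0n.
have E : (M + n.*2)%:R / 2 - n%:R = M%:R / 2 :> R.
  by rewrite natrD -mul2n natrM; field.
rewrite E.
have -> : pure_power (M + n.*2) (l + n) = pure_power M l.
  by rewrite /pure_power oddD odd_double addbF doubleD ltn_add2r.
have -> : ((M + n.*2)./2 - n = M./2)%N.
  by rewrite halfD odd_double andbF add0n doubleK addnK.
have V : 2 * (M + n.*2)%:R * ball_vol R (M + n.*2) * \prod_(i < n) (M%:R / 2 + i%:R) =
    pi ^+ n * (2 * M%:R * ball_vol R M).
  elim: n {E} => [|n IH]; first by rewrite big_ord0 !addn0 mulr1 expr0 mul1r.
  rewrite doubleS !addnS ball_vol_rec big_ord_recr /= exprS -[RHS]mulrA -IH.
  have n0 : 0 <= n%:R :> R by [].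
  have -> : (M + n.*2).+2%:R = M%:R + 2 * n%:R + 2 :> R.
    by rewrite -addn2 !natrD -mul2n natrM.
  have -> : (M + n.*2)%:R = M%:R + 2 * n%:R :> R by rewrite natrD -mul2n natrM.
  field; lra.
by rewrite V; ring.
Qed.

End ShapeConstants.

(** * A test function that does not vanish at the origin *)

Section Bump.
Variable R : realType.

Lemma is_derive0_quadratic (f : R -> R) (C : R) :
  (forall h, `|f h| <= C * h ^+ 2) -> is_derive (0 : R) (1 : R) f 0.
Proof.
move=> fC; have C0 : 0 <= C.
  by have := fC 1; rewrite expr1n mulr1; apply: le_trans.
have f0 : f 0 = 0.
  by apply/eqP; rewrite -normr_le0; have := fC 0; rewrite expr0n mulr0.
have cv : (fun h : R => h^-1 *: ((f \o shift 0) (h *: (1 : R)) - f 0)) @ 0^' --> (0 : R).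
  apply/cvgrPdist_le => e e0; near=> h.
  rewrite /= f0 subr0 addr0 [h%:A]mulr1 sub0r normrN normrM normfV.
  have h0 : 0 < `|h| by rewrite normr_gt0; near: h; exact: nbhs_dnbhs_neq.
  rewrite ler_pdivrMl// (le_trans (fC h))// -real_normK ?num_real// expr2 mulrA mulrC.
  rewrite ler_pM2l//.
  have : `|h| <= e / (C + 1) by near: h; apply: dnbhs0_le; rewrite divr_gt0// ltr_wpDl.
  rewrite ler_pdivlMr ?ltr_wpDl// => H; apply: le_trans H; nra.
by split; [apply/cvg_ex; exists 0|exact: cvg_lim].
Unshelve. all: by end_near. Qed.

(* The family flat k is closed under differentiation, all of its members being flat at 0. *)
Definition flat (k : nat) (s : R) : R :=
  if s < 0 then (- s)^-1 ^+ k * expR (s^-1) else 0.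

(** For v = -1/s > 0 this is v^(k+2) exp(-v) <= (k+2)!. A quadratic bound gives derivative 0 at the
    gluing point s = 0. *)
Lemma flat_quadratic k s : `|flat k s| <= (k.+2)`!%:R * s ^+ 2.
Proof.
rewrite /flat; case: ifP => s0; last by rewrite normr0 mulr_ge0// sqr_ge0.
set v := (- s)^-1; have v0 : 0 < v by rewrite invr_gt0 oppr_gt0.
have -> : s^-1 = - v by rewrite /v invrN opprK.
have -> : s ^+ 2 = v^-1 ^+ 2 by rewrite /v invrK sqrrN.
rewrite ger0_norm; last by rewrite mulr_ge0 ?expR_ge0// exprn_ge0// ltW.
have := exprn_le_fact_expR k.+2 (ltW v0).
move=> H; rewrite expRN exprVn ler_pdivrMr ?expR_gt0// mulrAC ler_pdivlMr ?exprn_gt0//.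
by rewrite -exprD addn2.
Qed.

Lemma is_derive_flat k (s : R) :
  is_derive (s : R) (1 : R) (flat k) (k%:R * flat k.+1 s - flat k.+2 s).
Proof.
have [s0|s0|->] := ltgtP s 0.
- have sn : s != 0 by rewrite lt_eqF.
  apply: (@near_eq_is_derive R R^o R^o (fun s => (- s)^-1 ^+ k * expR (s^-1))).
    by near=> t; rewrite /flat ifT//; near: t; exact: lt_nbhsl.
  have dV : is_derive (s : R) (1 : R) (fun u : R => u^-1) (- (s ^- 2)).
    have := is_deriveV sn (is_derive_idR s).
    by move=> H; apply: is_derive_eq H _; rewrite /GRing.scale /= mulr1.
  have dE := is_derive1_comp (is_derive_expR (s^-1)) dV.
  have dN : is_derive (s : R) (1 : R) (fun u : R => (- u)^-1) (s ^- 2).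
    rewrite (_ : (fun u : R => (- u)^-1) = fun u => (-1) * u^-1).
      have := is_derive_cmulR (-1) dV.
      by move=> H; apply: is_derive_eq H _; rewrite mulrNN mul1r.
    by apply/funext => u; rewrite invrN mulN1r.
  have := is_deriveM (is_deriveX k dN) dE.
  rewrite exprfctE.
  move=> H; apply: is_derive_eq H _; rewrite /flat s0 /GRing.scale /=.
  case: k => [|k].
    rewrite !expr0 !mul0r mulr0 addr0 sub0r mul1r; field; exact: sn.
  rewrite /= !exprS; field; rewrite ?oppr_eq0 sn//.
- rewrite /flat ltNge (ltW s0) /= mulr0 subr0.
  apply: (@near_eq_is_derive R R^o R^o (fun=> 0)); last first.
  by near=> t; rewrite ifF//; apply/negbTE; rewrite -leNgt ltW//; near: t; exact: lt_nbhsr.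
- rewrite /flat ltxx mulr0 subr0; apply: is_derive0_quadratic; exact: (flat_quadratic k).
Unshelve. all: by end_near. Qed.

Variable d : nat.

(** For k = 0 this is the usual bump exp(1 / (r^2 - 1)) on the unit ball. *)
Definition flat_radial k (x : 'rV[R]_d) : R := flat k (r2 x + -1).

(** An algebra of differentiable functions closed under partial derivatives; membership therefore
    yields derivatives of all orders without computing them. *)
Inductive bump_algebra : ('rV[R]_d -> R) -> Prop :=
| bump_algebra_cst c : bump_algebra (fun=> c)
| bump_algebra_coord i : bump_algebra (fun x => x 0 i)
| bump_algebra_flat k : bump_algebra (flat_radial k)
| bump_algebraD f g : bump_algebra f -> bump_algebra g -> bump_algebra (fun x => f x + g x)
| bump_algebraM f g : bump_algebra f -> bump_algebra g -> bump_algebra (fun x => f x * g x).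

Lemma differentiable_r2 (x : 'rV[R]_d) : differentiable (@r2 R d) x.
Proof.
rewrite (_ : @r2 R d = \sum_(i < d) (fun y : 'rV[R]_d => y 0 i) ^+ 2).
  elim/big_ind: _ => [|f g|i _]; [exact: differentiable_cst|exact: differentiableD|].
  by apply: differentiableX; exact: differentiable_coord.
by apply/funext => y; rewrite fct_sumE; apply: eq_bigr => i _; rewrite !expr2.
Qed.

Lemma differentiable_bump_algebra f x : bump_algebra f -> differentiable f x.
Proof.
elim=> [c|i|k|{}f g _ df _ dg|{}f g _ df _ dg].
- exact: differentiable_cst.
- exact: differentiable_coord.
- apply: (@differentiable_comp R 'rV[R]_d R^o R^o (fun x => r2 x + -1) (flat k)).
    by apply: (differentiableD (differentiable_r2 x)); exact: differentiable_cst.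
  by apply/derivable1_diffP; have [] := is_derive_flat k (r2 x + -1).
- exact: differentiableD.
- exact: differentiableM.
Qed.

Lemma derive_bump_algebra f i : bump_algebra f -> bump_algebra ('D_(ebasis R i) f).
Proof.
have E (F G : 'rV[R]_d -> R) : (forall x, is_derive x (ebasis R i) F (G x)) ->
    bump_algebra G -> bump_algebra ('D_(ebasis R i) F).
  by move=> h; rewrite (_ : 'D_(ebasis R i) F = G)//; apply/funext => x; have [] := h x.
have D F x : bump_algebra F -> is_derive x (ebasis R i) F ('D_(ebasis R i) F x).
  move=> bF; split => //; exact/diff_derivable/differentiable_bump_algebra.
elim=> [c|j|k|{}f g bf bDf bg bDg|{}f g bf bDf bg bDg].
- by apply: (E _ (fun=> 0)) (bump_algebra_cst 0) => x; exact: is_derive_cst.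
- apply: (E _ (fun=> (j == i)%:R)); last exact: bump_algebra_cst.
  move=> x; apply: is_derive_of_line.
  rewrite (_ : (fun s => _) = fun s => x 0 j + (j == i)%:R * s); last first.
    by apply/funext => s; rewrite !mxE eqxx /= mulrC.
  have := is_derive_addR (is_derive_cstR (x 0 j) 0)
    (is_derive_cmulR ((j == i)%:R) (is_derive_idR 0)).
  by move=> H; apply: is_derive_eq H _; rewrite add0r mulr1.
- apply: (E _ (fun x => 2 * x 0 i * (k%:R * flat_radial k.+1 x + -1 * flat_radial k.+2 x))).
    move=> x; rewrite mulN1r; apply: is_derive_radial; exact: is_derive_flat.
  by do ?[apply: bump_algebraM|apply: bump_algebraD|exact: bump_algebra_cst
    |exact: bump_algebra_coord|exact: bump_algebra_flat].
- apply: (E _ (fun x => 'D_(ebasis R i) f x + 'D_(ebasis R i) g x)).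
    by move=> x; apply: is_deriveD; exact: D.
  exact: bump_algebraD.
- apply: (E _ (fun x => f x * 'D_(ebasis R i) g x + g x * 'D_(ebasis R i) f x)).
    by move=> x; apply: is_deriveM; exact: D.
  by apply: bump_algebraD; exact: bump_algebraM.
Qed.

Lemma exists_test_fun_neq0 : exists2 phi : 'rV[R]_d -> R, test_fun phi & phi 0 != 0.
Proof.
exists (flat_radial 0); last first.
  rewrite /flat_radial /flat /r2 big1; last by move=> i _; rewrite mxE expr0n.
  by rewrite add0r ltrN10 expr0 mul1r gt_eqF// expR_gt0.
split.
  move=> s x; apply: differentiable_bump_algebra.
  elim: s => [|i s IH] /=; [exact: bump_algebra_flat|exact: derive_bump_algebra].
have cK := @compact_r2_le R d 1.
apply: (subclosed_compact _ cK); first exact: closed_closure.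
have clK : closed [set x : 'rV[R]_d | r2 x <= 1].
  by apply: compact_closed cK; exact: norm_hausdorff.
rewrite [X in _ `<=` X](closure_id _).1//; apply: closureS => x /=.
rewrite /flat_radial /flat; case: ifP; last by rewrite eqxx.
by rewrite subr_lt0 => /ltW.
Qed.

End Bump.

(** * Identification of the bosonic constants *)

Section Normalisation.
Variable R : realType.

Lemma nu_shape_scale m j c (s : R) : nu_shape m j c s = c^-1 * nu_shape m j 1 s.
Proof.
rewrite /nu_shape /even_shape /pow_shape /log_shape invr1.
by case: ifP => _; [|case: ifP => _]; ring.
Qed.

(** The direction from left to right tests with a bump function and divides by its nonzero value at
    0. *)
Lemma nu_shape_fundsol m j c : (0 < m)%N -> (0 < j)%N ->
  bos_fundsol m j (@nu_shape R m j c) <-> c^-1 * shape_const R m 0 j = (-1) ^+ j.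
Proof.
case: m => // d _ j0.
have E phi : test_fun phi -> _ := fun tp =>
  @bos_shape R d j c^-1 (nu_shape d.+1 j c) phi j0 tp (fun s _ => nu_shape_scale d.+1 j c s).
split=> [H|H phi tp]; last by rewrite E// H.
have [phi tp phi0] := @exists_test_fun_neq0 R d.+1.
by apply: (mulIf phi0); rewrite -E// H.
Qed.

(** Exhibiting one admissible constant shows that the choice made by [xget] has the property; the
    equivalence [nu_shape_fundsol] then leaves a single value for it. *)
Lemma gammap_shape_const m j : (0 < m)%N -> (0 < j)%N -> ~~ odd m ->
  gammap R j.-1 m = (-1) ^+ j * shape_const R m 0 j.
Proof.
move=> m0 j0 om; have S0 := @shape_const_neq0 R m j m0.
have E : even_shape m j = @nu_shape R m j by rewrite /nu_shape (negbTE om).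
have s0 : (-1) ^+ j != 0 :> R by rewrite expf_neq0// oppr_eq0 oner_eq0.
have ss : ((-1) ^+ j)^-1 = (-1) ^+ j :> R by rewrite -exprVn invrN1.
rewrite /gammap prednK// E.
set P := [set c | _].
have [g0] : P (xget 1 P).
  apply: xgetPex; exists ((-1) ^+ j * shape_const R m 0 j); split.
    exact: mulf_neq0.
  by apply/nu_shape_fundsol => //; rewrite invfM ss -mulrA mulVf// mulr1.
move=> /(nu_shape_fundsol _ m0 j0) H.
have SE : shape_const R m 0 j = (-1) ^+ j * xget 1 P by rewrite -H mulrAC mulVf// mul1r.
by rewrite SE mulrA -expr2 sqrr_sign mul1r.
Qed.

Lemma Gamma_half (q : nat) :
  Gamma (q%:R + 2^-1 : R) = Num.sqrt pi * \prod_(j < q) (j%:R + 2^-1).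
Proof. by rewrite /Gamma ifT ?Gamma_pos_half// ltr_wpDl. Qed.

Lemma Gamma_neg_half (q : nat) : (0 < q)%N ->
  Gamma (2^-1 - q%:R : R) = Num.sqrt pi / \prod_(j < q) (2^-1 - q%:R + j%:R).
Proof.
case: q => // q _; have q0 : 0 <= q%:R :> R by [].
rewrite /Gamma ifF; last by apply/negbTE; rewrite -leNgt -[q.+1%:R]natr1; lra.
(* Hence [Gamma] shifts its argument by q + 1, which lands exactly on 1/2. *)
have -> : Num.floor (- (2^-1 - q.+1%:R) : R) = q%:Z.
  apply/eqP; rewrite floor_eq// -[q.+1%:R]natr1 /=; apply/andP; split; rewrite ?intrD; lra.
rewrite absz_nat subrK; have := Gamma_pos_half R 0.
by rewrite add0r big_ord0 mulr1 => ->.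
Qed.

Lemma half_int_neq0 (a b : nat) : a%:R - b%:R + 2^-1 != 0 :> R.
Proof.
apply/eqP => H; have om : odd a.*2.+1 by rewrite /= odd_double.
have /eqP := @nat_half_neq R _ b om; apply.
by rewrite -natr1 -mul2n natrM; lra.
Qed.

(** [Gamma] is defined by cases on the sign, so its functional equation has to be checked across the
    boundary; a - b + 1/2 runs through all half-integers. *)
Lemma Gamma_half_rec (a b : nat) (z : R) : z = a%:R - b%:R + 2^-1 ->
  Gamma (z + 1) = z * Gamma z.
Proof.
move=> zE; have z0 : z != 0 by rewrite zE half_int_neq0.
have [ba|ab] := leqP b a.
  have E : z = (a - b)%:R + 2^-1 by rewrite natrB.
  rewrite {1}E -addrA [2^-1 + 1]addrC addrA natr1 {2}E !Gamma_half big_ord_recr /= -E; ring.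
have [q qE] : exists q, (b - a = q.+1)%N.
  by exists (b - a).-1; rewrite prednK// subn_gt0.
have E : z = 2^-1 - q.+1%:R by rewrite -qE natrB 1?ltnW// zE; ring.
have E1 : z + 1 = 2^-1 - q%:R by rewrite E -natr1; ring.
rewrite {3}E Gamma_neg_half// big_ord_recl /= addr0 -E.
have -> : Gamma (z + 1) = Num.sqrt pi / \prod_(j < q) (z + (bump 0 j)%:R).
  rewrite E1; case: q {qE E} E1 => [|q] E1.
    by rewrite big_ord0 subr0 -[2^-1]add0r (Gamma_half 0) big_ord0 invr1.
  rewrite Gamma_neg_half//; congr (_ / _); apply: eq_bigr => i _.
  by rewrite -E1 /bump add1n -natr1; ring.
by rewrite invfM mulrCA [z * _]mulrA mulfV// mul1r.
Qed.

Lemma Gamma_half_prod (q j : nat) (z : R) : z = q%:R + 2^-1 ->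
  Gamma z = Gamma (z - j%:R) * \prod_(i < j) (z - 1 - i%:R).
Proof.
move=> zE; elim: j => [|j IH]; first by rewrite big_ord0 subr0 mulr1.
rewrite IH big_ord_recr /=.
have -> : z - j%:R = (z - j.+1%:R) + 1 by rewrite -natr1; ring.
rewrite (@Gamma_half_rec q j.+1); last by rewrite zE; ring.
by rewrite -natr1; ring.
Qed.

(** m times the ball volume is the area of the unit sphere. Both sides obey the same two-step
    recursion in the dimension, by [ball_vol_rec] and the functional equation. *)
Lemma ball_vol_Gamma (q : nat) : let m := q.*2.+1 in
  m%:R * ball_vol R m * Gamma (m%:R / 2) = 2 * pi `^ (m%:R / 2).
Proof.
have E p : (p.*2.+1)%:R / 2 = p%:R + 2^-1 :> R by rewrite -natr1 -mul2n natrM; field.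
elim: q => [|q IH] /=.
  rewrite E (Gamma_half 0) big_ord0 mulr1 ball_vol1 mul1r add0r.
  by rewrite powR12_sqrt ?pi_ge0.
have q0 : 0 <= q%:R :> R by [].
move: IH; rewrite /= !E => IH; rewrite doubleS ball_vol_rec.
have -> : pi `^ (q.+1%:R + 2^-1) = pi * pi `^ (q%:R + 2^-1) :> R.
  rewrite -natr1 addrAC powRD ?powRr1 ?pi_ge0//; first by rewrite mulrC.
  by rewrite (gt_eqF (pi_gt0 R)) implybT.
have -> : q.+1%:R + 2^-1 = q%:R + 2^-1 + 1 :> R by rewrite -natr1 addrAC.
rewrite [RHS]mulrCA -IH (@Gamma_half_rec q 0); last by rewrite subr0.
have -> : q.*2.+3%:R = 2 * q%:R + 3 :> R by rewrite -addn3 natrD -mul2n natrM.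
have -> : q.*2.+1%:R = 2 * q%:R + 1 :> R by rewrite -addn1 natrD -mul2n natrM.
field; lra.
Qed.

(** The quotient of Gamma(m/2) by Gamma(m/2 - j) is, up to sign, the product in [shape_const], and
    Gamma(m/2) is tied to the ball volume by [ball_vol_Gamma]. *)
Lemma gamma_c_shape_const m j : (0 < j)%N -> odd m ->
  gamma_c j.-1 (m%:R : R) = (-1) ^+ j * shape_const R m 0 j.
Proof.
case: j => // j _ om; have [q mE] : exists q, m = q.*2.+1.
  by exists m./2; rewrite -[LHS]odd_double_half om.
have zE : m%:R / 2 = q%:R + 2^-1 :> R by rewrite mE -natr1 -mul2n natrM; field.
have /= := ball_vol_Gamma q; rewrite -mE => V.
have G := Gamma_half_prod j.+1 zE.
rewrite /shape_const /pure_power om /= big_ord0 mulr1 subr0 /gamma_c.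
have -> : m%:R / 2 - j%:R - 1 = m%:R / 2 - j.+1%:R :> R by rewrite -natr1; ring.
have -> : \prod_(i < j.+1) (i.+1%:R - m%:R / 2) =
    (-1) ^+ j.+1 * \prod_(i < j.+1) (m%:R / 2 - 1 - i%:R) :> R.
  rewrite -[X in _ ^+ X]card_ord -prodrN; apply: eq_bigr => i _.
  by rewrite -natr1; ring.
have p0 : 2 * pi `^ (m%:R / 2) != 0 :> R.
  by rewrite mulf_neq0 ?pnatr_eq0// gt_eqF// powR_gt0 ?pi_gt0.
(* If this value were 0, so would be Gamma(m/2) by [G], and then 2 pi^(m/2) by [V]. *)
have g0 : Gamma (m%:R / 2 - j.+1%:R) != 0 :> R.
  apply: contra p0 => /eqP g0; by rewrite -V G g0 mul0r mulr0.
apply: (mulIf g0); rewrite divfK//.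
set P := \prod_(i < _) _ in G *; set Z := Gamma (_ - _) in G *.
rewrite -V G; have -> : 2 ^+ j.*2.+1 = 2 * 4 ^+ j :> R.
  by rewrite exprS -mul2n exprM; congr (_ * _ ^+ _); ring.
have /= s1 := @sqrr_sign R j.+1.
transitivity (((-1) ^+ j.+1) ^+ 2 * (2 * 4 ^+ j * j`!%:R * (m%:R * ball_vol R m * (Z * P)))).
  by rewrite s1 mul1r.
by ring.
Qed.

Definition nu_const (m j : nat) : R :=
  if odd m then gamma_c j.-1 m%:R else gammap R j.-1 m.

Lemma nu_bE m j : nu_b m j = nu_shape m j (nu_const m j).
Proof. by rewrite /nu_b /nu_shape /nu_const; case: (odd m). Qed.

Lemma nu_const_shape_const m j : (0 < m)%N -> (0 < j)%N ->
  nu_const m j = (-1) ^+ j * shape_const R m 0 j.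
Proof.
move=> m0 j0; rewrite /nu_const; case: ifP => om.
  exact: gamma_c_shape_const.
by rewrite gammap_shape_const// om.
Qed.

Lemma nu_const_shift m n l : (0 < m)%N -> (0 < l)%N -> admissible m n ->
  nu_const m (l + n) = (-1) ^+ l * 4 ^+ n * ((l + n).-1)`!%:R / (l.-1)`!%:R * shape_const R m n l.
Proof.
move=> m0 l0 adm; rewrite nu_const_shape_const ?addn_gt0 ?l0// shape_const_shift//.
rewrite exprD -[(-4)]mulN1r exprMn.
have s1 := @sqrr_sign R n.
transitivity (((-1) ^+ n) ^+ 2 *
  ((-1) ^+ l * 4 ^+ n * ((l + n).-1)`!%:R / (l.-1)`!%:R * shape_const R m n l)).
  by ring.
by rewrite s1 mul1r.
Qed.

(** Both sides contain Gamma at the same point, z/2 - (p + n) - 1. The identity therefore holds for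
    negative superdimension z - 2n as well. *)
Lemma gamma_c_shift (p n : nat) (z : R) :
  gamma_c (p + n) z = 4 ^+ n * (p + n)`!%:R / p`!%:R * pi ^+ n * gamma_c p (z - (n.*2)%:R).
Proof.
have p0 : pi != 0 :> R by rewrite gt_eqF// pi_gt0.
rewrite /gamma_c.
have -> : (z - (n.*2)%:R) / 2 - p%:R - 1 = z / 2 - (p + n)%:R - 1.
  by rewrite natrD -mul2n natrM; field.
have -> : pi `^ (z / 2) = pi ^+ n * pi `^ ((z - (n.*2)%:R) / 2).
  rewrite -powR_mulrn ?pi_ge0// -powRD ?(negbTE p0) ?implybT//.
  by congr (_ `^ _); rewrite -mul2n natrM; field.
have -> : 2 ^+ (p + n).*2.+1 = 4 ^+ n * 2 ^+ p.*2.+1 :> R.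
  rewrite doubleD -addSn exprD mulrC -mul2n exprM; congr (_ ^+ _ * _); ring.
have f0 : p`!%:R != 0 :> R by rewrite pnatr_eq0 -lt0n fact_gt0.
set G := (Gamma _)^-1; set a := (_ + n)`!%:R; set b := p`!%:R in f0 *.
by field.
Qed.

End Normalisation.

(** * The super fundamental solution and its closed form *)

Section Main.
Variable R : realType.

Lemma absz_sub_double (m n : nat) : odd `|m%:Z - (n.*2)%:Z| = odd m.
Proof.
have [nm|mn] := leqP n.*2 m.
  by rewrite subzn// absz_nat oddB// odd_double addbF.
by rewrite distnC subzn ?(ltnW mn)// absz_nat oddB ?(ltnW mn)// odd_double.
Qed.

Lemma admissibleP (m n : nat) :
  ~ ((m%:Z - (n.*2)%:Z <= 0) /\ ~~ odd `|m%:Z - (n.*2)%:Z|%N) -> admissible m n.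
Proof.
move=> H; rewrite /admissible; have [//|om] := boolP (odd m).
rewrite ltnNge; apply/negP => mn; apply: H; split.
  by rewrite subr_le0 lez_nat.
by rewrite absz_sub_double.
Qed.

Lemma nu_super_fundsol (m n l : nat) (phi : 'rV[R]_m -> R) (A : {set 'I_(n.*2)}) :
  (0 < m)%N -> (0 < l)%N -> admissible m n -> test_fun phi ->
  iter l (@slap R m n) (sf_dist (@nu_super R m n l)) A phi =
  (-1) ^+ l * @sdelta R m n A phi.
Proof.
move=> m0 l0 adm tp.
have ln0 : (0 < l + n)%N by rewrite addn_gt0 l0.
have c0 : nu_const R m (l + n) != 0.
  by rewrite nu_const_shape_const// mulf_neq0 ?expf_neq0 ?oppr_eq0 ?oner_eq0 ?shape_const_neq0.
have F k : k`!%:R != 0 :> R by rewrite pnatr_eq0 -lt0n fact_gt0.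
case: m m0 phi adm tp c0 => // d _ phi adm tp c0.
set K : R := pi ^+ n * 2 ^+ (n.*2) * ((n + l - 1)`!)%:R / ((l - 1)`!)%:R.
rewrite /nu_super (@iter_slap_shape R d n l (K / nu_const R d.+1 (l + n)))//; last first.
  by move=> s _; rewrite nu_bE nu_shape_scale mulrA.
rewrite /sdelta gpow_xsq.
(* By [nu_const_shift] the bosonic constant is [shape_const] times the factorial quotient and the
   power of 4 in K, up to the sign (-1)^l; so all but pi^n and the sign cancel. *)
have -> : K / nu_const R d.+1 (l + n) * shape_const R d.+1 n l = (-1) ^+ l * pi ^+ n.
  have E := @nu_const_shift R d.+1 n l isT l0 adm.
  have S0 : shape_const R d.+1 n l != 0.
    by apply: contra c0 => /eqP S0; rewrite E S0 mulr0.
  apply: (mulIf c0); rewrite mulrAC divfK// E /K addnC !subn1.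
  have -> : 2 ^+ n.*2 = 4 ^+ n :> R by rewrite -mul2n exprM; congr (_ ^+ _); ring.
  set a := ((l + n).-1)`!%:R; set b := (l.-1)`!%:R.
  have b0 : b != 0 by exact: F.
  transitivity (((-1) ^+ l) ^+ 2 * (pi ^+ n * 4 ^+ n * a / b * shape_const R d.+1 n l)).
    by rewrite sqrr_sign mul1r.
  by field.
by field; exact: F.
Qed.

(** Both sides have the same shape, since 2 (l + n) - m = 2 l - M, so only the constants are
    compared: for odd M by [gamma_c_shift], for even M > 0 through [shape_const_dim]. *)
Lemma nu_super_case (m n l : nat) (s : R) : (0 < m)%N -> (0 < l)%N -> admissible m n ->
  pi ^+ n * 2 ^+ (n.*2) * ((n + l - 1)`!)%:R / ((l - 1)`!)%:R * nu_b m (l + n) s =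
  nu_case (m%:Z - (n.*2)%:Z) l s.
Proof.
move=> m0 l0 adm; rewrite addnC !subn1.
have -> : 2 ^+ n.*2 = 4 ^+ n :> R by rewrite -mul2n exprM; congr (_ ^+ _); ring.
rewrite /nu_case absz_sub_double nu_bE nu_shape_scale.
have a0 : ((l + n).-1)`!%:R != 0 :> R by rewrite pnatr_eq0 -lt0n fact_gt0.
have b0 : (l.-1)`!%:R != 0 :> R by rewrite pnatr_eq0 -lt0n fact_gt0.
have p0 : pi ^+ n != 0 :> R by rewrite expf_neq0// gt_eqF// pi_gt0.
have f0 : 4 ^+ n != 0 :> R by rewrite expf_neq0.
have K0 : pi ^+ n * 4 ^+ n * ((l + n).-1)`!%:R / (l.-1)`!%:R != 0 :> R.
  by rewrite !mulf_neq0// invr_eq0.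
case: (boolP (odd m)) => om.
  rewrite /nu_const /nu_shape om /pow_shape.
  have -> : (m%:Z - (n.*2)%:Z)%:~R = m%:R - (n.*2)%:R :> R by rewrite intrB.
  have -> : (l + n).-1 = (l.-1 + n)%N by case: l l0 {a0 b0 K0}.
  rewrite gamma_c_shift.
  have -> : ((l + n).*2)%:R - m%:R = (l.*2)%:R - (m%:R - (n.*2)%:R) :> R.
    by rewrite doubleD natrD; ring.
  rewrite divr1; move: (gamma_c _ (_ - _)) => G.
  have -> : (l.-1 + n)%N = (l + n).-1 by case: l l0 {a0 b0 K0}.
  rewrite !invfM invrK; move: a0 b0 p0 f0.
  set a := ((l + n).-1)`!%:R; set b := (l.-1)`!%:R.
  set p := pi ^+ n; set f := 4 ^+ n; move: (G^-1) => H a0 b0 p0 f0.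
  by field; rewrite a0 b0 p0 f0.
have nm : (n.*2 < m)%N by move: adm; rewrite /admissible (negbTE om).
have [k mE] : exists k, m = (k + n.*2)%N by exists (m - n.*2)%N; rewrite subnK// ltnW.
have k0 : (0 < k)%N by move: nm; rewrite mE -[X in (X < _)%N]add0n ltn_add2r.
have ok : ~~ odd k by move: om; rewrite mE oddD odd_double addbF.
rewrite mE PoszD addrK -mE.
have -> : even_shape k l (gammap R l.-1 k) s = (gammap R l.-1 k)^-1 * nu_shape k l 1 s.
  by rewrite -nu_shape_scale /nu_shape (negbTE ok).
have -> : nu_shape m (l + n) 1 s = nu_shape k l 1 s.
  rewrite /nu_shape (negbTE om) (negbTE ok) /even_shape mE doubleD ltn_add2r.
  rewrite /pow_shape /log_shape (_ : _ - (k + n.*2)%:R = (l.*2)%:R - k%:R :> R)//.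
  by rewrite doubleD !natrD; ring.
have -> : nu_const R m (l + n) =
    pi ^+ n * 4 ^+ n * ((l + n).-1)`!%:R / (l.-1)`!%:R * gammap R l.-1 k.
  rewrite nu_const_shift// mE shape_const_dim// gammap_shape_const//; ring.
by rewrite invfM mulrA mulVKf// ?mulfV// mulrA.
Qed.

End Main.

Theorem theorem16 (R : realType) (m n l : nat) :
  (1 <= m)%N -> (1 <= l)%N ->
  ~ ((m%:Z - (n.*2)%:Z <= 0) /\ ~~ odd `|m%:Z - (n.*2)%:Z|%N) ->
  (forall (phi : 'rV[R]_m -> R), test_fun phi ->
     forall A : {set 'I_(n.*2)},
       iter l (@slap R m n) (@sf_dist R m n (@nu_super R m n l)) A phi
       = (-1) ^+ l * @sdelta R m n A phi)
  /\
  (forall (A : {set 'I_(n.*2)}) (x : 'rV[R]_m), x != 0 ->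
     @nu_super R m n l A x
     = @superR2 R m n (@nu_case R (m%:Z - (n.*2)%:Z) l) A x).
Proof.
move=> m0 l0 /admissibleP adm; split=> [phi tp A|A x _].
  exact: nu_super_fundsol.
rewrite /nu_super; congr (superR2 _ A x); apply/funext => s.
exact: nu_super_case.
Qed.
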